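(* If $$\max_{1\le j\le N}\mathrm{cap}(F^{(j)})<\frac{5d}{24\pi},$$ then the matrix $I+SD$ is invertible and the column vector $(C_1,\dots,C_N)^T=-(I+SD)^{-1}V_f$ satisfies the estimate $$\sum_{j=1}^N\mathrm{cap}(F^{(j)})\,C_j^2\le\Big(1-\frac{24\pi}{5d}\max_{1\le j\le N}\mathrm{cap}(F^{(j)})\Big)^{-2}\sum_{j=1}^N\mathrm{cap}(F^{(j)})\,\big(v_f(O^{(j)})\big)^2.$$
   Context: Geometry. $\Omega\subset\mathbb{R}^3$ is an arbitrary domain; $N\ge 2$; $F^{(1)},\dots,F^{(N)}$ are pairwise disjoint compact subsets of $\Omega$ of positive harmonic capacity, and $O^{(j)}\in F^{(j)}$ are points. $\varepsilon_j$ is the diameter of $F^{(j)}$ (small compared to the diameter of $\Omega$), and $$\varepsilon=\max_{1\le j\le N}\varepsilon_j,\qquad d=\tfrac12\min_{i\ne j,\,1\le i,j\le N}|O^{(j)}-O^{(i)}|.$$ It is assumed throughout that $\varepsilon<c_0 d$ with $c_0$ a sufficiently small constant. There is an open set $\omega\subset\Omega$ with $\bigcup_{j=1}^N F^{(j)}\subset\omega$, $\mathrm{diam}(\omega)=1$, $\mathrm{dist}(\partial\omega,\partial\Omega)\ge 2d$ and $\mathrm{dist}\big(\bigcup_{j=1}^N F^{(j)},\partial\omega\big)\ge 2d$. Data. $f$ is a smooth function with compact support in $\Omega$ whose support has diameter bounded by an absolute constant, and $v_f$ is the variational solution of $-\Delta v_f=f$ in $\Omega$, $v_f=0$ on $\partial\Omega$.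 Auxiliary functions. $P^{(j)}$ is the harmonic capacitary potential of $F^{(j)}$: the unique variational solution of $\Delta P^{(j)}=0$ in $\mathbb{R}^3\setminus F^{(j)}$, $P^{(j)}=1$ on $\partial(\mathbb{R}^3\setminus F^{(j)})$, $P^{(j)}(x)=O(\varepsilon|x-O^{(j)}|^{-1})$ as $\varepsilon^{-1}|x-O^{(j)}|\to\infty$. The harmonic capacity is $\mathrm{cap}(F^{(j)})=\frac1{4\pi}\int_{\mathbb{R}^3\setminus F^{(j)}}|\nabla P^{(j)}|^2\,dx$. $G(x,y)$ is Green's function of the Dirichlet problem for $-\Delta$ in $\Omega$ ($\Delta_xG(x,y)+\delta(x-y)=0$ for $x,y\in\Omega$; $G(x,y)=0$ for $x\in\partial\Omega$, $y\in\Omega$). Matrices. $I$ is the $N\times N$ identity matrix, $S=\{(1-\delta_{ik})G(O^{(k)},O^{(i)})\}_{i,k=1}^N$ (zero diagonal), $D=4\pi\,\mathrm{diag}\{\mathrm{cap}(F^{(1)}),\dots,\mathrm{cap}(F^{(N)})\}$, and $V_f=(v_f(O^{(1)}),\dots,v_f(O^{(N)}))^T$. *)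

(* Defs.v *)
From HB Require Import structures.
From mathcomp Require Import all_boot all_order all_algebra.
From mathcomp Require Import all_classical all_reals all_analysis.
From mathcomp Require Import measurable_realfun.

Set Implicit Arguments.
Unset Strict Implicit.
Unset Printing Implicit Defensive.

Import Order.TTheory GRing.Theory Num.Theory.
Import numFieldNormedType.Exports.

Local Open Scope classical_set_scope.
Local Open Scope ring_scope.

(* The library norm on R * R * R is the max norm; its topology and its product
   sigma-algebra are the Euclidean topology and the Borel sets of R^3.  The
   Euclidean length is [enorm] below. *)
Notation R3 R := (R * R * R)%type.

(* The library proves this fact, but its canonical sigma-finite structure on a
   product measure is only found for products of subprobabilities. *)
Lemma sigma_finite_prod d1 d2 (T1 : measurableType d1) (T2 : measurableType d2)
    (R : realType) (m1 : {sigma_finite_measure set T1 -> \bar R})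
    (m2 : {sigma_finite_measure set T2 -> \bar R}) :
  sigma_finite setT (m1 \x m2)%E.
Proof.
have /sigma_finiteP[F [TF ndF Foo]] := sigma_finiteT m1.
have /sigma_finiteP[G [TG ndG Goo]] := sigma_finiteT m2.
exists (fun n => F n `*` G n).
  rewrite -setXTT TF TG predeqE => -[x y]; split.
    move=> [/= [n _ Fnx] [k _ Gky]]; exists (maxn n k) => //; split.
    - by move: x Fnx; exact/subsetPset/ndF/leq_maxl.
    - by move: y Gky; exact/subsetPset/ndG/leq_maxr.
  by move=> [n _ []/= ? ?]; split; exists n.
move=> k; have [? ?] := Foo k; have [? ?] := Goo k.
split; first exact: measurableX.
by rewrite product_measure1E// lte_mul_pinfty// ge0_fin_numE.
Qed.

Definition leb2 (R : realType) :
    set (measurableTypeR R * measurableTypeR R) -> \bar R :=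
  (@lebesgue_measure R \x @lebesgue_measure R)%E.

HB.instance Definition _ (R : realType) := Measure.on (@leb2 R).
HB.instance Definition _ (R : realType) :=
  Measure_isSigmaFinite.Build _ _ _ (@leb2 R)
    (sigma_finite_prod (@lebesgue_measure R) (@lebesgue_measure R)).

Definition leb3 (R : realType) : set (R3 (measurableTypeR R)) -> \bar R :=
  (@leb2 R \x @lebesgue_measure R)%E.

HB.instance Definition _ (R : realType) := Measure.on (@leb3 R).
HB.instance Definition _ (R : realType) :=
  Measure_isSigmaFinite.Build _ _ _ (@leb3 R)
    (sigma_finite_prod (@leb2 R) (@lebesgue_measure R)).

Section Euclidean.
Context {R : realType}.
Implicit Types (x y : R3 R) (A B : set (R3 R)).

Definition dot x y : R := x.1.1 * y.1.1 + x.1.2 * y.1.2 + x.2 * y.2.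

Definition enorm x : R := Num.sqrt (dot x x).

Definition ediam A : \bar R :=
  ereal_sup [set (enorm (p.1 - p.2))%:E | p in A `*` A].

Definition set_dist A B : \bar R :=
  ereal_inf [set (enorm (p.1 - p.2))%:E | p in A `*` B].

Definition boundary A : set (R3 R) := closure A `\` A°.

Definition domain A : Prop := [/\ A !=set0, open A & connected A].

End Euclidean.

Section Calculus.
Context {R : realType}.
Implicit Types (f : R3 R -> R) (U : set (R3 R)).

Definition basis3 (i : 'I_3) : R3 R :=
  ((i == 0)%:R, (i == 1)%:R, (i == 2%:R)%:R).

Definition partial (i : 'I_3) f : R3 R -> R := 'D_(basis3 i) f.

Definition grad f (x : R3 R) : R3 R :=
  (partial 0 f x, partial 1 f x, partial 2%:R f x).

Definition laplacian f (x : R3 R) : R :=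
  \sum_(i < 3) partial i (partial i f) x.

(* C^infty(R^3): all iterated partial derivatives exist and are continuous *)
Definition smooth f : Prop :=
  forall s : seq 'I_3, let g := foldr partial f s in
    continuous g /\ forall i x, derivable g x (basis3 i).

Definition supp f : set (R3 R) := closure [set x | f x != 0].

(* C_c^infty(U) *)
Definition test_function U f : Prop :=
  [/\ smooth f, compact (supp f) & supp f `<=` U].

End Calculus.

Section Variational.
Context {R : realType}.
Implicit Types (f v : R3 R -> R) (dv : R3 R -> R3 R) (U F : set (R3 R)).

Local Notation mu := (@leb3 R).

(* The completion of C_c^infty(U) in the Dirichlet norm |grad v|_{L^2(U)},
   realized through the Sobolev embedding in L^6(U).  An element is given as a
   function v together with its weak gradient dv. *)
Definition dirichlet_space U v dv : Prop :=
  [/\ measurable_fun U v, measurable_fun U dv &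
   exists phi : nat -> R3 R -> R,
   [/\ forall n, test_function U (phi n),
       (fun n => \int[mu]_(x in U) (enorm (grad (phi n) x - dv x) ^+ 2)%:E)%E
         @ \oo --> (0 : \bar R)%E &
       (fun n => \int[mu]_(x in U) (`|phi n x - v x| ^+ 6)%:E)%E
         @ \oo --> (0 : \bar R)%E]].

(* - Delta v = f in U, v = 0 on the boundary of U; v is the continuous
   representative, so that its values at points of U are meaningful. *)
Definition variational_solution U f v : Prop :=
  {in U, continuous v} /\
  exists dv, dirichlet_space U v dv /\
    forall phi, test_function U phi ->
      \int[mu]_(x in U) dot (dv x) (grad phi x) =
      \int[mu]_(x in U) (f x * phi x).

(* The capacitary potential P of the compact set F, with weak gradient dP in
   the complement of F: the boundary value 1 means that P differs from a
   cutoff function eta, equal to 1 near F, by an element of the Dirichlet space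
   of the complement. *)
Definition capacitary_potential F (P : R3 R -> R) (dP : R3 R -> R3 R) : Prop :=
  [/\ {in ~` F, continuous P},
      forall phi, test_function (~` F) phi ->
        \int[mu]_(x in ~` F) dot (dP x) (grad phi x) = 0,
      exists eta, [/\ test_function setT eta,
        exists2 W, open W /\ F `<=` W & {in W, forall x, eta x = 1} &
        dirichlet_space (~` F) (P \- eta) (dP \- grad eta)] &
      exists C M : R, forall x, M <= enorm x -> `|P x| <= C / enorm x].

(* A compact F has exactly one such value c; the default 0 is never used. *)
Definition harmonic_capacity F : R :=
  xget 0 [set c | exists P dP, capacitary_potential F P dP /\
    c = (4 * pi)^-1 * \int[mu]_(x in ~` F) (enorm (dP x) ^+ 2)].

(* Delta_x G(x,y) + delta(x - y) = 0 in the sense of distributions; the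
   condition G(x,y) = 0 for x on the boundary is the variational one: G(.,y),
   cut off near its pole y, belongs to the Dirichlet space of Omega.  The value
   of G y y is irrelevant. *)
Definition green_function (Omega : set (R3 R)) (G : R3 R -> R3 R -> R) : Prop :=
  forall y, Omega y ->
  [/\ {in Omega `\ y, continuous (G^~ y)},
      forall K, compact K -> K `<=` Omega -> mu.-integrable K (EFin \o G^~ y),
      forall phi, test_function Omega phi ->
        \int[mu]_(x in Omega) (G x y * laplacian phi x) + phi y = 0 &
      forall chi, test_function Omega chi -> (\forall x \near y, chi x = 1) ->
        exists dg, dirichlet_space Omega (fun x => (1 - chi x) * G x y) dg].

End Variational.

(* Main.v *)
Require Import Defs.
From HB Require Import structures.
From mathcomp Require Import all_boot all_order all_algebra.
From mathcomp Require Import all_classical all_reals all_analysis.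
From mathcomp Require Import measurable_realfun ring lra.

(* Put q = D C.  Testing (I + S D) C = - V against D C, everything follows from
   the lower bound
     sum_(i <> k) q_i q_k G(O_k, O_i) >= - 6 / (5 d) sum_i q_i^2.
   Replace the unit charge at O_i by a smooth radial unit charge tau_i in the
   ball of radius r = 3 d / 4, and let h_i be its potential in Omega; by the mean
   value property h_i = G(., O_i) outside that ball and the average of G(., O_i)
   against tau_k is G(O_k, O_i) for k <> i.  The Gram matrix (int h_i tau_k) of
   the potentials is positive semidefinite, its off-diagonal entries are the
   values of G, and its diagonal entries are at most those in the whole space,
   which are O(1/d).  The potential h_i is built by mollifying G(., O_i) near its
   pole, so that it lies in the Dirichlet space of Omega and no regularity theory
   for harmonic functions is needed. *)

Set Implicit Arguments.
Unset Strict Implicit.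
Unset Printing Implicit Defensive.

Import Order.TTheory GRing.Theory Num.Theory.
Import numFieldNormedType.Exports.

Local Open Scope classical_set_scope.
Local Open Scope ring_scope.

(** * Lebesgue integration on R^3 *)

Section Measurability.
Context {R : realType}.
Local Notation T := (R3 (measurableTypeR R)).
Local Notation mu := (@leb3 R).

(** The charges are spread out because a point charge has infinite self-energy: only the
    off-diagonal part of the Gram matrix is wanted, and the price is its diagonal. That diagonal is
    bounded by duality instead of a maximum principle: a test function on [Omega], extended by zero,
    is one on the whole space, where Hardy's inequality for the superharmonic regularized potential
    bounds its pairing with the charge by its Dirichlet norm. The obstacle is that, beyond
    continuity off the pole, [G] is known only through a distributional equation and membership in a
    closure of test functions. Hence all derivatives are placed on test functions, and energies are
    computed for approximants, at the cost of a factor 4/3. With r = 3 d / 4, the profile bound 5/4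
    and total charge M, the diagonal is at most (4/3) (5/4) / (r M) = 20 / (9 M d). This is below 6
    / (5 d) as soon as M >= 50/27, so a crude lower bound on M replaces the evaluation M = 4 pi; and
    4 pi times 6 / (5 d) is the 24 pi / (5 d) of the theorem. *)

Definition countable_base (X : topologicalType) (M : set (set X)) :=
  exists B : nat -> set X, (forall n, M (B n)) /\
    forall x U, nbhs x U -> exists n, B n x /\ B n `<=` U.

Lemma countable_base_R :
  countable_base (@measurable _ (measurableTypeR R) : set (set R)).
Proof.
pose B n : set R := if @unpickle (rat * rat)%type n is Some (q, k)
  then ball (ratr q : R) (ratr k) else set0.
exists B; split.
  move=> n; rewrite /B; case: unpickle => [[q k]|]; last exact: measurable0.
  exact: (open_measurable (@ball_open _ _ (ratr q : R) _)).
move=> x U; rewrite nbhsE => -[V [oV Vx] VU].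
have [q [k /= [xB BV]]] := open_subball_rat oV (mem_set Vx).
exists (pickle (q, k)); rewrite /B pickleK; split; first exact: set_mem.
exact: subset_trans VU.
Qed.

(** Boxes built from a countable base of the line exhaust an open set, so the Borel sets of the
    product topology lie in the product sigma-algebra. *)
Lemma open_measurable3 (U : set (R * R * R)) : open U -> @measurable _ T U.
Proof.
have [B [mB bB]] := countable_base_R.
move=> oU.
pose C n : set (R * R * R) :=
  if @unpickle (nat * nat * nat)%type n is Some (i, j, k)
  then (B i `*` B j) `*` B k else set0.
have mC n : @measurable _ T (C n).
  rewrite /C; case: unpickle => [[[i j] k]|]; last exact: measurable0.
  by apply: measurableX; [apply: measurableX|]; exact: mB.
have -> : U = \bigcup_(n in [set n | C n `<=` U]) C n.
  apply/seteqP; split=> [x Ux|x [n /= h Cx]]; last exact: h.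
  have [[P Q] [/= nP nQ] PQ] : nbhs x U by exact: open_nbhs_nbhs.
  have [[P1 P2] [/= nP1 nP2] PP] := nP.
  have [i [Bi iP]] := bB _ _ nP1.
  have [j [Bj jP]] := bB _ _ nP2.
  have [k [Bk kP]] := bB _ _ nQ.
  have CE : C (pickle (i, j, k)) = (B i `*` B j) `*` B k by rewrite /C pickleK.
  exists (pickle (i, j, k)); rewrite /= CE // => y [[y1 y2] y3].
  apply: PQ; split; last exact: kP.
  by apply: PP; split; [exact: iP|exact: jP].
by apply: bigcup_measurable => n _; exact: mC.
Qed.

Lemma continuous_measurable3 (f : R * R * R -> R) :
  continuous f -> measurable_fun setT (f : T -> R).
Proof.
move=> /continuousP cf.
apply: (measurability _ (RGenOpens.measurableE R)) => _ [_ [a [b ->] <-]].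
by rewrite setTI; apply: open_measurable3; apply: cf; exact: interval_open.
Qed.

Lemma closed_measurable3 (F : set (R * R * R)) : closed F -> @measurable _ T F.
Proof.
move=> cF; rewrite -(setCK F); apply: measurableC.
by apply: open_measurable3; exact: closed_openC.
Qed.

Definition box (L : R) : set (R * R * R) :=
  (`[- L, L]%classic `*` `[- L, L]%classic) `*` `[- L, L]%classic.

Lemma boxP L x : box L x <-> [/\ `|x.1.1| <= L, `|x.1.2| <= L & `|x.2| <= L].
Proof.
by rewrite /box /= !in_itv /= -!ler_norml; split=> [[[]]|[]].
Qed.

Lemma compact_box L : compact (box L).
Proof. by apply: compact_setX; [apply: compact_setX|]; exact: segment_compact. Qed.

Lemma measurable_box L : @measurable _ T (box L).
Proof. by do 2! apply: measurableX => //. Qed.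

Lemma leb3_box L : (mu (box L) < +oo)%E.
Proof.
pose I : set (measurableTypeR R) := `[- L, L]%classic.
have mI : measurable I by exact: measurable_itv.
have hI : (lebesgue_measure I < +oo)%E.
  by rewrite lebesgue_measure_itv /=; case: ifP; rewrite ?ltry.
have -> : mu (box L) = (@leb2 R (I `*` I) * lebesgue_measure I)%E.
  by apply: product_measure1E => //; exact: measurableX.
have h2 : (@leb2 R (I `*` I) < +oo)%E.
  have -> : @leb2 R (I `*` I) = (lebesgue_measure I * lebesgue_measure I)%E.
    exact: product_measure1E.
  by rewrite lte_mul_pinfty // ge0_fin_numE.
by rewrite lte_mul_pinfty // ge0_fin_numE.
Qed.

Lemma compact_sub_box (K : set (R * R * R)) : compact K -> exists2 L, 0 < L & K `<=` box L.
Proof.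
move=> /compact_bounded[M [_ hM]].
exists (Num.max M 0 + 1).
  by rewrite ltr_pwDr // le_max lexx orbT.
move=> x /(hM (Num.max M 0 + 1)) h.
have /h : M < Num.max M 0 + 1 by rewrite ltr_pwDr // le_max lexx.
by move=> {}h; apply/boxP; move: h; rewrite /Num.norm /= !ge_max => /andP[/andP[]].
Qed.

Lemma bounded_on_box (f : R * R * R -> R) L : continuous f ->
  exists2 C, 0 <= C & forall x, box L x -> `|f x| <= C.
Proof.
move=> cf; have : compact (f @` box L).
  apply: continuous_compact; last exact: compact_box.
  exact: continuous_subspaceT.
move=> /compact_bounded[M [_ hM]].
exists (Num.max M 0 + 1).
  by rewrite addr_ge0 // le_max lexx orbT.
move=> x bx; apply: (hM (Num.max M 0 + 1)); last by exists x.
by rewrite ltr_pwDr // le_max lexx.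
Qed.

(** Stands for continuous with compact support, the latter stated as confinement to a box. *)
Definition ccs (f : R * R * R -> R) : Prop :=
  continuous f /\ exists L, forall x, f x != 0 -> box L x.

Definition intg (f : R * R * R -> R) : Prop := mu.-integrable setT (EFin \o f).

End Measurability.

(** Locked to keep the integral over the product measure opaque to conversion and unification. *)
HB.lock Definition Int (R : realType) (f : R * R * R -> R) : R := \int[@leb3 R]_x f x.

Section Integral.
Context {R : realType}.
Implicit Types f g h : R * R * R -> R.
Local Notation T := (R3 (measurableTypeR R)).
Local Notation mu := (@leb3 R).

Lemma ccs_bounded (f : R * R * R -> R) : ccs f -> exists2 C, 0 <= C & forall x, `|f x| <= C.
Proof.
move=> [cf [L hL]]; have [C C0 hC] := bounded_on_box L cf.
exists C => // x; have [->|/hL/hC//] := eqVneq (f x) 0.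
by rewrite normr0.
Qed.

Lemma intg_bounded_box (f : R * R * R -> R) C L : measurable_fun setT (f : T -> R) ->
  (forall x, `|f x| <= C) -> (forall x, f x != 0 -> box L x) -> intg f.
Proof.
move=> mf bf hL; rewrite /intg.
have -> : f = f \_ (box L).
  apply/funext => x; rewrite patchE; case: ifPn => // /negP xL.
  by apply/eqP; apply: contraT => /hL/mem_set/xL.
rewrite -restrict_EFin; apply/(integrable_mkcond _ (measurable_box L)).
apply: measurable_bounded_integrable.
- exact: measurable_box.
- exact: leb3_box.
- exact: measurable_funTS.
- exists C; split; first exact: num_real.
  by move=> M CM x _; exact: le_trans (bf x) (ltW CM).
Qed.

Lemma intg_ccs f : ccs f -> intg f.
Proof.
move=> cf; have [C _ bC] := ccs_bounded cf; have [c [L hL]] := cf.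
exact: (@intg_bounded_box f C L (continuous_measurable3 c)).
Qed.

Lemma intgD f g : intg f -> intg g -> intg (f \+ g).
Proof.
move=> If Ig; rewrite /intg.
have -> : EFin \o (f \+ g) = ((EFin \o f) \+ (EFin \o g))%E by [].
exact: integrableD.
Qed.

Lemma intgZ c f : intg f -> intg (fun x => c * f x).
Proof. by move=> If; apply: (integrableZl _ c If). Qed.

Lemma intgN f : intg f -> intg (fun x => - f x).
Proof.
by move=> /(intgZ (-1)); congr intg; apply/funext => x; rewrite mulN1r.
Qed.

Lemma intgB f g : intg f -> intg g -> intg (f \- g).
Proof. by move=> If /intgN; apply: intgD. Qed.

Lemma intg_norm f : intg f -> intg (fun x => `|f x|).
Proof. by move=> If; have := integrable_abse If. Qed.

Lemma intg_measurable f : intg f -> measurable_fun setT (f : T -> R).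
Proof. by move=> /measurable_int/measurable_EFinP. Qed.

Lemma intgMb f h C : intg f -> measurable_fun setT (h : T -> R) ->
  (forall x, `|h x| <= C) -> intg (fun x => f x * h x).
Proof.
move=> If mh bh; apply: (@integrableMl _ _ _ mu setT _ (EFin \o f) h) => //.
exists C; split; first exact: num_real.
by move=> M CM x _; exact: le_trans (bh x) (ltW CM).
Qed.

Lemma IntD f g : intg f -> intg g -> Int (f \+ g) = Int f + Int g.
Proof. rewrite unlock; exact: RintegralD. Qed.

Lemma IntB f g : intg f -> intg g -> Int (f \- g) = Int f - Int g.
Proof. rewrite unlock; exact: RintegralB. Qed.

Lemma IntZ c f : intg f -> Int (fun x => c * f x) = c * Int f.
Proof. rewrite unlock; exact: RintegralZl. Qed.

Lemma IntN f : intg f -> Int (fun x => - f x) = - Int f.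
Proof.
move=> If; rewrite -mulN1r -IntZ //; congr Int.
by apply/funext => x; rewrite mulN1r.
Qed.

Lemma Int0 : Int (fun=> 0 : R) = 0.
Proof.
rewrite unlock /Rintegral; have -> : (fun x : T => (0 : R)%:E) = cst 0%E by [].
by rewrite integral0.
Qed.

Lemma intg0 : intg (fun=> 0 : R).
Proof. exact: integrable0. Qed.

Lemma intg_sum (I : Type) (r : seq I) (f : I -> R * R * R -> R) :
  (forall i, intg (f i)) -> intg (fun x => \sum_(i <- r) f i x).
Proof.
move=> If; elim: r => [|i r ih].
  by under eq_fun do rewrite big_nil; exact: intg0.
by under eq_fun do rewrite big_cons; exact: intgD.
Qed.

Lemma Int_sum (I : Type) (r : seq I) (f : I -> R * R * R -> R) :
  (forall i, intg (f i)) ->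
  Int (fun x => \sum_(i <- r) f i x) = \sum_(i <- r) Int (f i).
Proof.
move=> If; elim: r => [|i r ih].
  by under eq_fun do rewrite big_nil; rewrite big_nil Int0.
under eq_fun do rewrite big_cons; rewrite big_cons -ih -IntD //.
exact: intg_sum.
Qed.

Lemma le_Int f g : intg f -> intg g -> (forall x, f x <= g x) -> Int f <= Int g.
Proof. by move=> If Ig fg; rewrite unlock; apply: le_Rintegral. Qed.

Lemma Int_ge0 f : (forall x, 0 <= f x) -> 0 <= Int f.
Proof. by move=> f0; rewrite unlock; apply: Rintegral_ge0. Qed.

Lemma ler_norm_Int f : intg f -> `|Int f| <= Int (fun x => `|f x|).
Proof. by move=> If; rewrite unlock; apply: le_normr_Rintegral. Qed.

Lemma Int_integral f : intg f -> (Int f)%:E = (\int[mu]_x (f x)%:E)%E.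
Proof. by move=> If; rewrite unlock /Rintegral fineK // integrable_fin_num. Qed.

End Integral.

(** * Smooth functions and integration by parts *)

Section Smooth.
Context {R : realType}.
Notation E := (R * R * R)%type.

(** Reduction to one variable, which gives access to the chain rule and the mean value theorem on
    the line. *)
Lemma is_derive_line (f : E -> R) (x v : E) (l : R) :
  is_derive x v f l <-> is_derive (0 : R) 1 (fun t : R => f (t *: v + x)) l.
Proof.
have eq : (fun h : R => h^-1 *: ((f \o shift x) (h *: v) - f x)) =
    (fun h : R => h^-1 *: (((fun t : R => f (t *: v + x)) \o shift 0) (h *: 1)
      - (fun t : R => f (t *: v + x)) 0)).
  apply/funext => h /=; rewrite scale0r add0r addr0.
  by rewrite -[h *: 1]/(h * 1) mulr1.
split=> -[d e]; split; move: d e; rewrite /derivable /derive.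
all: by rewrite eq.
Qed.

Lemma is_derive_line_at (f df : E -> R) (x v : E) (t : R) :
  (forall y, is_derive y v f (df y)) ->
  is_derive t 1 (fun t : R => f (t *: v + x)) (df (t *: v + x)).
Proof.
move=> /(_ (t *: v + x)) /is_derive_line [d e].
have eq : (fun h : R => h^-1 *: (((fun s : R => f (s *: v + x)) \o shift t) (h *: 1)
      - (fun t : R => f (t *: v + x)) t)) =
    (fun h : R => h^-1 *: (((fun s : R => f (s *: v + (t *: v + x))) \o shift 0) (h *: 1)
      - (fun s : R => f (s *: v + (t *: v + x))) 0)).
  apply/funext => h /=; rewrite scale0r add0r addr0.
  by rewrite addrA -scalerDl.
by split; move: d e; rewrite /derivable /derive eq.
Qed.

(* Greatest fixed point of "differentiable with derivative in the class": to
   prove smoothness it suffices to exhibit a class closed under derivation. *)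
Definition smooth1 (phi : R -> R) : Prop :=
  exists C : (R -> R) -> Prop, C phi /\ forall g, C g ->
    exists2 g', C g' & forall x : R, is_derive x 1 g (g' x).

Lemma smooth1_deriv phi : smooth1 phi ->
  exists2 phi', smooth1 phi' & forall x : R, is_derive x 1 phi (phi' x).
Proof.
move=> [C [Cphi hC]]; have [g' Cg' dg] := hC _ Cphi.
by exists g' => //; exists C.
Qed.

Lemma smooth1_intro phi phi' : smooth1 phi' ->
  (forall x : R, is_derive x 1 phi (phi' x)) -> smooth1 phi.
Proof.
move=> [C [Cp hC]] d; exists (fun f => f = phi \/ C f); split; first by left.
move=> g [->|/hC[g' Cg' dg]]; first by exists phi' => //; right.
by exists g' => //; right.
Qed.

Lemma smooth1_continuous phi : smooth1 phi -> continuous phi.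
Proof.
move=> /smooth1_deriv[p' _ d] x.
by have [dx _] := d x; apply/differentiable_continuous/derivable1_diffP.
Qed.

(** Coinduction for [smooth]: iterated partial derivatives never leave a class that is stable under
    each [partial i]. *)
Lemma smooth_class (C : (E -> R) -> Prop) :
  (forall g, C g -> continuous g /\
    forall i, exists2 g', C g' & forall x, is_derive x (basis3 i) g (g' x)) ->
  forall f, C f -> smooth f.
Proof.
move=> hC f Cf s /=.
suff : C (foldr partial f s).
  move=> /hC[c d]; split => // i x.
  by have [g' _ /(_ x)[]] := d i.
elim: s => //= i s /hC[_ /(_ i)[g' Cg' d]].
suff -> : partial i (foldr partial f s) = g' by [].
by apply/funext => x; have [_] := d x.
Qed.

Lemma smooth_continuous f : @smooth R f -> continuous f.
Proof. by move=> /(_ [::])[]. Qed.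

Lemma smooth_partial i f : @smooth R f -> smooth (partial i f).
Proof. by move=> sf s; have := sf (rcons s i); rewrite foldr_rcons. Qed.

Lemma smooth_is_derive i f x : @smooth R f ->
  is_derive x (basis3 i) f (partial i f x).
Proof. by move=> /(_ [::]) /= [_ /(_ i x) d]; exact: DeriveDef. Qed.

(** Sums, products and compositions are generated together because the product and chain rules mix
    them; this makes the class stable under derivation, as [smooth_class] demands. *)
Inductive smooth_gen : (E -> R) -> Prop :=
| gen_cst c : smooth_gen (fun=> c)
| gen_X : smooth_gen (fun x => x.1.1)
| gen_Y : smooth_gen (fun x => x.1.2)
| gen_Z : smooth_gen (fun x => x.2)
| gen_smooth f : smooth f -> smooth_gen f
| gen_add f g : smooth_gen f -> smooth_gen g -> smooth_gen (fun x => f x + g x)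
| gen_mul f g : smooth_gen f -> smooth_gen g -> smooth_gen (fun x => f x * g x)
| gen_comp phi f : smooth1 phi -> smooth_gen f -> smooth_gen (fun x => phi (f x)).

Lemma is_derive_scomp (f : E -> R) (phi : R -> R) x v l m :
  is_derive x v f l -> is_derive (f x) 1 phi m ->
  is_derive x v (fun y => phi (f y)) (m * l).
Proof.
move=> /is_derive_line df dphi; apply/is_derive_line.
have df' : is_derive (f (0 *: v + x)) 1 phi m by rewrite scale0r add0r.
exact: (is_derive1_comp df' df).
Qed.

Lemma is_derive_sadd (f g : E -> R) x v l m :
  is_derive x v f l -> is_derive x v g m ->
  is_derive x v (fun y => f y + g y) (l + m).
Proof. by move=> df dg; apply: is_deriveD. Qed.

Lemma is_derive_smul (f g : E -> R) x v l m :
  is_derive x v f l -> is_derive x v g m ->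
  is_derive x v (fun y => f y * g y) (f x * m + g x * l).
Proof. by move=> df dg; apply: is_deriveM. Qed.

Lemma is_derive_affine (a b t : R) : is_derive t 1 (fun t : R => t * a + b) a.
Proof.
have d1 := @is_deriveM R R (id : R -> R) (cst a) t 1 _ _
  (is_derive_id _ _) (is_derive_cst _ _ _).
have d2 := @is_deriveD R R R _ _ t 1 _ _ d1 (is_derive_cst b _ _).
by apply: (is_derive_eq d2); rewrite -![_ *: _]/(_ * _) /=; lra.
Qed.

Lemma is_derive_lin (f : E -> R) (x v : E) :
  (forall (t : R) (y z : E), f (t *: y + z) = t * f y + f z) ->
  is_derive x v f (f v).
Proof.
move=> lf; apply/is_derive_line.
have -> : (fun t => f (t *: v + x)) = (fun t : R => t * f v + f x).
  by apply/funext => t; rewrite lf.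
exact: is_derive_affine.
Qed.

Lemma smooth_gen_class g : smooth_gen g -> continuous g /\
  forall i, exists2 g', smooth_gen g' &
    forall x : E, is_derive x (basis3 i) g (g' x).
Proof.
elim=> {g} [c||||f sf|f g _ [cf df] _ [cg dg]|f g sf [cf df] sg [cg dg]
  |phi f sp sf [cf df]].
- split=> [x|i]; first exact: cvg_cst.
  by exists (fun=> 0); [exact: gen_cst|move=> x; exact: is_derive_cst].
- split=> [x|i]; first by apply: (@cvg_comp _ _ _ fst fst _ (nbhs x.1)); exact: cvg_fst.
  exists (fun=> (basis3 i).1.1); [exact: gen_cst|move=> x].
  exact: is_derive_lin.
- split=> [x|i]; first by apply: (@cvg_comp _ _ _ fst snd _ (nbhs x.1)); [exact: cvg_fst|exact: cvg_snd].
  exists (fun=> (basis3 i).1.2); [exact: gen_cst|move=> x].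
  exact: (@is_derive_lin (fun x => x.1.2)).
- split=> [x|i]; first exact: cvg_snd.
  exists (fun=> (basis3 i).2); [exact: gen_cst|move=> x].
  exact: is_derive_lin.
- split=> [|i]; first exact: smooth_continuous.
  exists (partial i f); first by apply: gen_smooth; exact: smooth_partial.
  by move=> x; exact: smooth_is_derive.
- split=> [x|i]; first by apply: cvgD; [exact: cf|exact: cg].
  have [f' sf' df'] := df i; have [g' sg' dg'] := dg i.
  exists (fun x => f' x + g' x); first exact: gen_add.
  by move=> x; exact: is_derive_sadd.
- split=> [x|i]; first by apply: cvgM; [exact: cf|exact: cg].
  have [f' sf' df'] := df i; have [g' sg' dg'] := dg i.
  exists (fun x => f x * g' x + g x * f' x).
    by apply: gen_add; apply: gen_mul.
  by move=> x; exact: is_derive_smul.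
- split=> [x|i].
    by apply: (@cvg_comp _ _ _ f phi _ (nbhs (f x))); [exact: cf|exact: smooth1_continuous].
  have [f' sf' df'] := df i; have [p' sp' dp'] := smooth1_deriv sp.
  exists (fun x => p' (f x) * f' x).
    by apply: gen_mul => //; exact: gen_comp.
  by move=> x; exact: is_derive_scomp.
Qed.

Lemma smoothG f : smooth_gen f -> smooth f.
Proof. by move=> sf; apply: (smooth_class smooth_gen_class). Qed.

Lemma partialE (i : 'I_3) (f f' : E -> R) :
  (forall x, is_derive x (basis3 i) f (f' x)) -> partial i f = f'.
Proof. by move=> d; apply/funext => x; have [_] := d x. Qed.

Lemma smooth_cst c : @smooth R (fun=> c).
Proof. by apply: smoothG; exact: gen_cst. Qed.

Lemma smoothD f g : @smooth R f -> smooth g -> smooth (fun x => f x + g x).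
Proof. by move=> sf sg; apply: smoothG; apply: gen_add; exact: gen_smooth. Qed.

Lemma smoothM f g : @smooth R f -> smooth g -> smooth (fun x => f x * g x).
Proof. by move=> sf sg; apply: smoothG; apply: gen_mul; exact: gen_smooth. Qed.

Lemma smooth_comp phi f : smooth1 phi -> @smooth R f -> smooth (fun x => phi (f x)).
Proof. by move=> sp sf; apply: smoothG; apply: gen_comp => //; exact: gen_smooth. Qed.

Lemma smoothZ c f : @smooth R f -> smooth (fun x => c * f x).
Proof. by apply: smoothM; exact: smooth_cst. Qed.

Lemma smoothB f g : @smooth R f -> smooth g -> smooth (fun x => f x - g x).
Proof.
move=> sf /(smoothZ (-1)) sg; have := smoothD sf sg.
by congr smooth; apply/funext => x; rewrite mulN1r.
Qed.

Lemma smooth_sum (I : Type) (r : seq I) (f : I -> E -> R) :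
  (forall i, smooth (f i)) -> smooth (fun x => \sum_(i <- r) f i x).
Proof.
move=> sf; elim: r => [|i r ih].
  have -> : (fun x => \sum_(i <- [::]) f i x) = fun=> 0.
    by apply/funext => x; rewrite big_nil.
  exact: smooth_cst.
have -> : (fun x => \sum_(j <- i :: r) f j x) = (fun x => f i x + \sum_(j <- r) f j x).
  by apply/funext => x; rewrite big_cons.
exact: (smoothD (sf i) ih).
Qed.

Lemma partial_cst i c : partial i (fun=> c : R) = fun=> 0.
Proof. by apply: partialE => x; exact: is_derive_cst. Qed.

Lemma partialD i f g : @smooth R f -> smooth g ->
  partial i (fun x => f x + g x) = fun x => partial i f x + partial i g x.
Proof.
by move=> sf sg; apply: partialE => x; apply: is_derive_sadd; exact: smooth_is_derive.
Qed.

Lemma partialM i f g : @smooth R f -> smooth g ->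
  partial i (fun x => f x * g x) = fun x => f x * partial i g x + g x * partial i f x.
Proof.
by move=> sf sg; apply: partialE => x; apply: is_derive_smul; exact: smooth_is_derive.
Qed.

Lemma partialZ i c f : @smooth R f ->
  partial i (fun x => c * f x) = fun x => c * partial i f x.
Proof.
move=> sf; rewrite (partialM i (smooth_cst c) sf) partial_cst.
by apply/funext => x; rewrite mulr0 addr0.
Qed.

Lemma partialB i f g : @smooth R f -> smooth g ->
  partial i (fun x => f x - g x) = fun x => partial i f x - partial i g x.
Proof.
move=> sf sg; have := partialD i sf (smoothZ (-1) sg); rewrite partialZ //.
under eq_fun do rewrite mulN1r.
by move=> ->; apply/funext => x; rewrite mulN1r.
Qed.

Lemma partial_sum (I : Type) (r : seq I) i (f : I -> E -> R) :
  (forall j, smooth (f j)) ->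
  partial i (fun x => \sum_(j <- r) f j x) = fun x => \sum_(j <- r) partial i (f j) x.
Proof.
move=> sf; elim: r => [|j r ih].
  have -> : (fun x => \sum_(i <- [::]) f i x) = fun=> 0.
    by apply/funext => x; rewrite big_nil.
  by rewrite partial_cst; apply/funext => x; rewrite big_nil.
have -> : (fun x => \sum_(k <- j :: r) f k x) = (fun x => f j x + \sum_(k <- r) f k x).
  by apply/funext => x; rewrite big_cons.
rewrite (partialD i (sf j) (smooth_sum r sf)).
by rewrite ih; apply/funext => x; rewrite big_cons.
Qed.

Lemma partial_comp i phi phi' f : (forall x : R, is_derive x 1 phi (phi' x)) -> @smooth R f ->
  partial i (fun x => phi (f x)) = fun x => phi' (f x) * partial i f x.
Proof.
by move=> d sf; apply: partialE => x; apply: is_derive_scomp => //; exact: smooth_is_derive.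
Qed.

Lemma smooth_laplacian f : @smooth R f -> smooth (laplacian f).
Proof.
by move=> sf; rewrite /laplacian; apply: smooth_sum => i; do 2! apply: smooth_partial.
Qed.

Lemma laplacianD f g : @smooth R f -> smooth g ->
  laplacian (fun x => f x + g x) = fun x => laplacian f x + laplacian g x.
Proof.
move=> sf sg; apply/funext => x; rewrite /laplacian -big_split /=.
apply: eq_bigr => i _; rewrite (partialD i sf sg).
by rewrite (partialD i (smooth_partial i sf) (smooth_partial i sg)).
Qed.

Lemma laplacianZ c f : @smooth R f ->
  laplacian (fun x => c * f x) = fun x => c * laplacian f x.
Proof.
move=> sf; apply/funext => x; rewrite /laplacian mulr_sumr.
by apply: eq_bigr => i _; rewrite (partialZ i c sf) (partialZ i c (smooth_partial i sf)).
Qed.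

Lemma laplacianB f g : @smooth R f -> smooth g ->
  laplacian (fun x => f x - g x) = fun x => laplacian f x - laplacian g x.
Proof.
move=> sf sg; have := laplacianD sf (smoothZ (-1) sg); rewrite laplacianZ //.
under eq_fun do rewrite mulN1r.
by move=> ->; apply/funext => x; rewrite mulN1r.
Qed.

End Smooth.

(** * Integration by parts for functions of bounded support *)

Section Parts.
Context {R : realType}.
Notation E := (R * R * R)%type.
Local Notation T := (R3 (measurableTypeR R)).
Local Notation leb := (@lebesgue_measure R).

(** The fundamental theorem of calculus on an interval [[-M, M]] that reaches beyond the support, so
    that both endpoint values vanish. *)
Lemma integral_derive_eq0 (u u' : R -> R) (L : R) : (forall t : R, is_derive t 1 u (u' t)) ->
  continuous u' -> (forall t, u t != 0 -> `|t| <= L) ->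
  (\int[leb]_t (u' t)%:E = 0)%E.
Proof.
move=> du cu' hL.
have u0 t : L < `|t| -> u t = 0.
  by move=> Lt; apply/eqP; apply: contraTT Lt => /hL; rewrite leNgt.
have u'0 t : L < `|t| -> u' t = 0.
  move=> Lt; have [_ <-] := du t.
  rewrite -(derive_cst (V := R) (0 : R) t 1); apply: near_eq_derive.
  have /cvgr_gt/(_ _ Lt) : Num.norm x @[x --> t] --> `|t| by exact: norm_continuous.
  by apply: filterS => y; exact: u0.
pose M : R := `|L| + 1.
have M0 : 0 < M by rewrite ltr_pwDr.
have LM : L < M by rewrite (le_lt_trans (ler_norm _)) // ltrDl.
have cu : continuous u.
  by move=> x; have [dx _] := du x; apply/differentiable_continuous/derivable1_diffP.
transitivity (\int[leb]_(t in `[(- M)%R, M]) (u' t)%:E)%E.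
  rewrite [RHS]integral_mkcond; apply: eq_integral => t _.
  rewrite patchE; case: ifPn => // tM; rewrite u'0 //.
  rewrite ltNge; apply: contra tM => tL; rewrite inE /= in_itv /= -ler_norml.
  by rewrite (le_trans tL) // ltW.
rewrite (@continuous_FTC2 _ u' u).
- by rewrite !u0 ?subee // ?normrN ger0_norm ?ltW.
- by rewrite -subr_gt0 opprK addr_gt0.
- exact: continuous_subspaceT.
- split; first by move=> x _; have [] := du x.
    by apply: cvg_at_right_filter; exact: cu.
  by apply: cvg_at_left_filter; exact: cu.
- by move=> x _; rewrite derive1E; have [] := du x.
Qed.

Definition bsupp (f : E -> R) := exists L, forall x, f x != 0 -> box L x.

Lemma bsupp0 (f : E -> R) L x : (forall x, f x != 0 -> box L x) -> ~ box L x -> f x = 0.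
Proof. by move=> h nb; apply/eqP; apply: contra_notT nb => /h. Qed.

Lemma partial_near i (f g : E -> R) x : {near x, f =1 g} -> partial i f x = partial i g x.
Proof. by move=> fg; apply: near_eq_derive. Qed.

Lemma partial_open i (U : set E) (f g : E -> R) x : open U -> U x ->
  (forall y, U y -> f y = g y) -> partial i f x = partial i g x.
Proof.
move=> oU Ux fg; apply: partial_near.
by apply: filterS (open_nbhs_nbhs (conj oU Ux)) => y; exact: fg.
Qed.

Lemma laplacian_open (U : set E) (f g : E -> R) x : open U -> U x ->
  (forall y, U y -> f y = g y) -> laplacian f x = laplacian g x.
Proof.
move=> oU Ux fg; apply: eq_bigr => i _.
by apply: (partial_open i oU Ux) => y Uy; apply: (partial_open i oU Uy).
Qed.

Lemma closed_box L : closed (box L : set E).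
Proof. by apply: compact_closed; [exact: norm_hausdorff|exact: compact_box]. Qed.

Lemma partial_box i (f : E -> R) L : (forall x, f x != 0 -> box L x) ->
  forall x, partial i f x != 0 -> box L x.
Proof.
move=> h x; apply: contra_neqP => nb.
rewrite -[RHS](derive_cst (V := E) (0 : R) x (basis3 i)).
apply: (@partial_open i (~` box L)) => //; first exact/closed_openC/closed_box.
by move=> y; exact: bsupp0.
Qed.

Lemma bsupp_partial i f : bsupp f -> bsupp (partial i f).
Proof. by move=> [L hL]; exists L; exact: partial_box. Qed.

Lemma bsuppMl (f g : E -> R) : bsupp f -> bsupp (fun x => f x * g x).
Proof.
by move=> [L hL]; exists L => x; rewrite mulf_eq0 negb_or => /andP[/hL].
Qed.

Lemma bsuppMr (f g : E -> R) : bsupp g -> bsupp (fun x => f x * g x).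
Proof.
by move=> [L hL]; exists L => x; rewrite mulf_eq0 negb_or => /andP[_ /hL].
Qed.

Lemma box_le L M : L <= M -> @box R L `<=` box M.
Proof.
by move=> LM x /boxP[a b c]; apply/boxP; split; exact: le_trans LM.
Qed.

Lemma bsuppD (f g : E -> R) : bsupp f -> bsupp g -> bsupp (fun x => f x + g x).
Proof.
move=> [L hL] [M hM]; exists (Num.max L M) => x.
have [->|/hL fL _] := eqVneq (f x) 0.
  by rewrite add0r => /hM; apply: box_le; rewrite le_max lexx orbT.
by apply: box_le fL; rewrite le_max lexx.
Qed.

Lemma bsuppZ c (f : E -> R) : bsupp f -> bsupp (fun x => c * f x).
Proof. exact: bsuppMr. Qed.

Lemma bsuppB (f g : E -> R) : bsupp f -> bsupp g -> bsupp (fun x => f x - g x).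
Proof.
move=> bf /(bsuppZ (-1)) bg; have := bsuppD bf bg.
by congr bsupp; apply/funext => x; rewrite mulN1r.
Qed.

Lemma bsupp_sum (I : Type) (r : seq I) (f : I -> E -> R) :
  (forall i, bsupp (f i)) -> bsupp (fun x => \sum_(i <- r) f i x).
Proof.
move=> sf; elim: r => [|i r ih].
  by exists 0 => x; rewrite big_nil eqxx.
have -> : (fun x => \sum_(k <- i :: r) f k x) = (fun x => f i x + \sum_(k <- r) f k x).
  by apply/funext => x; rewrite big_cons.
exact: bsuppD.
Qed.

Lemma bsupp_laplacian f : bsupp f -> bsupp (laplacian f).
Proof. by move=> bf; apply: bsupp_sum => i; do 2! apply: bsupp_partial. Qed.

Lemma ccs_smooth f : @smooth R f -> bsupp f -> ccs f.
Proof. by move=> /smooth_continuous. Qed.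

Lemma measurable_box2 L : @measurable _ (measurableTypeR R * measurableTypeR R)%type
  (`[- L, L]%classic `*` `[- L, L]%classic).
Proof. by apply: measurableX. Qed.

Lemma leb2_box (L : R) : (@leb2 R (`[(- L)%R, L]%classic `*` `[(- L)%R, L]%classic) < +oo)%E.
Proof.
pose I : set (measurableTypeR R) := `[- L, L]%classic.
have mI : measurable I by exact: measurable_itv.
have hI : (lebesgue_measure I < +oo)%E.
  by rewrite lebesgue_measure_itv /=; case: ifP; rewrite ?ltry.
have -> : @leb2 R (`[(- L)%R, L]%classic `*` `[(- L)%R, L]%classic) =
    (lebesgue_measure I * lebesgue_measure I)%E.
  exact: product_measure1E.
by rewrite lte_mul_pinfty // ge0_fin_numE.
Qed.

Lemma integrable_section (f : E -> R) (z : R) : ccs f ->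
  (@leb2 R).-integrable setT (fun p => (f (p, z))%:E).
Proof.
move=> cf; have [C _ bC] := ccs_bounded cf; have [c [L hL]] := cf.
pose B : set (measurableTypeR R * measurableTypeR R) := `[- L, L]%classic `*` `[- L, L]%classic.
pose g (p : measurableTypeR R * measurableTypeR R) : R := f (p, z).
have mg : measurable_fun setT g.
  have := measurableT_comp (continuous_measurable3 c) (@pair2_measurable _ _ _ _ z).
  exact.
have gB : g = g \_ B.
  apply/funext => p; rewrite patchE; case: ifPn => // /negP pL.
  apply/eqP; apply: contraT => /hL[+ _] /=; rewrite /B => h.
  by case: pL; apply/mem_set.
rewrite -[X in integrable _ _ X]/(EFin \o g) gB -restrict_EFin.
apply/(integrable_mkcond _ (measurable_box2 L)).
apply: measurable_bounded_integrable.
- exact: measurable_box2.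
- exact: leb2_box.
- exact: measurable_funTS.
- exists C; split; first exact: num_real.
  by move=> M CM x _; exact: le_trans (bC _) (ltW CM).
Qed.

Lemma Int_fubini_z (f : E -> R) : ccs f ->
  (forall p, \int[leb]_z (f (p, z))%:E = 0)%E -> Int f = 0.
Proof.
move=> cf h; rewrite unlock /Rintegral.
have := integral12_prod_meas1 (intg_ccs cf); rewrite /fubini_F /= => e.
have -> : (\int[leb3 (R:=R)]_x (f x)%:E = 0)%E; last by [].
apply: etrans (esym e) _.
under eq_integral do rewrite h; exact: integral0.
Qed.

Lemma Int_fubini_xy (f : E -> R) : ccs f ->
  (forall z, \int[@leb2 R]_p (f (p, z))%:E = 0)%E -> Int f = 0.
Proof.
move=> cf h; rewrite unlock /Rintegral.
have := integral21_prod_meas1 (intg_ccs cf); rewrite /fubini_G /= => e.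
have -> : (\int[leb3 (R:=R)]_x (f x)%:E = 0)%E; last by [].
apply: etrans (esym e) _.
under eq_integral do rewrite h; exact: integral0.
Qed.

Lemma continuous_line (f : E -> R) (v x : E) : continuous f ->
  continuous (fun t : R => f (t *: v + x)).
Proof.
move=> cf t; apply: (@cvg_comp _ _ _ (fun t : R => t *: v + x) f _ (nbhs (t *: v + x))); last exact: cf.
apply: cvgD; last exact: cvg_cst.
by apply: cvgZr_tmp; exact: cvg_id.
Qed.

(** Fubini with the differentiated variable innermost: each inner integral is that of the derivative
    of a compactly supported function of one variable. *)
Lemma Int_partial i f : @smooth R f -> bsupp f -> Int (partial i f) = 0.
Proof.
move=> sf bf.
have sp := smooth_partial i sf.
have cp : ccs (partial i f) by apply: ccs_smooth => //; exact: bsupp_partial.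
(* The side condition on [x] is met when its coordinate in direction [i] is zero, since [t] is then
   itself a coordinate of the moving point. *)
have key (x : E) : (forall L t, box L (t *: basis3 i + x) -> `|t| <= L) ->
    (\int[leb]_t (partial i f (t *: basis3 i + x))%:E = 0)%E.
  move=> hb; have [L hL] := bf.
  apply: (@integral_derive_eq0 (fun t => f (t *: basis3 i + x)) _ L).
  - move=> t; apply: (@is_derive_line_at _ f (partial i f)) => y.
    exact: smooth_is_derive.
  - by apply: continuous_line; exact: smooth_continuous.
  - by move=> t /hL/hb.
have b0 : basis3 (0 : 'I_3) = (1, 0, 0) :> E by [].
have b1 : basis3 (1 : 'I_3) = (0, 1, 0) :> E by [].
have b2 : basis3 (2%:R : 'I_3) = (0, 0, 1) :> E by [].
have [i0|[i1|i2]] : i = 0 \/ i = 1 \/ i = 2%:R.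
  by case: i {sp cp key} => [[|[|[|]]]] //= hi; [left|right;left|right;right]; exact/val_inj.
- apply: Int_fubini_xy => // z.
  apply: etrans (esym (integral21_prod_meas1 (integrable_section z cp))) _.
  apply: etrans (eq_integral (cst 0%E) _ _) _; last exact: integral0.
  move=> y _; rewrite /fubini_G /=.
  apply: etrans (key (0, y, z) _).
    apply: eq_integral => t _; congr ((partial i f _)%:E).
    rewrite i0 b0; congr (_, _, _) => /=.
    + by rewrite -[RHS]/(t * 1 + 0) mulr1 addr0.
    + by rewrite -[RHS]/(t * 0 + y) mulr0 add0r.
    + by rewrite -[RHS]/(t * 0 + z) mulr0 add0r.
  move=> L t /boxP[] + _ _; rewrite i0 b0 -[X in `|X| <= _]/(t * 1 + 0).
  by rewrite mulr1 addr0.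
- apply: Int_fubini_xy => // z.
  apply: etrans (esym (integral12_prod_meas1 (integrable_section z cp))) _.
  apply: etrans (eq_integral (cst 0%E) _ _) _; last exact: integral0.
  move=> y _; rewrite /fubini_F /=.
  apply: etrans (key (y, 0, z) _).
    apply: eq_integral => t _; congr ((partial i f _)%:E).
    rewrite i1 b1; congr (_, _, _) => /=.
    + by rewrite -[RHS]/(t * 0 + y) mulr0 add0r.
    + by rewrite -[RHS]/(t * 1 + 0) mulr1 addr0.
    + by rewrite -[RHS]/(t * 0 + z) mulr0 add0r.
  move=> L t /boxP[] _ + _; rewrite i1 b1 -[X in `|X| <= _]/(t * 1 + 0).
  by rewrite mulr1 addr0.
- apply: Int_fubini_z => // -[x y].
  apply: etrans (key (x, y, 0) _).
    apply: eq_integral => t _; congr ((partial i f _)%:E).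
    rewrite i2 b2; congr (_, _, _) => /=.
    + by rewrite -[RHS]/(t * 0 + x) mulr0 add0r.
    + by rewrite -[RHS]/(t * 0 + y) mulr0 add0r.
    + by rewrite -[RHS]/(t * 1 + 0) mulr1 addr0.
  move=> L t /boxP[] _ _; rewrite i2 b2 -[X in `|X| <= _]/(t * 1 + 0).
  by rewrite mulr1 addr0.
Qed.

Lemma intg_smoothM f g : @smooth R f -> smooth g -> bsupp f \/ bsupp g ->
  intg (fun x => f x * g x).
Proof.
move=> sf sg bfg; apply: intg_ccs; split; first exact: smooth_continuous (smoothM sf sg).
by case: bfg => ?; [exact: bsuppMl|exact: bsuppMr].
Qed.

Lemma Int_parts i f g : @smooth R f -> smooth g -> bsupp f \/ bsupp g ->
  Int (fun x => f x * partial i g x) = - Int (fun x => g x * partial i f x).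
Proof.
move=> sf sg bfg; apply/eqP; rewrite -addr_eq0; apply/eqP.
have I1 : intg (fun x => f x * partial i g x).
  apply: (intg_smoothM sf (smooth_partial i sg)).
  by case: bfg => h; [left|right; exact: bsupp_partial].
have I2 : intg (fun x => g x * partial i f x).
  apply: (intg_smoothM sg (smooth_partial i sf)).
  by case: bfg => h; [right; exact: bsupp_partial|left].
rewrite -(IntD I1 I2); have := partialM i sf sg.
rewrite -[fun x => _ + _]/((fun x => f x * partial i g x) \+ (fun x => g x * partial i f x)).
move=> <-; apply: (Int_partial i (smoothM sf sg)).
by case: bfg => h; [exact: bsuppMl|exact: bsuppMr].
Qed.

Lemma sum3 (h : 'I_3 -> R) : \sum_(i < 3) h i = h 0 + h 1 + h 2%:R.
Proof.
rewrite !big_ord_recl big_ord0 addr0 addrA.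
by congr (h _ + h _ + h _); exact/val_inj.
Qed.

Lemma dot_grad (f g : E -> R) x :
  dot (grad f x) (grad g x) = \sum_(i < 3) partial i f x * partial i g x.
Proof.
by rewrite sum3.
Qed.

Lemma Int_green f g : @smooth R f -> smooth g -> bsupp f \/ bsupp g ->
  Int (fun x => dot (grad f x) (grad g x)) = - Int (fun x => f x * laplacian g x).
Proof.
move=> sf sg bfg.
have -> : (fun x => dot (grad f x) (grad g x)) =
    (fun x => \sum_(i < 3) partial i f x * partial i g x).
  by apply/funext => x; exact: dot_grad.
have -> : (fun x => f x * laplacian g x) =
    (fun x => \sum_(i < 3) f x * partial i (partial i g) x).
  by apply/funext => x; rewrite mulr_sumr.
have sp i := smooth_partial i sg.
have bp i : bsupp f \/ bsupp (partial i g).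
  by case: bfg => h; [left|right; exact: bsupp_partial].
rewrite Int_sum; last first.
  move=> i; apply: (intg_smoothM (smooth_partial i sf) (sp i)).
  by case: bfg => h; [left|right]; exact: bsupp_partial.
rewrite Int_sum; last first.
  move=> i; apply: (intg_smoothM sf (smooth_partial i (sp i))).
  by case: (bp i) => h; [left|right; exact: bsupp_partial].
rewrite -sumrN; apply: eq_bigr => i _; rewrite (Int_parts i sf (sp i) (bp i)).
by rewrite opprK; congr Int; apply/funext => x; rewrite mulrC.
Qed.

Lemma Int_laplacian f g : @smooth R f -> smooth g -> bsupp f \/ bsupp g ->
  Int (fun x => f x * laplacian g x) = Int (fun x => g x * laplacian f x).
Proof.
move=> sf sg bfg; have bgf : bsupp g \/ bsupp f by case: bfg; [right|left].
have e1 := Int_green sf sg bfg; have e2 := Int_green sg sf bgf.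
apply: oppr_inj; apply: etrans (esym e1) _; apply: etrans e2.
by congr Int; apply/funext => x; rewrite !dot_grad; apply: eq_bigr => i _; rewrite mulrC.
Qed.

Lemma test_bsupp (U : set E) f : test_function U f -> bsupp f.
Proof.
move=> [_ /compact_sub_box[L _ hL] _]; exists L => x fx; apply: hL.
exact: subset_closure.
Qed.

Lemma test_functionP (U : set E) f (K : set E) : smooth f -> compact K -> K `<=` U ->
  (forall x, f x != 0 -> K x) -> test_function U f.
Proof.
move=> sf cK KU fK.
have sK : supp f `<=` K.
  have clK : closed K by apply: compact_closed => //; exact: norm_hausdorff.
  by move=> x /(closure_subset fK); rewrite -(closure_id K).1.
split => //; last exact: subset_trans KU.
by apply: (subclosed_compact _ cK) => //; exact: closed_closure.
Qed.

End Parts.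

(** * Smooth functions of one variable *)

Section OneVariable.
Context {R : realType}.

(** Serves at the flat point of [flat] and for convolutions, where integrating a quadratic error
    bound replaces a passage to the limit under the integral. *)
Lemma is_derive_sq_bound (V : normedModType R) (f : V -> R) (x v : V) (l C : R) :
  (forall t : R, `|t| <= 1 -> `|f (t *: v + x) - f x - t * l| <= C * t ^+ 2) ->
  is_derive x v f l.
Proof.
move=> h.
have cv : (fun t : R => t^-1 *: ((f \o shift x) (t *: v) - f x)) @ 0^' --> l.
  apply/cvgrPdist_le => e e0.
  have C1 : 0 < `|C| + 1 by rewrite ltr_pwDr.
  near=> t.
  have t0 : t != 0 by near: t; exact: nbhs_dnbhs_neq.
  have t1 : `|t| < Num.min 1 (e / (`|C| + 1)).
    near: t; apply: dnbhs0_lt.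
    by rewrite lt_min ltr01 divr_gt0.
  rewrite lt_min in t1; case/andP: t1 => t1 te.
  rewrite /= -[_ *: _]/(_ * _) distrC.
  have -> : t^-1 * (f (t *: v + x) - f x) - l = t^-1 * (f (t *: v + x) - f x - t * l).
    by rewrite [RHS]mulrBr mulKf.
  rewrite normrM normfV ler_pdivrMl ?normr_gt0 //.
  apply: (le_trans (h t (ltW t1))).
  rewrite -real_normK ?num_real // expr2 [leRHS]mulrC mulrA ler_wpM2r //.
  rewrite (@le_trans _ _ ((`|C| + 1) * `|t|)) //.
    by rewrite ler_wpM2r // (le_trans (ler_norm _)) // lerDl.
  by rewrite mulrC -ler_pdivlMr // ltW.
split; first by apply/cvg_ex; exists l.
exact: cvg_lim cv.
Unshelve. all: by end_near. Qed.

Lemma is_deriveM1 (f g : R -> R) (x l m : R) : is_derive x 1 f l -> is_derive x 1 g m ->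
  is_derive x 1 (fun y => f y * g y) (f x * m + g x * l).
Proof. by move=> df dg; apply: is_deriveM. Qed.

Lemma is_deriveD1 (f g : R -> R) (x l m : R) : is_derive x 1 f l -> is_derive x 1 g m ->
  is_derive x 1 (fun y => f y + g y) (l + m).
Proof. by move=> df dg; apply: is_deriveD. Qed.

Inductive smooth1_gen : (R -> R) -> Prop :=
| gen1_cst c : smooth1_gen (fun=> c)
| gen1_id : smooth1_gen id
| gen1_smooth f : smooth1 f -> smooth1_gen f
| gen1_add f g : smooth1_gen f -> smooth1_gen g -> smooth1_gen (fun x => f x + g x)
| gen1_mul f g : smooth1_gen f -> smooth1_gen g -> smooth1_gen (fun x => f x * g x)
| gen1_comp f g : smooth1 f -> smooth1_gen g -> smooth1_gen (fun x => f (g x)).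

Lemma smooth1G f : smooth1_gen f -> smooth1 f.
Proof.
move=> sf; exists smooth1_gen; split => // g; elim=> {f sf g}.
- move=> c; exists (fun=> 0); first exact: gen1_cst.
  by move=> x; exact: is_derive_cst.
- exists (fun=> 1); first exact: gen1_cst.
  by move=> x; exact: is_derive_id.
- move=> f sf; have [f' sf' df] := smooth1_deriv sf.
  by exists f' => //; exact: gen1_smooth.
- move=> f g sf [f' sf' df] sg [g' sg' dg].
  exists (fun x => f' x + g' x); first exact: gen1_add.
  by move=> x; exact: is_deriveD1.
- move=> f g sf [f' sf' df] sg [g' sg' dg].
  exists (fun x => f x * g' x + g x * f' x).
    by apply: gen1_add; exact: gen1_mul.
  by move=> x; exact: is_deriveM1.
- move=> f g sf sg [g' sg' dg]; have [f' sf' df] := smooth1_deriv sf.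
  exists (fun x => f' (g x) * g' x).
    by apply: gen1_mul => //; exact: gen1_comp.
  by move=> x; exact: (is_derive1_comp (df (g x)) (dg x)).
Qed.

Lemma smooth1_cst c : @smooth1 R (fun=> c).
Proof. by apply: smooth1G; exact: gen1_cst. Qed.

Lemma smooth1M f g : @smooth1 R f -> smooth1 g -> smooth1 (fun x => f x * g x).
Proof. by move=> sf sg; apply: smooth1G; apply: gen1_mul; exact: gen1_smooth. Qed.

Lemma smooth1D f g : @smooth1 R f -> smooth1 g -> smooth1 (fun x => f x + g x).
Proof. by move=> sf sg; apply: smooth1G; apply: gen1_add; exact: gen1_smooth. Qed.

Lemma smooth1_affine f b c : @smooth1 R f -> smooth1 (fun x => f (b * x + c)).
Proof.
move=> sf; apply: smooth1G; apply: gen1_comp => //; apply: gen1_add; last exact: gen1_cst.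
by apply: gen1_mul; [exact: gen1_cst|exact: gen1_id].
Qed.

(** The derivatives of exp(-1/t) are combinations of these functions, hence the parameter [k]. *)
Definition flat (k : nat) (t : R) : R :=
  if 0 < t then t ^- k * expR (- t^-1) else 0.

Lemma flat_ge0 k t : 0 <= flat k t.
Proof.
rewrite /flat; case: ifP => // t0.
by rewrite mulr_ge0 ?expR_ge0 // invr_ge0 exprn_ge0 // ltW.
Qed.

(** Comparison with one term of the exponential series, exp(1/t) >= (1/t)^(k+2) / (k+2)!, whose
    exponent is chosen to leave the factor t^2. *)
Lemma flat_bound k t : `|flat k t| <= k.+2`!%:R * t ^+ 2.
Proof.
rewrite ger0_norm ?flat_ge0 // /flat; case: ifPn => [t0|_]; last first.
  by rewrite mulr_ge0 ?sqr_ge0.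
have s0 : 0 < t^-1 by rewrite invr_gt0.
have := expR_ge1Dxn k.+1 (ltW s0) => /(lt_le_trans (y := 1 + t^-1 ^+ k.+2 / k.+2`!%:R)).
move=> /(_ (t^-1 ^+ k.+2 / k.+2`!%:R)); rewrite ltrDr ltr01 => /(_ isT) /ltW.
rewrite ler_pdivrMr ?ltr0n ?fact_gt0 // => h.
rewrite expRN -ler_pdivlMr ?invr_gt0 ?expR_gt0 // invrK.
have -> : t ^- k = t^-1 ^+ k.+2 * t ^+ 2.
  by rewrite -addn2 exprD -mulrA -exprMn mulVf ?gt_eqF // expr1n mulr1 exprVn.
rewrite [leRHS]mulrAC; apply: ler_wpM2r; first exact: sqr_ge0.
by rewrite mulrC.
Qed.

Lemma flat0 k t : t <= 0 -> flat k t = 0.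
Proof. by rewrite leNgt /flat => /negbTE->. Qed.

Lemma is_derive_flat k (t : R) :
  is_derive t 1 (flat k) (flat k.+2 t + - k%:R * flat k.+1 t).
Proof.
have [t0|t0|->] := ltgtP t 0.
- rewrite !flat0 ?(ltW t0) // mulr0 addr0.
  apply: (@near_eq_is_derive _ _ _ (cst 0)).
  near=> s; rewrite flat0 // ltW //; near: s; exact: lt_nbhsl.
- have E : \forall s \near t, s ^- k * expR (- s^-1) = flat k s.
    near=> s; rewrite /flat ifT //; near: s; exact: lt_nbhsr.
  have tn0 : t != 0 by rewrite gt_eqF.
  have dV : is_derive t 1 (fun s : R => s^-1) (- t ^- 2).
    apply: is_derive_eq; first exact: (@is_deriveV _ id t 1 1).
    by rewrite -[_ *: _]/(_ * _) mulr1.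
  have dX : is_derive t 1 (fun s : R => s ^- k) (- k%:R * t ^- k.+1).
    have -> : (fun s : R => s ^- k) = (fun s : R => s^-1) ^+ k.
      by apply/funext => s; rewrite -exprVn; elim: (k) => // j ih; rewrite !exprS /= ih.
    apply: (is_derive_eq (@is_deriveX R R (fun s : R => s^-1) k t 1 _ dV)).
    rewrite -[_ *: _]/(_ * _) mulrN !mulNr; congr (- _).
    rewrite -mulrA; case: (k) => [|j]; first by rewrite !mul0r.
    by congr (_ * _); rewrite -!exprVn -exprD /= addn2.
  have dE : is_derive t 1 (fun s : R => expR (- s^-1)) (expR (- t^-1) * t ^- 2).
    have dN : is_derive t 1 (fun s : R => - s^-1) (t ^- 2).
      by apply: (is_derive_eq (is_deriveN dV)); rewrite opprK.
    exact: (is_derive1_comp (is_derive_expR _) dN).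
  apply: (near_eq_is_derive E).
  apply: (is_derive_eq (is_deriveM1 dX dE)).
  rewrite /flat t0 [_ * (_ * t ^- 2)]mulrCA [_ * (t ^- k * _)]mulrC.
  have -> : t ^- k.+2 = t ^- k * t ^- 2 by rewrite -!exprVn -exprD addn2.
  by congr (_ + _); ring.
- rewrite !flat0 // mulr0 addr0.
  (* At the origin the function vanishes and the quadratic bound supplies the zero derivative. *)
  apply: (@is_derive_sq_bound _ _ _ _ _ k.+2`!%:R) => s _.
  rewrite addr0 mulr0 subr0 (flat0 k (lexx 0)) subr0 -[s *: 1]/(s * 1) mulr1.
  exact: flat_bound.
Unshelve. all: by end_near. Qed.

(** The invariant class is that of finite linear combinations of the functions [flat j], indexed by
    their number of terms. *)
Lemma smooth1_flat k : smooth1 (flat k).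
Proof.
pose C := fix C n : (R -> R) -> Prop := fun f => if n is n'.+1 then
  exists a j g, C n' g /\ f = (fun t => a * flat j t + g t) else f = cst 0.
exists (fun f => exists n, C n f); split.
  exists 1%N, 1, k, (cst 0); split => //.
  by apply/funext => t; rewrite mul1r addr0.
move=> g [n]; elim: n g => [g ->|n ih _ [a [j [g [Cg ->]]]]].
  by exists (cst 0); [exists 0%N|move=> x; exact: is_derive_cst].
have [g' [m Cg'] dg] := ih _ Cg.
exists (fun t => a * flat j.+2 t + ((a * - j%:R) * flat j.+1 t + g' t)).
  exists m.+2, a, j.+2, (fun t => (a * - j%:R) * flat j.+1 t + g' t); split => //.
  by exists (a * - j%:R), j.+1, g'.
move=> x; have := is_deriveD1 (is_deriveM1 (is_derive_cst a _ _) (is_derive_flat j x)) (dg x).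
by move=> /is_derive_eq; apply; rewrite /cst; ring.
Qed.

Lemma is_derive_continuous (f f' : R -> R) :
  (forall x : R, is_derive x 1 f (f' x)) -> continuous f.
Proof.
by move=> d x; have [dx _] := d x; apply/differentiable_continuous/derivable1_diffP.
Qed.

Lemma mvt (f f' : R -> R) (x y : R) : (forall x : R, is_derive x 1 f (f' x)) -> x < y ->
  exists2 c, x < c < y & f y - f x = f' c * (y - x).
Proof.
move=> d xy; have [c] := @MVT R f f' x y xy (fun x _ => d x)
  (continuous_subspaceT (is_derive_continuous d)).
by rewrite in_itv /= => cxy e; exists c.
Qed.

Lemma is_derive_cst_on (f f' : R -> R) (x y : R) :
  (forall x : R, is_derive x 1 f (f' x)) -> x <= y ->
  (forall c, x < c < y -> f' c = 0) -> f x = f y.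
Proof.
move=> d; rewrite le_eqVlt => /orP[/eqP->//|xy] h.
have [c cxy e] := mvt d xy; apply/eqP; rewrite eq_sym -subr_eq0 e.
by rewrite h // mul0r.
Qed.

Lemma is_derive_le (f f' : R -> R) (x y : R) :
  (forall x : R, is_derive x 1 f (f' x)) -> x <= y ->
  (forall c, 0 <= f' c) -> f x <= f y.
Proof.
move=> d; rewrite le_eqVlt => /orP[/eqP->//|xy] h.
have [c cxy e] := mvt d xy; rewrite -subr_ge0 e.
by rewrite mulr_ge0 // subr_ge0 ltW.
Qed.

(** The integral starts at -1, strictly left of every point where [k] can be nonzero: the primitive
    is locally zero at each x < 0, and the fundamental theorem applies at each x >= 0. *)
Lemma primitive (k : R -> R) : continuous k -> (forall t, t <= 0 -> k t = 0) ->
  exists K, forall x : R, is_derive x 1 K (k x).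
Proof.
move=> ck k0; pose K x := \int[@lebesgue_measure R]_(t in `[-1, x]) k t.
have Kneg x : x <= 0 -> K x = 0.
  move=> x0; rewrite /K.
  rewrite (@eq_Rintegral _ _ _ _ _ (cst 0)); last first.
    move=> t; rewrite inE /= in_itv /= => /andP[_ tx]; rewrite k0 //.
    exact: le_trans tx x0.
  rewrite /Rintegral; have -> : (fun x : R => ((cst 0 x) : R)%:E) = cst 0%E by [].
  by rewrite integral0.
exists K => x; have [x0|x0] := ltP x 0.
  rewrite k0 ?ltW //.
  have E : \forall s \near x, cst 0 s = K s.
    near=> s; rewrite Kneg // ltW //; near: s; exact: lt_nbhsl.
  exact: (near_eq_is_derive E (is_derive_cst _ _ _)).
have xu : x < x + 1 by rewrite ltrDl.
have ik : (@lebesgue_measure R).-integrable `[-1, (x + 1)%R] (EFin \o k).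
  apply: continuous_compact_integrable; first exact: segment_compact.
  exact: continuous_subspaceT.
have x1 : -1 < x by rewrite (lt_le_trans _ x0) // ltrN10.
have [d e] := continuous_FTC1_closed xu ik x1 (ck x).
exact: (DeriveDef d (etrans (esym (derive1E _ _)) e)).
Unshelve. all: by end_near. Qed.

(** The primitive of a bump on []a, 1[], shifted and normalized to rise from 0 to 1. As [0 < a], the
    bump vanishes on the negative axis, as [primitive] requires. *)
Lemma smooth_step (a : R) : 0 < a < 1 -> exists m m' : R -> R,
  [/\ smooth1 m, smooth1 m', forall x : R, is_derive x 1 m (m' x), (forall t, 0 <= m' t) &
  (forall t, t <= a -> m t = 0) /\ (forall t, 1 <= t -> m t = 1)].
Proof.
move=> /andP[a0 a1].
pose b t : R := flat 0 (1 * t + - a) * flat 0 (-1 * t + 1).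
have sb : smooth1 b by apply: smooth1M; apply: smooth1_affine; exact: smooth1_flat.
have b0 t : 0 <= b t by rewrite mulr_ge0 ?flat_ge0.
have ba t : t <= a -> b t = 0.
  by move=> ta; rewrite /b flat0 ?mul0r // mul1r subr_le0.
have b1 t : 1 <= t -> b t = 0.
  by move=> ta; rewrite /b [X in _ * X]flat0 ?mulr0 // mulN1r addrC subr_le0.
have [B dB] : exists B, forall x : R, is_derive x 1 B (b x).
  apply: primitive; first exact: smooth1_continuous.
  by move=> t t0; apply: ba; rewrite (le_trans t0) // ltW.
have Z0 : 0 < B 1 - B a.
  have [c /andP[ac c1] ->] := mvt dB a1; rewrite mulr_gt0 ?subr_gt0 //.
  have e1 : 0 < 1 * c + - a by lra.
  have e2 : 0 < -1 * c + 1 by lra.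
  rewrite /b /flat e1 e2.
  by rewrite mulr_gt0 // mulr_gt0 ?expR_gt0 // expr0 invr1.
pose Z := B 1 - B a; pose m t := Z^-1 * (B t + - B a).
have sB : smooth1 B by apply: smooth1_intro sb dB.
exists m, (fun t => Z^-1 * b t); split.
- by apply: smooth1M; [exact: smooth1_cst|apply: smooth1D => //; exact: smooth1_cst].
- by apply: smooth1M => //; exact: smooth1_cst.
- move=> x; have := is_deriveM1 (is_derive_cst Z^-1 _ _) (is_deriveD1 (dB x) (is_derive_cst (- B a) _ _)).
  by move=> /is_derive_eq; apply; rewrite /cst; ring.
- by move=> t; rewrite mulr_ge0 // invr_ge0 ltW.
- split=> t h; rewrite /m.
    rewrite (is_derive_cst_on dB h) ?subrr ?mulr0 // => c /andP[_ /ltW]; exact: ba.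
  rewrite -(is_derive_cst_on dB h); first by rewrite mulVf // gt_eqF.
  by move=> c /andP[/ltW + _]; exact: b1.
Qed.

Definition isqrt (t : R) : R := (Num.sqrt t)^-1.

Lemma is_derive_isqrt (t : R) : 0 < t ->
  is_derive t 1 isqrt (- 2^-1 * isqrt t ^+ 3).
Proof.
move=> t0; have s0 : Num.sqrt t != 0 by rewrite gt_eqF // sqrtr_gt0.
have d := @is_deriveV R (fun t => Num.sqrt t) t _ 1 s0 (is_derive1_sqrt t0).
apply: (is_derive_eq d); rewrite -[_ *: _]/(_ * _) /isqrt; field.
by rewrite s0.
Qed.

(** The factor [m] vanishes near 0, where the power is singular. The invariant class consists of
    finite sums of such products: differentiation either raises the power by 2 or falls on [m]. *)
Lemma smooth1_isqrtX k (a : R) (m : R -> R) : 0 < a -> smooth1 m ->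
  (forall t, t < a -> m t = 0) -> smooth1 (fun t => isqrt t ^+ k * m t).
Proof.
move=> a0 sm m0.
pose C := fix C n : (R -> R) -> Prop := fun f => if n is n'.+1 then
  exists j m g, [/\ smooth1 m, (forall t, t < a -> m t = 0), C n' g &
    f = (fun t => isqrt t ^+ j * m t + g t)] else f = cst 0.
exists (fun f => exists n, C n f); split.
  exists 1%N, k, m, (cst 0); split => //.
  by apply/funext => t; rewrite addr0.
move=> g [n]; elim: n g {m sm m0 k} => [g ->|n ih _ [j [m [g [sm m0 Cg ->]]]]].
  by exists (cst 0); [exists 0%N|move=> x; exact: is_derive_cst].
have [g' [l Cg'] dg] := ih _ Cg.
have [m' sm' dm] := smooth1_deriv sm.
have dm0 (t : R) : t < a -> m' t = 0.
  move=> ta; have [_ <-] := dm t.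
  rewrite -(derive_cst (V := R) (0 : R) t 1); apply: near_eq_derive.
  by near=> s; apply: m0; near: s; exact: lt_nbhsl.
exists (fun t => isqrt t ^+ j.+2 * (- (j%:R / 2) * m t) + (isqrt t ^+ j * m' t + g' t)).
  exists l.+2, j.+2, (fun t => - (j%:R / 2) * m t), (fun t => isqrt t ^+ j * m' t + g' t).
  split => //; last by exists j, m', g'.
    by apply: smooth1M => //; exact: smooth1_cst.
  by move=> t /m0->; rewrite mulr0.
move=> x; have [x0|x0] := leP x 0.
  have xa : x < a by exact: le_lt_trans x0 a0.
  have E : \forall s \near x, g s = isqrt s ^+ j * m s + g s.
    by near=> s; rewrite m0 ?mulr0 ?add0r //; near: s; exact: lt_nbhsl.
  apply: (near_eq_is_derive E); apply: (is_derive_eq (dg x)).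
  by rewrite m0 // dm0 // !mulr0 !add0r.
have dX : is_derive x 1 (fun t => isqrt t ^+ j) (- (j%:R / 2) * isqrt x ^+ j.+2).
  have -> : (fun t => isqrt t ^+ j) = isqrt ^+ j.
    by apply/funext => s; elim: (j) => // i e; rewrite !exprS /= e.
  apply: (is_derive_eq (@is_deriveX R R isqrt j x 1 _ (is_derive_isqrt x0))).
  rewrite -[_ *: _]/(_ * _); case: (j) => [|i]; first by rewrite !mul0r oppr0 mul0r.
  by have -> : isqrt x ^+ i.+3 = isqrt x ^+ i * isqrt x ^+ 3; [rewrite -exprD addn3|field].
have := is_deriveD1 (is_deriveM1 dX (dm x)) (dg x).
by move=> /is_derive_eq; apply; ring.
Unshelve. all: by end_near. Qed.

End OneVariable.

(** * Regularized Newtonian potentials *)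

Section Profile.
Context {R : realType}.

(* [x |-> F (|x|^2)] is a smooth superharmonic function equal to [1/|x|] for
   [|x| >= 1].  Since [F' = - t^(-3/2) m / 2], its Laplacian is
   [- 2 t^(-1/2) m'] at [t = |x|^2], so [m] is the fraction of the total charge
   [4 pi] enclosed by the sphere of radius [sqrt t].  The charge sits in
   [16/25 <= t <= 1], whence the bound [5/4 = (16/25)^(-1/2)] on [F]. *)
Record newton_profile (F F1 m m1 : R -> R) : Prop := NewtonProfile {
  np_sF : smooth1 F;
  np_sm : smooth1 m;
  np_sm1 : smooth1 m1;
  np_dF : forall t : R, is_derive t 1 F (F1 t);
  np_dm : forall t : R, is_derive t 1 m (m1 t);
  np_F1 : forall t, F1 t = - 2^-1 * (isqrt t ^+ 3 * m t);
  np_m1 : forall t, 0 <= m1 t;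
  np_m0 : forall t, t <= 16 / 25 -> m t = 0;
  np_m_1 : forall t, 1 <= t -> m t = 1;
  np_Finf : forall t, 1 <= t -> F t = isqrt t;
  np_F0 : forall t, 0 < F t;
  np_Fle : forall t, F t <= 5 / 4 }.

Lemma isqrt1 : isqrt (1 : R) = 1.
Proof. by rewrite /isqrt sqrtr1 invr1. Qed.

Lemma isqrt_gt0 (t : R) : 0 < t -> 0 < isqrt t.
Proof. by move=> t0; rewrite invr_gt0 sqrtr_gt0. Qed.

Lemma isqrt_ge0 (t : R) : 0 <= isqrt t.
Proof. by rewrite invr_ge0 sqrtr_ge0. Qed.

Lemma isqrt_sq (t : R) : 0 < t -> t * isqrt t ^+ 2 = 1.
Proof. by move=> t0; rewrite /isqrt exprVn sqr_sqrtr ?ltW // divff ?gt_eqF. Qed.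

Lemma isqrt_1625 : isqrt (16 / 25 : R) = 5 / 4.
Proof.
rewrite /isqrt; have -> : 16 / 25 = (4 / 5 : R) ^+ 2 by field.
by rewrite sqrtr_sqr ger0_norm ?divr_ge0 // invf_div.
Qed.

(** [F] is 1 plus the integral from t to 1 of s^(-3/2) m(s) / 2: its derivative is as prescribed,
    and its value at 1 matches that of 1/sqrt(t). *)
Lemma exists_newton_profile : exists F F1 m m1, newton_profile F F1 m m1.
Proof.
have a01 : 0 < (16 / 25 : R) < 1 by apply/andP; split; lra.
have [m [m1 [sm sm1 dm m10 [ma m1']]]] := smooth_step a01.
have a0 : 0 < (16 / 25 : R) by case/andP: a01.
have mge t : 0 <= m t.
  have [h|/ltW h] := leP t (16 / 25); first by rewrite ma.
  by rewrite -(ma (16 / 25)) //; apply: (is_derive_le dm).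
have mle t : m t <= 1.
  have [h|/ltW h] := leP 1 t; first by rewrite m1'.
  by rewrite -(m1' 1) //; apply: (is_derive_le dm).
pose k t := 2^-1 * (isqrt t ^+ 3 * m t).
have sk : smooth1 k.
  apply: smooth1M; first exact: smooth1_cst.
  by apply: (smooth1_isqrtX _ a0) => // t /ltW; exact: ma.
have k0 t : 0 <= k t.
  by rewrite mulr_ge0 ?invr_ge0 // mulr_ge0 // exprn_ge0 // isqrt_ge0.
have [K dK] : exists K, forall x : R, is_derive x 1 K (k x).
  apply: primitive; first exact: smooth1_continuous.
  by move=> t t0; rewrite /k ma ?mulr0 // (le_trans t0) // ltW.
pose F t := 1 + (K 1 + -1 * K t).
have dF (t : R) : is_derive t 1 F (- 2^-1 * (isqrt t ^+ 3 * m t)).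
  have := is_deriveD1 (is_derive_cst (1 : R) t 1) (is_deriveD1 (is_derive_cst (K 1) t 1)
    (is_deriveM1 (is_derive_cst (-1 : R) t 1) (dK t))).
  by move=> /is_derive_eq; apply; rewrite /k /cst; ring.
have Finf t : 1 <= t -> F t = isqrt t.
  rewrite le_eqVlt => /orP[/eqP<-|t1]; first by rewrite isqrt1 /F mulN1r subrr addr0.
  have d (x : R) : x \in `]1, t[ -> is_derive x 1 (fun s => F s + -1 * isqrt s) 0.
    rewrite in_itv /= => /andP[x1 _]; have x0 : 0 < x by apply: lt_trans x1.
    have := is_deriveD1 (dF x) (is_deriveM1 (is_derive_cst (-1 : R) x 1) (is_derive_isqrt x0)).
    by move=> /is_derive_eq; apply; rewrite /cst m1' ?(ltW x1) //; ring.
  have c : {within `[1, t], continuous (fun s => F s + -1 * isqrt s)}.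
    apply: continuous_in_subspaceT => x; rewrite inE /= in_itv /= => /andP[x1 _].
    have x0 : 0 < x by apply: lt_le_trans x1.
    have [dx _] := is_deriveD1 (dF x) (is_deriveM1 (is_derive_cst (-1 : R) x 1) (is_derive_isqrt x0)).
    exact/differentiable_continuous/derivable1_diffP.
  have [s _] := @MVT R _ _ 1 t t1 d c.
  by rewrite mul0r isqrt1 /F; lra.
have Fdec x y : x <= y -> F y <= F x.
  move=> xy; have := is_derive_le dK xy k0; rewrite /F; lra.
exists F, (fun t => - 2^-1 * (isqrt t ^+ 3 * m t)), m, m1; split => //.
- apply: smooth1D; first exact: smooth1_cst.
  apply: smooth1D; first exact: smooth1_cst.
  apply: smooth1M; first exact: smooth1_cst.
  exact: smooth1_intro sk dK.
- move=> t; apply: (@lt_le_trans _ _ (F (Num.max t 1))).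
    by rewrite Finf ?isqrt_gt0 // ?le_max ?lexx ?orbT // lt_max ltr01 orbT.
  by apply: Fdec; rewrite le_max lexx.
- suff Fa : F (16 / 25) <= 5 / 4.
    move=> t; have [h|/ltW h] := leP t (16 / 25); last exact: le_trans (Fdec _ _ h) Fa.
    rewrite (is_derive_cst_on dF h) // => c /andP[_ ca].
    by rewrite ma ?mulr0 // ltW.
  rewrite -isqrt_1625 -subr_ge0.
  (* [isqrt - F] is nonincreasing on [[16/25, 1]], because [m <= 1], and vanishes at 1; hence it is
     nonnegative at 16/25, where [isqrt] is 5/4. *)
  have d (x : R) : x \in `](16 / 25), 1[ -> is_derive x 1 (fun s => isqrt s + -1 * F s)
      (- 2^-1 * isqrt x ^+ 3 * (1 - m x)).
    rewrite in_itv /= => /andP[x1 _]; have x0 : 0 < x by apply: lt_trans x1.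
    have := is_deriveD1 (is_derive_isqrt x0) (is_deriveM1 (is_derive_cst (-1 : R) x 1) (dF x)).
    by move=> /is_derive_eq; apply; rewrite /cst; ring.
  have c : {within `[(16 / 25), 1], continuous (fun s => isqrt s + -1 * F s)}.
    apply: continuous_in_subspaceT => x; rewrite inE /= in_itv /= => /andP[x1 _].
    have x0 : 0 < x by apply: lt_le_trans x1.
    have [dx _] := is_deriveD1 (is_derive_isqrt x0) (is_deriveM1 (is_derive_cst (-1 : R) x 1) (dF x)).
    exact/differentiable_continuous/derivable1_diffP.
  have a1 : 16 / 25 < 1 :> R by lra.
  have [s _] := @MVT R _ _ _ _ a1 d c.
  rewrite isqrt1 Finf // isqrt1 => e.
  have h1 : 0 <= isqrt s ^+ 3 * (1 - m s).
    by rewrite mulr_ge0 ?subr_ge0 // exprn_ge0 // isqrt_ge0.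
  by nra.
Qed.

(** Needed to divide by the potential in Hardy's inequality. The invariant class consists of finite
    sums of powers of 1/F times smooth factors. *)
Lemma smooth1_inv (F : R -> R) : smooth1 F -> (forall t, 0 < F t) ->
  smooth1 (fun t => (F t)^-1).
Proof.
move=> sF F0; have [F' sF' dF] := smooth1_deriv sF.
pose C := fix C n : (R -> R) -> Prop := fun f => if n is n'.+1 then
  exists j m g, [/\ smooth1 m, C n' g &
    f = (fun t => (F t)^-1 ^+ j * m t + g t)] else f = cst 0.
exists (fun f => exists n, C n f); split.
  exists 1%N, 1%N, (fun=> 1), (cst 0); split => //; first exact: smooth1_cst.
  by apply/funext => t; rewrite addr0 mulr1.
move=> g [n]; elim: n g => [g ->|n ih _ [j [m [g [sm Cg ->]]]]].
  by exists (cst 0); [exists 0%N|move=> x; exact: is_derive_cst].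
have [g' [l Cg'] dg] := ih _ Cg.
have [m' sm' dm] := smooth1_deriv sm.
exists (fun t => (F t)^-1 ^+ j.+1 * (- j%:R * F' t * m t) + ((F t)^-1 ^+ j * m' t + g' t)).
  exists l.+2, j.+1, (fun t => - j%:R * F' t * m t), (fun t => (F t)^-1 ^+ j * m' t + g' t).
  split => //; last by exists j, m', g'.
  by apply: smooth1M => //; apply: smooth1M => //; exact: smooth1_cst.
move=> x; have Fn0 : F x != 0 by rewrite gt_eqF.
have dV := @is_deriveV R F x _ 1 Fn0 (dF x).
have dX : is_derive x 1 (fun t => (F t)^-1 ^+ j) (- j%:R * F' x * (F x)^-1 ^+ j.+1).
  have -> : (fun t => (F t)^-1 ^+ j) = (fun t => (F t)^-1) ^+ j.
    by apply/funext => s; elim: (j) => // i e; rewrite !exprS /= e.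
  apply: (is_derive_eq (@is_deriveX R R (fun t => (F t)^-1) j x 1 _ dV)).
  rewrite -![_ *: _]/(_ * _); case: (j) => [|i]; first by rewrite !mul0r oppr0 !mul0r.
  have -> : (F x)^-1 ^+ i.+2 = (F x)^-1 ^+ i * (F x)^-1 ^+ 2 by rewrite -exprD addn2.
  by rewrite -exprVn /=; ring.
have := is_deriveD1 (is_deriveM1 dX (dm x)) (dg x).
by move=> /is_derive_eq; apply; ring.
Qed.

End Profile.

(** * Squared distance and radial functions *)

Section Kernel.
Context {R : realType}.
Notation E := (R * R * R)%type.

Definition sq (y x : E) : R :=
  (x.1.1 - y.1.1) ^+ 2 + (x.1.2 - y.1.2) ^+ 2 + (x.2 - y.2) ^+ 2.

Lemma sqC y x : sq y x = sq x y.
Proof. by rewrite /sq; ring. Qed.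

Lemma sq_ge0 y x : 0 <= sq y x.
Proof. by rewrite !addr_ge0 ?sqr_ge0. Qed.

Lemma smooth_sq y : smooth (sq y).
Proof.
apply: smoothG; rewrite /sq.
have H (f : E -> R) c : smooth_gen f -> smooth_gen (fun x => (f x - c) ^+ 2).
  move=> sf; have sf' : smooth_gen (fun x => f x + - c).
    by apply: gen_add => //; exact: gen_cst.
  exact: (gen_mul sf' sf').
apply: (gen_add (f := fun x => _ + _)); last by apply: H; exact: gen_Z.
by apply: (gen_add (f := fun x => _)); apply: H; [exact: gen_X|exact: gen_Y].
Qed.

Definition crd (i : 'I_3) (x : E) : R := [:: x.1.1; x.1.2; x.2]`_i.

Lemma sq_crd y x : sq y x = \sum_(i < 3) (crd i x - crd i y) ^+ 2.
Proof. by rewrite !big_ord_recl big_ord0 addr0 addrA. Qed.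

Lemma is_derive_crd i j x : is_derive x (basis3 j : E) (crd i) ((i == j)%:R).
Proof.
have -> : (i == j)%:R = crd i (basis3 j : E).
  by case: i j => [[|[|[|//]]] p] [[|[|[|//]]] q].
apply: is_derive_lin => t y z.
by case: i => [[|[|[|//]]] p].
Qed.

Lemma smooth_crd i : smooth (crd i).
Proof.
apply: smoothG; case: i => [[|[|[|//]]] p].
- exact: gen_X. - exact: gen_Y. - exact: gen_Z.
Qed.

Lemma partial_crd i j : partial j (crd i) = fun=> (i == j)%:R.
Proof. by apply: partialE => x; exact: is_derive_crd. Qed.

Lemma partial_sq i y : partial i (sq y) = fun x => 2 * (crd i x - crd i y).
Proof.
have -> : sq y = fun x => \sum_(j < 3) (crd j x - crd j y) * (crd j x - crd j y).
  by apply/funext => x; exact: sq_crd.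
have sc j : smooth (fun x => crd j x - crd j y).
  by apply: smoothB; [exact: smooth_crd|exact: smooth_cst].
rewrite partial_sum; last by move=> j; apply: smoothM.
apply/funext => x; rewrite (bigD1 i) //= big1 => [|j ji].
  rewrite partialM // partialB //; last exact: smooth_cst.
    by rewrite partial_crd partial_cst eqxx /=; ring.
  exact: smooth_crd.
rewrite partialM // partialB //; last exact: smooth_cst.
  by rewrite partial_crd partial_cst (negbTE ji) /=; ring.
exact: smooth_crd.
Qed.

(** The factors 6 and 4 come from the Laplacian of |x - y|^2, which is 6, and from its squared
    gradient, which is 4 |x - y|^2. *)
Lemma laplacian_radial (phi phi1 phi2 : R -> R) (c : R) y : smooth1 phi1 ->
  (forall t : R, is_derive t 1 phi (phi1 t)) -> (forall t : R, is_derive t 1 phi1 (phi2 t)) ->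
  laplacian (fun x => phi (c * sq y x)) = fun x =>
    c * (6 * phi1 (c * sq y x) + 4 * (c * sq y x) * phi2 (c * sq y x)).
Proof.
move=> s1 d1 d2; have scq : smooth (fun x => c * sq y x) by apply/smoothZ/smooth_sq.
have sc j : smooth (fun x => crd j x - crd j y).
  by apply: smoothB; [exact: smooth_crd|exact: smooth_cst].
have pq i : partial i (fun x => c * sq y x) = fun x => (2 * c) * (crd i x - crd i y).
  by rewrite partialZ; [rewrite partial_sq; apply/funext => x; ring|exact: smooth_sq].
apply/funext => x; rewrite /laplacian.
rewrite (eq_bigr (fun i : 'I_3 => 2 * c * phi1 (c * sq y x) +
    4 * c ^+ 2 * phi2 (c * sq y x) * (crd i x - crd i y) ^+ 2)); last first.
  move=> i _; rewrite (partial_comp i d1 scq) pq.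
  rewrite (partialM i (smooth_comp s1 scq) (smoothZ _ (sc i))).
  rewrite (partial_comp i d2 scq) pq (partialZ i _ (sc i)).
  rewrite (partialB i (smooth_crd i) (smooth_cst _)).
  by rewrite partial_crd partial_cst eqxx /=; ring.
rewrite big_split /= sumr_const card_ord -mulr_sumr -sq_crd -mulr_natl.
by ring.
Qed.

End Kernel.

(** * Regularized potentials and their charge densities *)

Section Newton.
Context {R : realType}.
Notation E := (R * R * R)%type.
Variables (F F1 m m1 : R -> R).
Hypothesis NP : newton_profile F F1 m m1.

(** The Newtonian potential 1/|x - y| with its singularity removed inside the ball of radius [e], by
    rescaling the unit profile. *)
Definition newt (e : R) (y x : E) : R := e^-1 * F (e^-1 ^+ 2 * sq y x).

(** The charge [- laplacian (newt e y)] in closed form: a smooth density in the shell 4e/5 <= |x -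
    y| <= e whose total does not depend on [e]. *)
Definition dens (e : R) (y x : E) : R :=
  e^-1 ^+ 3 * (2 * isqrt (e^-1 ^+ 2 * sq y x) * m1 (e^-1 ^+ 2 * sq y x)).

Lemma densC e y x : dens e y x = dens e x y.
Proof. by rewrite /dens sqC. Qed.

Lemma smooth_newt e y : smooth (newt e y).
Proof.
apply: smoothZ; apply: (smooth_comp (np_sF NP)).
by apply: smoothZ; exact: smooth_sq.
Qed.

Lemma np_m1_lt t : t < 16 / 25 -> m1 t = 0.
Proof.
move=> ta; have [_ <-] := np_dm NP t.
rewrite -(derive_cst (V := R) (0 : R) t 1); apply: near_eq_derive.
by near=> s; rewrite (np_m0 NP) // ltW //; near: s; exact: lt_nbhsl.
Unshelve. all: by end_near. Qed.

Lemma np_m1_gt t : 1 < t -> m1 t = 0.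
Proof.
move=> ta; have [_ <-] := np_dm NP t.
rewrite -(derive_cst (V := R) (1 : R) t 1); apply: near_eq_derive.
by near=> s; rewrite (np_m_1 NP) // ltW //; near: s; exact: lt_nbhsr.
Unshelve. all: by end_near. Qed.

Lemma smooth1_F1 : smooth1 F1.
Proof.
have -> : F1 = fun t => - 2^-1 * (isqrt t ^+ 3 * m t).
  by apply/funext => t; rewrite (np_F1 NP).
apply: smooth1M; first exact: smooth1_cst.
apply: (@smooth1_isqrtX _ 3 (16 / 25)); first lra.
  exact: (np_sm NP).
by move=> t /ltW; exact: (np_m0 NP).
Qed.

(** In 6 F' + 4 t F'' the terms containing [m] cancel, which is the harmonicity of 1/|x|; only the
    term with the derivative of [m] survives. *)
Lemma laplacian_newt e y : 0 < e -> laplacian (newt e y) = fun x => - dens e y x.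
Proof.
move=> e0; have [F2 sF2 dF2] := smooth1_deriv smooth1_F1.
rewrite laplacianZ; last first.
  by apply: (smooth_comp (np_sF NP)); apply: smoothZ; exact: smooth_sq.
rewrite (laplacian_radial _ _ smooth1_F1 (np_dF NP) dF2).
apply/funext => x; rewrite /dens; set t := _ * sq y x.
have t0 : 0 <= t by rewrite mulr_ge0 ?sqr_ge0 ?sq_ge0.
suff -> : 6 * F1 t + 4 * t * F2 t = - (2 * isqrt t * m1 t) by ring.
move: t0; rewrite le_eqVlt => /orP[/eqP<-|t0].
  have a0 : 0 < 16 / 25 :> R by lra.
  by rewrite (np_F1 NP) np_m1_lt // (np_m0 NP) ?ltW //; ring.
have dX : is_derive t 1 (fun t => isqrt t ^+ 3) (- (3 / 2) * isqrt t ^+ 5).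
  apply: (is_derive_eq (@is_deriveX R R isqrt 3 t 1 _ (is_derive_isqrt t0))).
  by rewrite -[_ *: _]/(_ * _) /=; field.
have d := is_deriveM1 (is_derive_cst (- 2^-1 : R) t 1) (is_deriveM1 dX (np_dm NP t)).
have -> : F2 t = - 2^-1 * (isqrt t ^+ 3 * m1 t + m t * (- (3 / 2) * isqrt t ^+ 5)).
  have [_ <-] := dF2 t; have -> : F1 = fun t => - 2^-1 * (isqrt t ^+ 3 * m t).
    by apply/funext => s; rewrite (np_F1 NP).
  by have [_ ->] := d; rewrite /cst mulr0 addr0.
rewrite (np_F1 NP); have h := isqrt_sq t0.
have -> : isqrt t ^+ 5 = isqrt t ^+ 3 * isqrt t ^+ 2 by rewrite -exprD.
have -> : isqrt t ^+ 3 = isqrt t * isqrt t ^+ 2 by rewrite -exprS.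
have -> : isqrt t ^+ 2 = t^-1 by rewrite -(mulr1 t^-1) -h mulKf ?gt_eqF.
by field; rewrite gt_eqF.
Qed.

Lemma dens_laplacian e y x : 0 < e -> dens e y x = - laplacian (newt e y) x.
Proof. by move=> e0; rewrite laplacian_newt // opprK. Qed.

Lemma smooth_dens e y : 0 < e -> smooth (dens e y).
Proof.
move=> e0; have -> : dens e y = fun x => -1 * laplacian (newt e y) x.
  by apply/funext => x; rewrite dens_laplacian // mulN1r.
by apply: smoothZ; apply: smooth_laplacian; exact: smooth_newt.
Qed.

Lemma dens_ge0 e y x : 0 < e -> 0 <= dens e y x.
Proof.
move=> e0; rewrite mulr_ge0 ?exprn_ge0 ?invr_ge0 ?(ltW e0) //.
by rewrite mulr_ge0 ?(np_m1 NP) // mulr_ge0 // isqrt_ge0.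
Qed.

Lemma dens0 e y x : 0 < e -> e ^+ 2 < sq y x -> dens e y x = 0.
Proof.
move=> e0 h; rewrite /dens np_m1_gt ?mulr0 //.
by rewrite exprVn mulrC ltr_pdivlMr ?mul1r // exprn_gt0.
Qed.

Lemma newt_out e y x : 0 < e -> e ^+ 2 <= sq y x -> newt e y x = isqrt (sq y x).
Proof.
move=> e0 h; rewrite /newt (np_Finf NP); last first.
  by rewrite exprVn mulrC ler_pdivlMr ?mul1r // exprn_gt0.
rewrite /isqrt sqrtrM ?sqr_ge0 // sqrtr_sqr ger0_norm ?invr_ge0 ?(ltW e0) //.
by rewrite invfM invrK mulKf // gt_eqF.
Qed.

Lemma newt_gt0 e y x : 0 < e -> 0 < newt e y x.
Proof. by move=> e0; rewrite mulr_gt0 ?invr_gt0 // (np_F0 NP). Qed.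

Lemma newt_le e y x : 0 < e -> newt e y x <= 5 / 4 / e.
Proof. by move=> e0; rewrite /newt mulrC ler_wpM2r ?invr_ge0 ?(ltW e0) // (np_Fle NP). Qed.

Lemma smooth_newt_inv e y : 0 < e -> smooth (fun x => (newt e y x)^-1).
Proof.
move=> e0; have -> : (fun x => (newt e y x)^-1) =
   fun x => e * ((fun t => (F t)^-1) (e^-1 ^+ 2 * sq y x)).
  by apply/funext => x; rewrite /newt invfM invrK.
apply: smoothZ; apply: (smooth_comp (smooth1_inv (np_sF NP) (np_F0 NP))).
by apply: smoothZ; exact: smooth_sq.
Qed.

Lemma sq_box (L : R) y x : sq y x <= L ^+ 2 -> 0 <= L ->
  box (R := R) (`|y.1.1| + `|y.1.2| + `|y.2| + L) x.
Proof.
move=> h L0.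
have s1 := sqr_ge0 (x.1.1 - y.1.1); have s2 := sqr_ge0 (x.1.2 - y.1.2).
have s3 := sqr_ge0 (x.2 - y.2).
have n1 := normr_ge0 y.1.1; have n2 := normr_ge0 y.1.2; have n3 := normr_ge0 y.2.
have H (a b : R) : (a - b) ^+ 2 <= L ^+ 2 -> `|a| <= `|b| + L.
  move=> hs; have : `|a - b| <= L.
    by rewrite -[L]ger0_norm // -(@ler_pXn2r _ 2) ?nnegrE // -!normrX !ger0_norm ?sqr_ge0.
  by move=> hl; have := ler_normD (a - b) b; rewrite subrK; lra.
rewrite /sq in h.
have h1 : (x.1.1 - y.1.1) ^+ 2 <= L ^+ 2 by lra.
have h2 : (x.1.2 - y.1.2) ^+ 2 <= L ^+ 2 by lra.
have h3 : (x.2 - y.2) ^+ 2 <= L ^+ 2 by lra.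
apply/boxP; split; [have := H _ _ h1|have := H _ _ h2|have := H _ _ h3]; lra.
Qed.

Lemma bsupp_dens e y : 0 < e -> bsupp (dens e y).
Proof.
move=> e0; exists (`|y.1.1| + `|y.1.2| + `|y.2| + e) => x; apply: contra_neqP => nb.
apply: dens0 => //; rewrite ltNge; apply/negP => h.
by apply: nb; apply: sq_box => //; exact: ltW.
Qed.

Lemma ccs_dens e y : 0 < e -> ccs (dens e y).
Proof. by move=> e0; apply: ccs_smooth; [exact: smooth_dens|exact: bsupp_dens]. Qed.

Lemma newt_sub0 e e' y x : 0 < e <= e' -> e' ^+ 2 <= sq y x -> newt e y x - newt e' y x = 0.
Proof.
move=> /andP[e0 ee'] h; have e'0 : 0 < e' by exact: lt_le_trans ee'.
rewrite !newt_out // ?subrr // (le_trans _ h) //; apply: lerXn2r => //; rewrite nnegrE ltW //.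
Qed.

Lemma bsupp_newt_sub e e' y : 0 < e <= e' -> bsupp (fun x => newt e y x - newt e' y x).
Proof.
move=> /andP[e0 ee']; have e'0 : 0 < e' by exact: lt_le_trans ee'.
exists (`|y.1.1| + `|y.1.2| + `|y.2| + e') => x; apply: contra_neqP => nb.
apply: newt_sub0; first by rewrite e0.
rewrite leNgt; apply/negP => h.
by apply: nb; apply: sq_box => //; exact: ltW.
Qed.

Lemma laplacian_newt_sub e e' y : 0 < e -> 0 < e' ->
  laplacian (fun x => newt e y x - newt e' y x) = fun x => dens e' y x - dens e y x.
Proof.
move=> e0 e'0; rewrite laplacianB ?laplacian_newt //; try exact: smooth_newt.
by apply/funext => x; ring.
Qed.

Lemma Int_laplacian0 (f : E -> R) : smooth f -> bsupp f -> Int (laplacian f) = 0.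
Proof.
move=> sf bf; rewrite /laplacian Int_sum.
  rewrite big1 // => i _; apply: Int_partial; first exact: smooth_partial.
  exact: bsupp_partial.
move=> i; apply: intg_ccs; apply: ccs_smooth; first by do 2! apply: smooth_partial.
by do 2! apply: bsupp_partial.
Qed.

(** The difference of the two potentials has compact support, so its Laplacian, the difference of
    the two densities up to sign, has integral zero. *)
Lemma Int_dens_scale e e' y : 0 < e <= e' -> Int (dens e y) = Int (dens e' y).
Proof.
move=> /andP[e0 ee']; have e'0 : 0 < e' by exact: lt_le_trans ee'.
apply/eqP; rewrite eq_sym -subr_eq0 -IntB; try exact/intg_ccs/ccs_dens.
have := laplacian_newt_sub y e0 e'0.
rewrite -[fun x => dens e' y x - _]/(dens e' y \- dens e y) => <-.
rewrite Int_laplacian0 //; last by apply: bsupp_newt_sub; rewrite e0.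
by apply: smoothB; exact: smooth_newt.
Qed.

End Newton.

(** * Total charge of the densities *)

Section Mass.
Context {R : realType}.
Notation E := (R * R * R)%type.
Local Notation leb := (@lebesgue_measure R).
Local Notation T := (R3 (measurableTypeR R)).

Lemma integral_shift (G : R -> R) (c : R) : continuous G -> (forall x, 0 <= G x) ->
  (\int[leb]_x (G (x + c))%:E = \int[leb]_x (G x)%:E)%E.
Proof.
move=> cG G0.
have d (x : R) : is_derive x 1 (fun t : R => t + c) 1.
  apply: (is_derive_eq (is_deriveD1 (is_derive_id x 1) (is_derive_cst c x 1))).
  by rewrite addr0.
have d1 : derive1 (fun t : R => t + c) = cst 1.
  by apply/funext => x; rewrite derive1E; have [_ ->] := d x.
rewrite (@increasing_ge0_integration_by_substitutionT R (fun t => t + c) G) //.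
- by apply: eq_integral => x _ /=; rewrite d1 /= mulr1.
- by move=> x y xy; rewrite ltrD2r.
- by rewrite d1; exact: cst_continuous.
- by rewrite d1; exact: is_cvg_cst.
- by rewrite d1; exact: is_cvg_cst.
- exact: cvg_addrr_Ny.
- exact: cvg_addrr.
Qed.

Lemma measurableE3 (f : E -> R) : continuous f ->
  measurable_fun setT ((fun x => (f x)%:E) : T -> \bar R).
Proof. by move=> cf; apply/measurable_EFinP; exact: continuous_measurable3. Qed.

Lemma measurable_section (f : E -> R) (z : R) : continuous f ->
  measurable_fun setT ((fun p => (f (p, z))%:E) :
    (measurableTypeR R * measurableTypeR R)%type -> \bar R).
Proof.
move=> cf; apply/measurable_EFinP.
exact: (measurableT_comp (continuous_measurable3 cf) (@pair2_measurable _ _ _ _ z)).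
Qed.

Lemma continuous_translate (f : E -> R) (v : E) : continuous f -> continuous (fun x : E => f (x + v)).
Proof.
move=> cf; have h : continuous (fun x : E => (x + v)%R : E).
  by move=> x; apply: cvgD; [exact: cvg_id|exact: cvg_cst].
by move=> x; apply: continuous_comp; [exact: h|exact: cf].
Qed.

Section FubiniNonneg.
Variable f : E -> R.
Hypotheses (cf : continuous f) (f0 : forall x, 0 <= f x).

Lemma integral_z_last : (\int[@leb3 R]_x (f x)%:E =
  \int[@leb2 R]_p \int[leb]_z (f (p, z))%:E)%E.
Proof.
apply: (@fubini_tonelli1 _ _ _ _ _ (@leb2 R) leb (fun x => (f x)%:E)).
  exact: measurableE3.
by move=> x /=; rewrite lee_fin.
Qed.

Lemma integral_xy_last : (\int[@leb3 R]_x (f x)%:E =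
  \int[leb]_z \int[@leb2 R]_p (f (p, z))%:E)%E.
Proof.
apply: (@fubini_tonelli2 _ _ _ _ _ (@leb2 R) leb (fun x => (f x)%:E)).
  exact: measurableE3.
by move=> x /=; rewrite lee_fin.
Qed.

Lemma integral2_y_last z : (\int[@leb2 R]_p (f (p, z))%:E =
  \int[leb]_x \int[leb]_y (f (x, y, z))%:E)%E.
Proof.
apply: (@fubini_tonelli1 _ _ _ _ _ leb leb (fun p => (f (p, z))%:E)).
  exact: measurable_section.
by move=> x /=; rewrite lee_fin.
Qed.

Lemma integral2_x_last z : (\int[@leb2 R]_p (f (p, z))%:E =
  \int[leb]_y \int[leb]_x (f (x, y, z))%:E)%E.
Proof.
apply: (@fubini_tonelli2 _ _ _ _ _ leb leb (fun p => (f (p, z))%:E)).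
  exact: measurable_section.
by move=> x /=; rewrite lee_fin.
Qed.

End FubiniNonneg.

Lemma continuous_slice (f : E -> R) (h : R -> E) (v x : E) : continuous f ->
  (forall t : R, h t = t *: v + x) -> continuous (fun t => f (h t)).
Proof.
move=> cf e; have -> : (fun t => f (h t)) = (fun t => f (t *: v + x)).
  by apply/funext => t; rewrite e.
exact: continuous_line.
Qed.

Lemma lineE1 (t y z : R) : (t, y, z) = t *: (1, 0, 0) + (0, y, z) :> E.
Proof.
by congr (_, _, _); rewrite -[RHS]/(t * _ + _) ?mulr1 ?mulr0 ?addr0 ?add0r.
Qed.

Lemma lineE2 (x t z : R) : (x, t, z) = t *: (0, 1, 0) + (x, 0, z) :> E.
Proof.
by congr (_, _, _); rewrite -[RHS]/(t * _ + _) ?mulr1 ?mulr0 ?addr0 ?add0r.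
Qed.

Lemma lineE3 (x y t : R) : (x, y, t) = t *: (0, 0, 1) + (x, y, 0) :> E.
Proof.
by congr (_, _, _); rewrite -[RHS]/(t * _ + _) ?mulr1 ?mulr0 ?addr0 ?add0r.
Qed.

(** One coordinate at a time: Tonelli places it innermost, and a change of variable on the line
    removes the shift. *)
Lemma Int_shift (f : E -> R) (v : E) : continuous f -> (forall x, 0 <= f x) ->
  Int (fun x => f (x + v)) = Int f.
Proof.
suff H (g : E -> R) (a b c : R) : continuous g -> (forall x, 0 <= g x) ->
   [/\ Int (fun x => g (x + (a, 0, 0))) = Int g, Int (fun x => g (x + (0, b, 0))) = Int g
     & Int (fun x => g (x + (0, 0, c))) = Int g].
  move=> cf f0; case: v => -[a b] c.
  have [e1 _ _] := H f a 0 0 cf f0.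
  have [_ e2 _] := H _ 0 b 0 (continuous_translate (v := (a, 0, 0)) cf) (fun=> f0 _).
  have [_ _ e3] := H _ 0 0 c
    (continuous_translate (v := (0, b, 0)) (continuous_translate (v := (a, 0, 0)) cf)) (fun=> f0 _).
  rewrite -e1 -e2 -e3; congr Int; apply/funext => x; congr f.
  rewrite -!addrA; congr (_ + _).
  by rewrite -[RHS]/((0 + (0 + a), 0 + (b + 0), c + (0 + 0))) !add0r !addr0.
move=> cg g0.
have cs w := @continuous_translate g w cg.
have s0 w x : 0 <= g (x + w) by [].
split; rewrite unlock /Rintegral; congr fine.
- apply: etrans (integral_xy_last (cs (a, 0, 0)) (s0 _)) _.
  apply: etrans (esym (integral_xy_last cg g0)); apply: eq_integral => z _.
  apply: etrans (integral2_x_last (cs (a, 0, 0)) (s0 _) z) _.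
  apply: etrans (esym (integral2_x_last cg g0 z)); apply: eq_integral => y _.
  rewrite -(integral_shift a (continuous_slice cg (fun t => lineE1 t y z)) (fun=> g0 _)).
  apply: eq_integral => x _; congr ((g _)%:E).
  by rewrite -[LHS]/(x + a, y + 0, z + 0) !addr0.
- apply: etrans (integral_xy_last (cs (0, b, 0)) (s0 _)) _.
  apply: etrans (esym (integral_xy_last cg g0)); apply: eq_integral => z _.
  apply: etrans (integral2_y_last (cs (0, b, 0)) (s0 _) z) _.
  apply: etrans (esym (integral2_y_last cg g0 z)); apply: eq_integral => x _.
  rewrite -(integral_shift b (continuous_slice cg (fun t => lineE2 x t z)) (fun=> g0 _)).
  apply: eq_integral => y _; congr ((g _)%:E).
  by rewrite -[LHS]/(x + 0, y + b, z + 0) !addr0.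
- apply: etrans (integral_z_last (cs (0, 0, c)) (s0 _)) _.
  apply: etrans (esym (integral_z_last cg g0)); apply: eq_integral => -[x y] _.
  rewrite -(integral_shift c (continuous_slice cg (fun t => lineE3 x y t)) (fun=> g0 _)).
  apply: eq_integral => z _; congr ((g _)%:E).
  by rewrite -[LHS]/(x + 0, y + 0, z + c) !addr0.
Qed.

Variables (F F1 m m1 : R -> R).
Hypothesis NP : newton_profile F F1 m m1.

Lemma Int_dens_center e y : 0 < e -> Int (dens m1 e y) = Int (dens m1 e 0).
Proof.
move=> e0; rewrite -(@Int_shift (dens m1 e 0) (- y)).
- congr Int; apply/funext => x; rewrite /dens /sq.
  by rewrite -[x - y]/(x.1.1 - y.1.1, x.1.2 - y.1.2, x.2 - y.2) /= !subr0.
- by apply: smooth_continuous; exact: (smooth_dens NP).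
- by move=> x; exact: (dens_ge0 NP).
Qed.

Definition mass := Int (dens m1 1 0).

Lemma Int_dens e y : 0 < e -> Int (dens m1 e y) = mass.
Proof.
move=> e0; rewrite Int_dens_center // /mass.
have [h|h] := leP e 1; first by rewrite (@Int_dens_scale _ _ _ _ _ NP e 1) // e0.
by rewrite (@Int_dens_scale _ _ _ _ _ NP 1 e) // ltr01 ltW.
Qed.

Lemma dens1_line (x y z : R) : dens m1 1 0 (x, y, z) =
  2 * isqrt (x ^+ 2 + y ^+ 2 + z ^+ 2) * m1 (x ^+ 2 + y ^+ 2 + z ^+ 2).
Proof. by rewrite /dens /sq /= !subr0 invr1 !expr1n !mul1r. Qed.

(** The density is even in z, and on [[0, 1]] it dominates the z-derivative of m(x^2 + y^2 + z^2),
    because 1/sqrt(t) >= 1 >= z where [m1] is nonzero. That function rises from 0 at z = 0 to 1 at z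
    = 1. *)
Lemma integral_dens_line (x y : R) : x ^+ 2 + y ^+ 2 <= 16 / 25 ->
  (2%:E <= \int[leb]_z (dens m1 1 0 (x, y, z))%:E)%E.
Proof.
move=> hs; set s := x ^+ 2 + y ^+ 2 in hs.
have s0 : 0 <= s by rewrite addr_ge0 ?sqr_ge0.
pose f z : R := dens m1 1 0 (x, y, z).
have cf : continuous f.
  apply: (continuous_slice _ (fun t => lineE3 x y t)).
  by apply: smooth_continuous; exact: (smooth_dens NP).
have f0 z : 0 <= f z by exact: (dens_ge0 NP).
have fE z : f z = 2 * isqrt (s + z ^+ 2) * m1 (s + z ^+ 2) by rewrite /f dens1_line.
rewrite -[X in (_ <= X)%E]/(\int[leb]_z (f z)%:E)%E ge0_symfun_integralT //; last first.
  by move=> z /=; rewrite !fE sqrrN.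
rewrite -[leLHS]mule1 lee_pmul2l //.
pose W z := m (s + z ^+ 2).
pose W' z : R := 2 * z * m1 (s + z ^+ 2).
have dW (z : R) : is_derive z 1 W (W' z).
  have d : is_derive z 1 (fun t : R => s + t * t) (2 * z).
    apply: (is_derive_eq (is_deriveD1 (is_derive_cst s z 1)
      (is_deriveM1 (is_derive_id z 1) (is_derive_id z 1)))).
    by ring.
  have := @is_derive1_comp R m (fun t : R => s + t * t) z _ _ (np_dm NP (s + z * z)) d.
  have -> : m \o (fun t : R => s + t * t) = W by [].
  by move=> /is_derive_eq; apply; rewrite /W' expr2; ring.
have cm1 := smooth1_continuous (np_sm1 NP).
have cW' : continuous W'.
  move=> z; apply: cvgM; first by apply: cvgM; [exact: cvg_cst|exact: cvg_id].
  apply: (@cvg_comp _ _ _ (fun z : R => s + z ^+ 2) m1 _ (nbhs (s + z ^+ 2))); last exact: cm1.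
  apply: cvgD; first exact: cvg_cst.
  by apply: cvgM; exact: cvg_id.
have W'1 : (\int[leb]_(z in `[0%R, 1%R]) (W' z)%:E = 1)%E.
  rewrite (@continuous_FTC2 _ W' W) //.
  - rewrite /W expr1n expr0n /= addr0 (np_m_1 NP) ?(np_m0 NP) ?sube0 //.
    by rewrite lerDr.
  - exact: continuous_subspaceT.
  - have cW := is_derive_continuous dW; split; first by move=> z _; have [] := dW z.
      by apply: cvg_at_right_filter; exact: cW.
    by apply: cvg_at_left_filter; exact: cW.
  - by move=> z _; rewrite derive1E; have [_ ->] := dW z.
rewrite -W'1; apply: (@le_trans _ _ (\int[leb]_(z in `[0%R, 1%R]) (f z)%:E)%E).
  apply: ge0_le_integral => //.
  - move=> z; rewrite /= in_itv /= => /andP[z0 _]; rewrite lee_fin /W'.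
    by rewrite mulr_ge0 ?(np_m1 NP) // mulr_ge0.
  - apply/measurable_EFinP; apply: measurable_funTS; exact: continuous_measurable_fun.
  - apply/measurable_EFinP; apply: measurable_funTS; exact: continuous_measurable_fun.
  move=> z; rewrite /= in_itv /= => /andP[z0 z1]; rewrite lee_fin /W' fE.
  have [h|h] := ltP 1 (s + z ^+ 2); first by rewrite (np_m1_gt NP) // !mulr0.
  have [h0|h0] := ltP (s + z ^+ 2) (16 / 25); first by rewrite (np_m1_lt NP) // !mulr0.
  have t0 : 0 < s + z ^+ 2 by lra.
  rewrite ler_wpM2r ?(np_m1 NP) // ler_wpM2l // (le_trans z1) //.
  rewrite /isqrt invf_ge1 ?sqrtr_gt0 //.
  by rewrite -sqrtr1 ler_wsqrtr.
apply: ge0_subset_integral => //.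
- by rewrite -set_itvcy.
- apply/measurable_EFinP; apply: measurable_funTS; exact: continuous_measurable_fun.
- by move=> z _; rewrite lee_fin.
- by move=> z; rewrite /= in_itv /= => /andP[].
Qed.

(* The exact value is [4 pi]; the columns above the square [|x|, |y| <= 14/25]
   already carry enough charge for the constant of the theorem. *)
Lemma mass_lower : 5 / 2 <= mass.
Proof.
pose b : R := 14 / 25.
pose I : set (measurableTypeR R) := `[- b, b]%classic.
pose Q : set (measurableTypeR R * measurableTypeR R) := I `*` I.
have mI : measurable I by exact: measurable_itv.
have mQ : measurable Q by exact: measurableX.
have lI : @lebesgue_measure R I = (28 / 25)%:E.
  rewrite /I lebesgue_measure_itv /= ifT; last by rewrite lte_fin /b; lra.
  by rewrite -EFinB; congr EFin; rewrite /b; field.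
have lQ : @leb2 R Q = (28 / 25 * (28 / 25))%:E.
  by rewrite EFinM -lI; apply: product_measure1E.
have cd : continuous (dens m1 1 0).
  by apply: smooth_continuous; exact: (smooth_dens NP).
have d0 x : 0 <= dens m1 1 0 x by exact: (dens_ge0 NP).
have cc : ccs (dens m1 1 0) by exact: (ccs_dens NP).
rewrite -lee_fin /mass (Int_integral (intg_ccs cc)) integral_z_last //.
have md : measurable_fun setT (fun p => \int[leb]_z (dens m1 1 0 (p, z))%:E)%E.
  apply: (@measurable_fun_fubini_tonelli_F _ _ _ _ _ leb (fun x => (dens m1 1 0 x)%:E)).
    exact: measurableE3.
  by move=> x /=; rewrite lee_fin.
(* Twice the area (28/25)^2 of the square is 1568/625, just above 5/2; the square lies in the disc
   of radius 4/5, since 2 (14/25)^2 = 392/625 <= 16/25. *)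
apply: (@le_trans _ _ (\int[@leb2 R]_(p in Q) 2%:E)%E).
  rewrite integral_cst // -[X in (_ <= _ * X)%E]/(@leb2 R Q) lQ -EFinM lee_fin; lra.
apply: (@le_trans _ _ (\int[@leb2 R]_(p in Q) \int[leb]_z (dens m1 1 0 (p, z))%:E)%E).
  apply: ge0_le_integral => //.
  - by apply: measurable_funTS.
  move=> [x y] [/=]; rewrite /I /= !in_itv /= -!ler_norml => hx hy.
  apply: integral_dens_line.
  rewrite -(real_normK (num_real x)) -(real_normK (num_real y)).
  have nx := normr_ge0 x; have ny := normr_ge0 y.
  by rewrite /b in hx hy; nra.
apply: ge0_subset_integral => //.
by move=> p _; apply: integral_ge0 => z _; rewrite lee_fin.
Qed.

End Mass.

(** * Hardy's inequality for the regularized potential *)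

Section Hardy.
Context {R : realType}.
Notation E := (R * R * R)%type.
Variables (F F1 m m1 : R -> R).
Hypothesis NP : newton_profile F F1 m m1.

Lemma partial_newt_inv i e y x : 0 < e ->
  partial i (fun x => (newt F e y x)^-1) x =
  - (newt F e y x)^-1 ^+ 2 * partial i (newt F e y) x.
Proof.
move=> e0; have sU := smooth_newt NP e y; have sV := smooth_newt_inv NP y e0.
have := partialM i sU sV.
have -> : (fun x => newt F e y x * (newt F e y x)^-1) = fun=> 1.
  by apply/funext => z; rewrite divff // gt_eqF // (newt_gt0 NP).
rewrite partial_cst => /(congr1 (fun f => (newt F e y x)^-1 * f x)) /=.
rewrite mulr0 mulrDr mulKf ?gt_eqF ?(newt_gt0 NP) // => h.
by apply/eqP; rewrite -subr_eq0 h; apply/eqP; ring.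
Qed.

(* Hardy's inequality for the superharmonic function [U = newt e y]: the
   divergence of [phi^2 grad U / U] integrates to zero, hence
   [int dens phi^2 / U <= int |grad phi|^2]; then AM-GM with weight [l]. *)
Lemma Int_dens_test (e l : R) y (phi : E -> R) : 0 < e -> 0 < l -> smooth phi -> bsupp phi ->
  Int (fun x => dens m1 e y x * phi x) <=
  l / 2 * Int (fun x => dot (grad phi x) (grad phi x)) + mass m1 * (5 / 4 / e) / (2 * l).
Proof.
move=> e0 l0 sp bp.
have sU := smooth_newt NP e y; have sV := smooth_newt_inv NP y e0.
pose U := newt F e y; pose V x := (U x)^-1.
pose th i x := (phi x * phi x) * (V x * partial i U x).
have sth i : smooth (th i).
  exact: (smoothM (smoothM sp sp) (smoothM sV (smooth_partial i sU))).
have bth i : bsupp (th i) by apply/bsuppMl/bsuppMl.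
have Ith i : Int (partial i (th i)) = 0 by exact: Int_partial (sth i) (bth i).
have iP (i : 'I_3) : intg (partial i (th i)).
  by apply: intg_ccs; apply: (ccs_smooth (smooth_partial i (sth i))); exact: bsupp_partial.
have iG : intg (fun x => dot (grad phi x) (grad phi x)).
  have -> : (fun x => dot (grad phi x) (grad phi x)) =
      (fun x => \sum_(i < 3) partial i phi x * partial i phi x).
    by apply/funext => x; exact: dot_grad.
  apply: intg_sum => i; apply: (intg_smoothM (smooth_partial i sp) (smooth_partial i sp)).
  by left; exact: bsupp_partial.
have iD : intg (dens m1 e y) by exact/intg_ccs/(ccs_dens NP).
have iDp : intg (fun x => dens m1 e y x * phi x).
  by apply: (intg_smoothM (smooth_dens NP y e0) sp); right.
have key x : dens m1 e y x * phi x <=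
    l / 2 * (dot (grad phi x) (grad phi x) + - \sum_(i < 3) partial i (th i) x) +
    (5 / 4 / e) / (2 * l) * dens m1 e y x.
  have U0 : 0 < U x by exact: (newt_gt0 NP).
  have V0 : 0 < V x by rewrite invr_gt0.
  have D0 : 0 <= dens m1 e y x by exact: (dens_ge0 NP).
  have thE i : partial i (th i) x = 2 * phi x * partial i phi x * V x * partial i U x
      - phi x ^+ 2 * V x ^+ 2 * partial i U x ^+ 2
      + phi x ^+ 2 * V x * partial i (partial i U) x.
    rewrite (partialM i (smoothM sp sp) (smoothM sV (smooth_partial i sU))).
    rewrite (partialM i sp sp) (partialM i sV (smooth_partial i sU)).
    by rewrite partial_newt_inv // -/U -/(V x); ring.
  (* The defect is |grad phi - phi grad U / U|^2; the terms with the Laplacian of [U] cancel against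
     [dens]. *)
  have H : phi x ^+ 2 * V x * dens m1 e y x <=
      dot (grad phi x) (grad phi x) + - \sum_(i < 3) partial i (th i) x.
    rewrite (dens_laplacian NP) // /laplacian dot_grad -subr_ge0.
    rewrite [_ * - _]mulrN opprK mulr_sumr -sumrN -!big_split /= sumr_ge0 // => i _.
    apply: (le_trans (sqr_ge0 (partial i phi x - phi x * V x * partial i U x))).
    by rewrite le_eqVlt; apply/orP; left; apply/eqP; rewrite thE -/U; ring.
  have UV : U x * V x = 1 by rewrite divff // gt_eqF.
  have Ule : U x <= 5 / 4 / e by exact: (newt_le NP).
  (* The square behind the weighted inequality phi <= (l/2) phi^2 / U + U / (2 l). *)
  have H2 : 0 <= dens m1 e y x * (V x / (2 * l) * (l * phi x - U x) ^+ 2).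
    by rewrite mulr_ge0 // mulr_ge0 ?sqr_ge0 // divr_ge0 ?ltW // mulr_gt0.
  have H3 : V x / (2 * l) * (l * phi x - U x) ^+ 2 =
      l / 2 * (phi x ^+ 2 * V x) + U x / (2 * l) - phi x.
    transitivity (l / 2 * (phi x ^+ 2 * V x) - phi x * (U x * V x) + U x * (U x * V x) / (2 * l)).
      by field; rewrite gt_eqF.
    by rewrite UV; ring.
  have H4 : l / 2 * (phi x ^+ 2 * V x * dens m1 e y x) <=
     l / 2 * (dot (grad phi x) (grad phi x) + - \sum_(i < 3) partial i (th i) x).
    by rewrite ler_wpM2l // divr_ge0 // ltW.
  have H5 : U x / (2 * l) * dens m1 e y x <= 5 / 4 / e / (2 * l) * dens m1 e y x.
    by rewrite ler_wpM2r // ler_wpM2r // invr_ge0 mulr_ge0 // ltW.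
  move: H2; rewrite H3 mulrBr mulrDr => H2; lra.
have iS : intg (fun x => - \sum_(i < 3) partial i (th i) x).
  by apply: intgN; exact: intg_sum.
have iA := intgD iG iS.
have := le_Int iDp (intgD (intgZ (l / 2) iA) (intgZ (5 / 4 / e / (2 * l)) iD)) key.
rewrite (IntD (intgZ (l / 2) iA) (intgZ _ iD)) (IntZ _ iA) (IntZ _ iD) (IntD iG iS).
rewrite IntN; last exact: intg_sum.
rewrite Int_sum // big1 // oppr0 addr0 (Int_dens NP) // => h.
by apply: (le_trans h); rewrite lerD2l le_eqVlt; apply/orP; left; apply/eqP; ring.
Qed.

End Hardy.

(** * Convolution *)

Section Convolution.
Context {R : realType}.
Notation E := (R * R * R)%type.
Local Notation T := (R3 (measurableTypeR R)).

Lemma bsupp_bounded (f : E -> R) : continuous f -> bsupp f ->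
  exists2 C, 0 <= C & forall x, `|f x| <= C.
Proof. by move=> cf bf; exact: ccs_bounded (conj cf bf). Qed.

Lemma mvt_line (f : E -> R) i (x : E) (t : R) : smooth f ->
  exists2 s, `|s| <= `|t| &
    f (t *: (basis3 i : E) + x) - f x = t * partial i f (s *: (basis3 i : E) + x).
Proof.
move=> sf.
have d (s : R) : is_derive s 1 (fun t : R => f (t *: (basis3 i : E) + x))
    (partial i f (s *: (basis3 i : E) + x)).
  apply: (@is_derive_line_at _ f (partial i f)) => y; exact: smooth_is_derive.
have f0 : f (0 *: (basis3 i : E) + x) = f x by rewrite scale0r add0r.
have [t0|t0|->] := ltgtP t 0; last by exists 0 => //; rewrite f0 subrr mul0r.
- have [s /andP[s1 s2] e] := mvt d t0; exists s.
    by rewrite !ler0_norm ?lerN2 ?ltW.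
  by rewrite f0 in e; rewrite -opprB e; ring.
- have [s /andP[s1 s2] e] := mvt d t0; exists s.
    by rewrite !ger0_norm ?ltW.
  by rewrite f0 in e; rewrite e; ring.
Qed.

Lemma lip_line (f : E -> R) : smooth f -> bsupp f ->
  exists2 C, 0 <= C & forall i (x : E) (t : R),
    `|f (t *: (basis3 i : E) + x) - f x| <= C * `|t|.
Proof.
move=> sf bf.
have H i := bsupp_bounded (smooth_continuous (smooth_partial i sf)) (bsupp_partial i bf).
have [C0 C00 h0] := H 0; have [C1 C10 h1] := H 1; have [C2 C20 h2] := H 2%:R.
exists (C0 + C1 + C2); first by rewrite !addr_ge0.
move=> i x t; have [s _ ->] := mvt_line i x t sf; rewrite normrM mulrC ler_wpM2r //.
have [->|[->|->]] : i = 0 \/ i = 1 \/ i = 2%:R.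
  by case: i => [[|[|[|]]]] //= hi; [left|right;left|right;right]; exact/val_inj.
- by apply: (le_trans (h0 _)); lra.
- by apply: (le_trans (h1 _)); lra.
- by apply: (le_trans (h2 _)); lra.
Qed.

(** The constant is uniform in [x], so that the bound can be integrated against a merely integrable
    kernel. *)
Lemma taylor_line (f : E -> R) i : smooth f -> bsupp f ->
  exists C, forall (x : E) (t : R),
    `|f (t *: (basis3 i : E) + x) - f x - t * partial i f x| <= C * t ^+ 2.
Proof.
move=> sf bf.
have [C C0 hC] := lip_line (smooth_partial i sf) (bsupp_partial i bf).
exists C => x t; have [s st ->] := mvt_line i x t sf.
rewrite -mulrBr normrM -(real_normK (num_real t)) expr2 mulrCA ler_wpM2l //.
by apply: (le_trans (hC i x s)); rewrite ler_wpM2l.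
Qed.

Definition convol (k eta : E -> R) (x : E) : R := Int (fun z => k z * eta (x - z)).

Lemma continuous_rsub (f : E -> R) (x : E) : continuous f -> continuous (fun z : E => f (x - z)).
Proof.
move=> cf; have h : continuous (fun z : E => (x - z)%R : E).
  by move=> z; apply: cvgB; [exact: cvg_cst|exact: cvg_id].
by move=> z; apply: continuous_comp; [exact: h|exact: cf].
Qed.

Lemma intg_convol (k eta : E -> R) x : intg k -> continuous eta -> bsupp eta ->
  intg (fun z => k z * eta (x - z)).
Proof.
move=> Ik ce be; have [C _ hC] := bsupp_bounded ce be.
apply: (@intgMb _ k (fun z => eta (x - z)) C Ik).
  exact: (continuous_measurable3 (continuous_rsub (x := x) ce)).
by move=> z; exact: hC.
Qed.

Lemma convol_lip (k eta : E -> R) : intg k -> smooth eta -> bsupp eta ->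
  exists2 C, 0 <= C & forall i (x : E) (t : R),
   `|convol k eta (t *: (basis3 i : E) + x) - convol k eta x| <= C * `|t|.
Proof.
move=> Ik se be; have [C C0 hC] := lip_line se be.
have ce := smooth_continuous se.
exists (C * Int (fun z => `|k z|)); first by rewrite mulr_ge0 // Int_ge0.
move=> i x t; rewrite /convol -IntB; [|exact: intg_convol..].
have IB := intgB (intg_convol (t *: (basis3 i : E) + x) Ik ce be) (intg_convol x Ik ce be).
apply: (le_trans (ler_norm_Int IB)).
rewrite mulrAC -IntZ; last exact: intg_norm.
apply: le_Int; [exact: intg_norm|exact/intgZ/intg_norm|move=> z /=].
rewrite -mulrBr normrM mulrC ler_wpM2r // -addrA; exact: hC.
Qed.

(** Two points are joined by three segments parallel to the axes, hence the factor 3. *)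
Lemma continuous_of_lip (f : E -> R) C : 0 <= C ->
  (forall i (x : E) (t : R), `|f (t *: (basis3 i : E) + x) - f x| <= C * `|t|) -> continuous f.
Proof.
move=> C0 h x; apply/cvgrPdist_le => e e0.
have C1 : 0 < 3 * C + 1 by lra.
near=> y.
have : `|x - y| < e / (3 * C + 1).
  near: y; apply: (@cvgr_dist_lt _ E _ (nbhs x) _ id x cvg_id).
  by rewrite divr_gt0.
rewrite ltr_pdivlMr // => hy; rewrite distrC.
pose a := y.1.1 - x.1.1; pose b := y.1.2 - x.1.2; pose c := y.2 - x.2.
have [na nb nc] : [/\ `|a| <= `|x - y|, `|b| <= `|x - y| & `|c| <= `|x - y|].
  rewrite /a /b /c /Num.norm /= !le_max !(distrC x.1.1) !(distrC x.1.2) !(distrC x.2).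
  by rewrite !lexx !orbT.
pose x1 : E := a *: (basis3 0 : E) + x.
pose x2 : E := b *: (basis3 1 : E) + x1.
have ey : y = c *: (basis3 2%:R : E) + x2.
  rewrite /x2 /x1 {1}(surjective_pairing y) {1}(surjective_pairing y.1).
  congr (_, _, _).
  - rewrite -[RHS]/(c * 0 + (b * 0 + (a * 1 + x.1.1))) /a; ring.
  - rewrite -[RHS]/(c * 0 + (b * 1 + (a * 0 + x.1.2))) /b; ring.
  - rewrite -[RHS]/(c * 1 + (b * 0 + (a * 0 + x.2))) /c; ring.
have e1 := h 0 x a; have e2 := h 1 x1 b; have e3 := h 2%:R x2 c.
rewrite -/x1 in e1; rewrite -/x2 in e2; rewrite -ey in e3.
have -> : f y - f x = (f y - f x2) + (f x2 - f x1) + (f x1 - f x) by ring.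
apply: (le_trans (ler_normD _ _)).
have := ler_normD (f y - f x2) (f x2 - f x1).
have m1 : C * `|a| <= C * `|x - y| by rewrite ler_wpM2l.
have m2 : C * `|b| <= C * `|x - y| by rewrite ler_wpM2l.
have m3 : C * `|c| <= C * `|x - y| by rewrite ler_wpM2l.
have := normr_ge0 (x - y).
lra.
Unshelve. all: by end_near. Qed.

Lemma convol_derive (k eta : E -> R) i x : intg k -> smooth eta -> bsupp eta ->
  is_derive x (basis3 i : E) (convol k eta) (convol k (partial i eta) x).
Proof.
move=> Ik se be; have [C hC] := taylor_line i se be.
have ce := smooth_continuous se.
have cp := smooth_continuous (smooth_partial i se).
have bp := bsupp_partial i be.
apply: (@is_derive_sq_bound _ _ _ _ _ _ (C * Int (fun z => `|k z|))) => t _.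
have I1 := intg_convol (t *: (basis3 i : E) + x) Ik ce be.
have I2 := intg_convol x Ik ce be.
have I3 := intgZ t (intg_convol x Ik cp bp).
rewrite /convol -(IntZ t (intg_convol x Ik cp bp)) -(IntB I1 I2) -(IntB (intgB I1 I2) I3).
apply: (le_trans (ler_norm_Int (intgB (intgB I1 I2) I3))).
rewrite mulrAC -IntZ; last exact: intg_norm.
apply: le_Int; [exact: (intg_norm (intgB (intgB I1 I2) I3))|exact/intgZ/intg_norm|move=> z /=].
rewrite mulrCA -!mulrBr normrM mulrC ler_wpM2r //.
by have := hC (x - z) t; rewrite addrA.
Qed.

(** Every derivative falls on [eta], so the convolutions with the fixed kernel [k] form a class
    stable under derivation. *)
Lemma smooth_convol (k eta : E -> R) : intg k -> smooth eta -> bsupp eta ->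
  smooth (convol k eta).
Proof.
move=> Ik se be.
apply: (@smooth_class _ (fun f => exists eta, [/\ smooth eta, bsupp eta & f = convol k eta])).
  move=> _ [h [sh bh ->]]; split.
    by have [C C0 hC] := convol_lip Ik sh bh; exact: continuous_of_lip hC.
  move=> i; exists (convol k (partial i h)); last by move=> x; exact: convol_derive.
  exists (partial i h); split; [exact: smooth_partial|exact: bsupp_partial|by []].
by exists eta.
Qed.

Lemma partial_convol i (k eta : E -> R) : intg k -> smooth eta -> bsupp eta ->
  partial i (convol k eta) = convol k (partial i eta).
Proof. by move=> Ik se be; apply: partialE => x; exact: convol_derive. Qed.

Lemma laplacian_convol (k eta : E -> R) : intg k -> smooth eta -> bsupp eta ->
  laplacian (convol k eta) = convol k (laplacian eta).
Proof.
move=> Ik se be; apply/funext => x; rewrite /laplacian /convol.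
transitivity (\sum_(i < 3) convol k (partial i (partial i eta)) x).
  apply: eq_bigr => i _; rewrite (partial_convol i Ik se be).
  by rewrite (partial_convol i Ik (smooth_partial i se) (bsupp_partial i be)).
rewrite /convol -Int_sum.
  by congr Int; apply/funext => z; rewrite mulr_sumr.
move=> i; apply: (intg_convol x Ik).
  exact: smooth_continuous (smooth_partial i (smooth_partial i se)).
by do 2! apply: bsupp_partial.
Qed.

End Convolution.

(** * Transfer of a convolution to the test function *)

Section ConvFubini.
Context {R : realType}.
Notation E := (R * R * R)%type.
Local Notation T := (R3 (measurableTypeR R)).
Local Notation mu := (@leb3 R).

Lemma measurable_sub3 : measurable_fun setT (fun p : T * T => (p.1 - p.2 : E) : T).
Proof.
pose M : measurableType _ := measurableTypeR R.
have m11 : measurable_fun setT (fun p : T * T => p.1.1.1 : M).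
  exact: (measurableT_comp measurable_fst (measurableT_comp measurable_fst measurable_fst)).
have m12 : measurable_fun setT (fun p : T * T => p.1.1.2 : M).
  exact: (measurableT_comp measurable_snd (measurableT_comp measurable_fst measurable_fst)).
have m13 : measurable_fun setT (fun p : T * T => p.1.2 : M).
  exact: (measurableT_comp measurable_snd measurable_fst).
have m21 : measurable_fun setT (fun p : T * T => p.2.1.1 : M).
  exact: (measurableT_comp measurable_fst (measurableT_comp measurable_fst measurable_snd)).
have m22 : measurable_fun setT (fun p : T * T => p.2.1.2 : M).
  exact: (measurableT_comp measurable_snd (measurableT_comp measurable_fst measurable_snd)).
have m23 : measurable_fun setT (fun p : T * T => p.2.2 : M).
  exact: (measurableT_comp measurable_snd measurable_snd).
apply: measurable_fun_pair; first apply: measurable_fun_pair.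
- exact: (measurable_funB m11 m21).
- exact: (measurable_funB m12 m22).
- exact: (measurable_funB m13 m23).
Qed.

(** Fubini; integrability on the product follows from the majorant C |k(z)| |psi(x)|, with C a bound
    of |eta|. *)
Lemma Int_convol (k eta psi : E -> R) : intg k -> ccs eta -> ccs psi ->
  Int (fun x => convol k eta x * psi x) = Int (fun z => k z * Int (fun x => eta (x - z) * psi x)).
Proof.
move=> Ik ceta cpsi.
have [C C0 hC] := ccs_bounded ceta.
have [ce be] := ceta; have [cp bp] := cpsi.
pose f (p : T * T) : R := k p.2 * eta (p.1 - p.2) * psi p.1.
have mf : measurable_fun setT f.
  apply: measurable_funM; first apply: measurable_funM.
  - exact: (measurableT_comp (intg_measurable Ik) measurable_snd).
  - exact: (measurableT_comp (continuous_measurable3 ce) measurable_sub3).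
  - exact: (measurableT_comp (continuous_measurable3 cp) measurable_fst).
have mE : measurable_fun setT (EFin \o f) by apply/measurable_EFinP.
have Ix x : intg (fun z => f (x, z)).
  have -> : (fun z => f (x, z)) = fun z => psi x * (k z * eta (x - z)).
    by apply/funext => z; rewrite /f /= mulrC.
  by apply: intgZ; exact: intg_convol.
have Iz z : intg (fun x => f (x, z)).
  have -> : (fun x => f (x, z)) = fun x => k z * (psi x * eta (x - z)).
    by apply/funext => x; rewrite /f /=; ring.
  apply: intgZ; apply: (@intgMb _ psi (fun x => eta (x - z)) C (intg_ccs cpsi)).
    exact: (continuous_measurable3 (continuous_translate (v := - z) ce)).
  by move=> x; exact: hC.
have If : (mu \x mu)%E.-integrable setT (EFin \o f).
  apply/(@integrable12ltyP _ _ _ _ _ mu mu _ mE).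
  apply: (@le_lt_trans _ _ (\int[mu]_x (C * Int (fun z => `|k z|) * `|psi x|)%:E)%E).
    apply: ge0_le_integral => //.
    - by move=> x _; exact: integral_ge0.
    - apply: (measurable_fun_fubini_tonelli_F (m2 := mu) (abse \o (EFin \o f))) => //.
        exact: measurableT_comp.
      by move=> x; rewrite /= lee_fin.
    - apply/measurable_EFinP; apply: measurable_funM => //.
      apply: measurableT_comp => //; exact: continuous_measurable3.
    move=> x _.
    have In := intg_norm (Ix x).
    rewrite -(Int_integral In) lee_fin mulrAC -(IntZ _ (intg_norm Ik)).
    apply: (le_Int In (intgZ _ (intg_norm Ik))) => z.
    rewrite /f /= !normrM mulrC mulrA [C * _]mulrC -!mulrA ler_wpM2l //.
    by rewrite mulrC ler_wpM2r.
  rewrite -(Int_integral (intgZ _ (intg_norm (intg_ccs cpsi)))).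
  exact: ltry.
have FF := Fubini If; rewrite /fubini_F /fubini_G in FF.
have e1 : (\int[mu]_x \int[mu]_z (f (x, z))%:E)%E = (\int[mu]_x (convol k eta x * psi x)%:E)%E.
  apply: eq_integral => x _; rewrite -(Int_integral (Ix x)); congr EFin.
  rewrite /convol mulrC -IntZ; last exact: intg_convol.
  by congr Int; apply/funext => z; rewrite /f /= mulrC.
have e2 : (\int[mu]_z \int[mu]_x (f (x, z))%:E)%E =
    (\int[mu]_z (k z * Int (fun x => eta (x - z) * psi x))%:E)%E.
  apply: eq_integral => z _; rewrite -(Int_integral (Iz z)); congr EFin.
  have h : intg (fun x => eta (x - z) * psi x).
    apply: intg_ccs; split; last exact: bsuppMr.
    move=> x; apply: cvgM; last exact: cp.
    exact: (continuous_translate (v := - z) ce).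
  rewrite -(IntZ _ h).
  by congr Int; apply/funext => x; rewrite /f /= mulrA.
have UE (g h : E -> R) : (\int[mu]_x (g x)%:E = \int[mu]_x (h x)%:E)%E -> Int g = Int h.
  by rewrite unlock /Rintegral => ->.
apply: UE.
by apply: etrans (esym e1) _; apply: etrans FF _; exact: e2.
Qed.

End ConvFubini.

(** * Smoothing the Green function at its pole *)

Section Potential.
Context {R : realType}.
Notation E := (R * R * R)%type.
Local Notation T := (R3 (measurableTypeR R)).
Variables (F F1 m m1 : R -> R).
Hypothesis NP : newton_profile F F1 m m1.

(** Cauchy-Schwarz through Lagrange's identity, so that only squared distances occur. *)
Lemma sq_triangle (a b : R) (y x z : E) : 0 <= a -> 0 <= b ->
  sq y x <= a ^+ 2 -> sq x z <= b ^+ 2 -> sq y z <= (a + b) ^+ 2.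
Proof.
move=> a0 b0 hx hz.
pose u1 := x.1.1 - y.1.1; pose u2 := x.1.2 - y.1.2; pose u3 := x.2 - y.2.
pose v1 := z.1.1 - x.1.1; pose v2 := z.1.2 - x.1.2; pose v3 := z.2 - x.2.
have hu : u1 ^+ 2 + u2 ^+ 2 + u3 ^+ 2 <= a ^+ 2 by [].
have hv : v1 ^+ 2 + v2 ^+ 2 + v3 ^+ 2 <= b ^+ 2 by [].
pose D := u1 * v1 + u2 * v2 + u3 * v3.
have hD2 : D ^+ 2 <= (a * b) ^+ 2.
  rewrite exprMn (@le_trans _ _ ((u1 ^+ 2 + u2 ^+ 2 + u3 ^+ 2) * (v1 ^+ 2 + v2 ^+ 2 + v3 ^+ 2))) //.
    rewrite -subr_ge0.
    have -> : (u1 ^+ 2 + u2 ^+ 2 + u3 ^+ 2) * (v1 ^+ 2 + v2 ^+ 2 + v3 ^+ 2) - D ^+ 2 =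
       (u1 * v2 - u2 * v1) ^+ 2 + (u1 * v3 - u3 * v1) ^+ 2 + (u2 * v3 - u3 * v2) ^+ 2.
      by rewrite /D; ring.
    by rewrite !addr_ge0 ?sqr_ge0.
  by apply: ler_pM => //; rewrite !addr_ge0 ?sqr_ge0.
have hD : D <= a * b.
  rewrite (le_trans (ler_norm _)) // -(@ler_pXn2r _ 2) ?nnegrE ?mulr_ge0 //.
  by rewrite real_normK ?num_real.
have -> : sq y z = (u1 ^+ 2 + u2 ^+ 2 + u3 ^+ 2) + 2 * D + (v1 ^+ 2 + v2 ^+ 2 + v3 ^+ 2).
  by rewrite /sq /D /u1 /u2 /u3 /v1 /v2 /v3; ring.
have -> : (a + b) ^+ 2 = a ^+ 2 + 2 * (a * b) + b ^+ 2 by ring.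
lra.
Qed.

Definition cball (y : E) (a : R) : set E := [set x | sq y x <= a ^+ 2].

Lemma open_sq_lt y (c : R) : open [set x | sq y x < c].
Proof.
have /continuousP/(_ `]-oo, c[%classic) := smooth_continuous (smooth_sq (R := R) y).
have -> : sq y @^-1` `]-oo, c[ = [set x | sq y x < c].
  by apply/seteqP; split=> x /=; rewrite in_itv.
by apply; exact: interval_open.
Qed.

Lemma open_sq_gt y (c : R) : open [set x | c < sq y x].
Proof.
have /continuousP/(_ `]c, +oo[%classic) := smooth_continuous (smooth_sq (R := R) y).
have -> : sq y @^-1` `]c, +oo[ = [set x | c < sq y x].
  by apply/seteqP; split=> x /=; rewrite in_itv /= andbT.
by apply; exact: interval_open.
Qed.

Lemma closed_cball y (a : R) : closed (cball y a).
Proof.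
have -> : cball y a = ~` [set x | a ^+ 2 < sq y x].
  by apply/seteqP; split=> x; rewrite /cball /= leNgt => /negP.
by apply: open_closedC; exact: open_sq_gt.
Qed.

Lemma compact_cball y (a : R) : 0 <= a -> compact (cball y a).
Proof.
move=> a0; have cb := @compact_box R (`|y.1.1| + `|y.1.2| + `|y.2| + a).
apply: (subclosed_compact _ cb); first exact: closed_cball.
by move=> x h; exact: sq_box h a0.
Qed.

Lemma partial_supp i (f : E -> R) (K : set E) : closed K -> (forall x, f x != 0 -> K x) ->
  forall x, partial i f x != 0 -> K x.
Proof.
move=> cK h x; apply: contra_neqP => nb.
rewrite -[RHS](derive_cst (V := E) (0 : R) x (basis3 i)).
apply: (@partial_open R i (~` K)) => //; first exact: closed_openC.
by move=> z nz; apply/eqP; apply: contra_notT nz => /h.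
Qed.

Lemma laplacian_supp (f : E -> R) (K : set E) : closed K -> (forall x, f x != 0 -> K x) ->
  forall x, laplacian f x != 0 -> K x.
Proof.
move=> cK h x; apply: contra_neqP => nb.
rewrite /laplacian big1 // => i _; apply/eqP; apply: contra_notT nb.
by apply: partial_supp => // z; exact: partial_supp.
Qed.

(** Radiality makes the Laplacian symmetric in centre and argument, which [laplacian_dens_sub]
    exploits to exchange the two. *)
Lemma laplacian_dens_radial (e : R) : exists Phi : R -> R, forall y x : E,
  laplacian (dens m1 e y) x = Phi (sq y x).
Proof.
pose p t : R := e^-1 ^+ 3 * (2 * (isqrt t ^+ 1 * m1 t)).
have sp : smooth1 p.
  apply: smooth1M; first exact: smooth1_cst.
  apply: smooth1M; first exact: smooth1_cst.
  apply: (@smooth1_isqrtX _ _ (16 / 25)); first lra.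
    exact: (np_sm1 NP).
  exact: (np_m1_lt NP).
have [p1 sp1 dp] := smooth1_deriv sp; have [p2 sp2 dp1] := smooth1_deriv sp1.
exists (fun s => e^-1 ^+ 2 * (6 * p1 (e^-1 ^+ 2 * s) +
    4 * (e^-1 ^+ 2 * s) * p2 (e^-1 ^+ 2 * s))) => y x.
have -> : dens m1 e y = fun x => p (e^-1 ^+ 2 * sq y x).
  by apply/funext => z; rewrite /dens /p expr1 mulrA.
by rewrite (laplacian_radial _ _ sp1 dp dp1).
Qed.

Lemma dens_sub (e : R) (z x : E) : dens m1 e 0 (x - z) = dens m1 e z x.
Proof.
rewrite /dens /sq.
by rewrite -[x - z]/(x.1.1 - z.1.1, x.1.2 - z.1.2, x.2 - z.2) /= !subr0.
Qed.

Lemma laplacian_dens_sub (e : R) (z x : E) :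
  laplacian (dens m1 e 0) (z - x) = laplacian (dens m1 e z) x.
Proof.
have [P hP] := laplacian_dens_radial e; rewrite !hP; congr P.
rewrite /sq -[z - x]/(z.1.1 - x.1.1, z.1.2 - x.1.2, z.2 - x.2) /= !subr0.
by ring.
Qed.

Variables (Om : set E) (y : E) (g0 : E -> R) (d : R).
Hypothesis d0 : 0 < d.
Hypothesis ballOm : forall x, sq y x < (2 * d) ^+ 2 -> Om x.
Hypothesis g0int : forall K, compact K -> K `<=` Om -> intg (g0 \_ K).
Hypothesis g0green : forall phi, test_function Om phi ->
  Int (fun x => g0 x * laplacian phi x) = - phi y.
Hypothesis g0cont : forall x, Om x -> x != y -> forall e : R, 0 < e ->
  exists2 r : R, 0 < r & forall z, sq x z <= r ^+ 2 -> `|g0 z - g0 x| <= e.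

Lemma cball_sub (a : R) : a < 2 * d -> 0 <= a -> cball y a `<=` Om.
Proof.
move=> ad a0 x xa; apply: ballOm; apply: (le_lt_trans xa).
by rewrite ltrXn2r.
Qed.

Lemma patchM (k psi : E -> R) (K : set E) : (forall x, psi x != 0 -> K x) ->
  (fun x => (k \_ K) x * psi x) = (fun x => k x * psi x).
Proof.
move=> h; apply/funext => x; rewrite patchE; case: ifPn => // /negP xK.
have [->|/h/mem_set//] := eqVneq (psi x) 0.
by rewrite !mulr0.
Qed.

Lemma intg_g0 (psi : E -> R) (K : set E) : compact K -> K `<=` Om ->
  (forall x, psi x != 0 -> K x) -> continuous psi -> intg (fun x => g0 x * psi x).
Proof.
move=> cK KO h cp; rewrite -(patchM g0 h).
have bp : bsupp psi.
  by have [L _ hL] := compact_sub_box cK; exists L => x /h/hL.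
have [C _ hC] := bsupp_bounded cp bp.
exact: (intgMb (g0int cK KO) (continuous_measurable3 cp) hC).
Qed.

(* Two potentials [newt e x] and [newt r x] differ by a test function vanishing
   at [y], so the averages of [g0] against [dens e x] do not depend on [e]. *)
Lemma mean_value (x : E) (r : R) : 0 < r -> r ^+ 2 <= sq y x -> cball x r `<=` Om ->
  Int (fun z => g0 z * dens m1 r x z) = mass m1 * g0 x.
Proof.
move=> r0 rx BO.
have cB := @compact_cball x r (ltW r0).
have xO : Om x by apply: BO; rewrite /cball /= /sq !subrr expr0n /= !addr0 sqr_ge0.
have xy : x != y.
  apply: contraTneq rx => ->; rewrite -ltNge /sq !subrr expr0n /= !addr0.
  by rewrite exprn_gt0.
have dsupp e : 0 < e <= r -> forall z, dens m1 e x z != 0 -> cball x r z.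
  move=> /andP[e0 er] z; apply: contra_neqP => /negP; rewrite -ltNge => h.
  apply: (dens0 NP) => //; apply: le_lt_trans h.
  by apply: lerXn2r => //; rewrite nnegrE ltW.
have cdens e : 0 < e -> continuous (dens m1 e x).
  by move=> e0; exact: smooth_continuous (smooth_dens NP x e0).
have ID e (er : 0 < e <= r) : intg (fun z => g0 z * dens m1 e x z).
  by apply: (intg_g0 cB BO (dsupp e er)); apply: cdens; case/andP: er.
have inv e : 0 < e <= r ->
    Int (fun z => g0 z * dens m1 r x z) = Int (fun z => g0 z * dens m1 e x z).
  move=> er; have /andP[e0 er'] := er.
  have rr : 0 < r <= r by rewrite r0 lexx.
  have tp : test_function Om (fun z => newt F e x z - newt F r x z).
    apply: (test_functionP (smoothB (smooth_newt NP e x) (smooth_newt NP r x)) cB BO) => z.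
    apply: contra_neqP => /negP; rewrite -ltNge => /ltW h.
    exact: (newt_sub0 NP).
  have := g0green tp; rewrite (laplacian_newt_sub NP x e0 r0).
  rewrite (newt_sub0 NP er) ?oppr0; last by rewrite sqC.
  have -> : (fun z => g0 z * (dens m1 r x z - dens m1 e x z)) =
      ((fun z => g0 z * dens m1 r x z) \- (fun z => g0 z * dens m1 e x z)).
    by apply/funext => z /=; rewrite mulrBr.
  by rewrite (IntB (ID _ rr) (ID _ er)) => /eqP; rewrite subr_eq0 => /eqP.
have M0 : 0 < mass m1 by apply: lt_le_trans (mass_lower NP); lra.
(* The radius may now shrink to some [t] for which [g0] differs from [g0 x] by at most e / mass on
   the ball; integrating against the density costs at most [e]. *)
apply/eqP; rewrite -subr_eq0 -normr_le0; apply/ler_addgt0Pr => e e0; rewrite add0r.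
have eM : 0 < e / mass m1 by rewrite divr_gt0.
have [s s0 hs] := g0cont xO xy eM.
pose t := Num.min s r.
have t0 : 0 < t by rewrite lt_min s0.
have tr : 0 < t <= r by rewrite t0 ge_min lexx orbT.
rewrite (inv _ tr) -(Int_dens NP x t0) mulrC -IntZ; last exact/intg_ccs/(ccs_dens NP).
have IZ := intgZ (g0 x) (intg_ccs (ccs_dens NP x t0)).
rewrite -(IntB (ID _ tr) IZ) (le_trans (ler_norm_Int (intgB (ID _ tr) IZ))) //.
have -> : e = Int (fun z => e / mass m1 * dens m1 t x z).
  rewrite IntZ; last exact/intg_ccs/(ccs_dens NP).
  by rewrite (Int_dens NP) // divfK // gt_eqF.
apply: le_Int; [exact: intg_norm (intgB (ID _ tr) IZ)|exact/intgZ/intg_ccs/(ccs_dens NP)|].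
move=> z /=; rewrite -mulrBl normrM (ger0_norm (dens_ge0 NP _ _ t0)).
have [h|h] := leP (sq x z) (t ^+ 2).
  rewrite ler_wpM2r ?(dens_ge0 NP) //; apply: hs; apply: (le_trans h).
  by apply: lerXn2r; rewrite ?nnegrE ?ge_min ?lexx // ltW.
by rewrite (dens0 NP) // !mulr0.
Qed.

(** Three constraints govern the radius: r < 4d/5, so that the spread charge at [y] lies where
    [cutoff] is 1; d + r < 2d, so that averages centred in the support of [cutoff] stay in [Om]; and
    2r < 2d, so that charges at distinct poles do not meet. *)
Let r : R := 3 / 4 * d.
Let K : set E := cball y (7 / 4 * d).

Let r0 : 0 < r. Proof. by rewrite /r mulr_gt0 // divr_gt0. Qed.
Let M0 : 0 < mass m1. Proof. by apply: lt_le_trans (mass_lower NP); lra. Qed.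
Let cK : compact K. Proof. by apply: compact_cball; rewrite mulr_ge0 // ?divr_ge0 // ltW. Qed.
Let KO : K `<=` Om. Proof. by have h := d0; apply: cball_sub; lra. Qed.

(** Reuses the step [m] of the profile: 1 for |x - y| <= 4d/5 and 0 for |x - y| >= d. *)
Definition cutoff (x : E) : R := 1 - m (d^-1 ^+ 2 * sq y x).

(** The average of [g0] against the density of radius 3d/4 around [x]. Truncation to the ball of
    radius 7d/4 makes the kernel integrable on the whole space and is invisible for |x - y| <= d. *)
Definition regular (x : E) : R :=
  (mass m1)^-1 * convol (g0 \_ (cball y (7 / 4 * d))) (dens m1 (3 / 4 * d) 0) x.

(* By the mean value property [regular] and [g0] agree on the annulus where
   [cutoff] varies (lemma [regularE]), so [smoothed] has the smooth source
   [dens / mass] instead of a Dirac mass and equals [g0] away from [y]. *)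
Definition smoothed (x : E) : R := (1 - cutoff x) * g0 x + cutoff x * regular x.

Lemma smooth_cutoff : smooth cutoff.
Proof.
apply: (smoothB (smooth_cst 1)); apply: (smooth_comp (np_sm NP)).
exact: (smoothZ _ (smooth_sq y)).
Qed.

Lemma cutoff1 x : sq y x <= 16 / 25 * d ^+ 2 -> cutoff x = 1.
Proof.
move=> h; rewrite /cutoff (np_m0 NP) ?subr0 //.
by rewrite exprVn mulrC ler_pdivrMr // exprn_gt0.
Qed.

Lemma cutoff0 x : d ^+ 2 <= sq y x -> cutoff x = 0.
Proof.
move=> h; rewrite /cutoff (np_m_1 NP) ?subrr //.
by rewrite exprVn mulrC ler_pdivlMr ?mul1r // exprn_gt0.
Qed.

Lemma cutoff_supp x : cutoff x != 0 -> cball y d x.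
Proof. by apply: contra_neqP => /negP; rewrite -ltNge => /ltW/cutoff0. Qed.

Lemma smooth_regular : smooth regular.
Proof.
apply: smoothZ; apply: smooth_convol; first exact: g0int.
  exact: (smooth_dens NP).
exact: (bsupp_dens NP).
Qed.

Lemma cball_r_sub x : cball y d x -> cball x r `<=` K.
Proof.
move=> hx z hz; rewrite /K /cball /=; have -> : 7 / 4 * d = d + r by rewrite /r; field.
by apply: (sq_triangle _ _ hx hz); exact: ltW.
Qed.

Lemma dens_supp (e : R) x z : 0 < e -> dens m1 e x z != 0 -> cball x e z.
Proof.
by move=> e0; apply: contra_neqP => /negP; rewrite -ltNge; exact: (dens0 NP).
Qed.

Lemma regularE x : r ^+ 2 <= sq y x -> cball y d x -> regular x = g0 x.
Proof.
move=> rx hx; have sub := cball_r_sub hx.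
rewrite /regular /convol.
have -> : (fun z => (g0 \_ (cball y (7 / 4 * d))) z * dens m1 (3 / 4 * d) 0 (x - z)) =
    (fun z => g0 z * dens m1 r x z).
  rewrite -(@patchM g0 (dens m1 r x) K).
    by apply/funext => z; rewrite dens_sub densC.
  by move=> z /(dens_supp r0)/sub.
rewrite (mean_value r0 rx); last exact: subset_trans KO.
by rewrite mulKf // gt_eqF.
Qed.

Lemma smoothedE x : r ^+ 2 <= sq y x -> smoothed x = g0 x.
Proof.
move=> rx; rewrite /smoothed; have [h|/ltW h] := leP (sq y x) (d ^+ 2).
  by rewrite regularE //; ring.
by rewrite cutoff0 //; ring.
Qed.

Lemma test_cutoff (f : E -> R) : smooth f -> test_function Om (fun x => cutoff x * f x).
Proof.
move=> sf; have cB : compact (cball y d) by apply: compact_cball; exact: ltW.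
apply: (test_functionP (smoothM smooth_cutoff sf) cB).
  by have h := d0; apply: cball_sub; lra.
by move=> x; rewrite mulf_eq0 negb_or => /andP[/cutoff_supp].
Qed.

(** Fubini transfers the averaging to [phi]. The averaged function [kap] is a test function
    supported in [K], so the distributional equation of [g0] evaluates it at the pole. *)
Lemma Int_regular_laplacian (phi : E -> R) : smooth phi -> (forall x, phi x != 0 -> cball y d x) ->
  Int (fun x => regular x * laplacian phi x) =
  - ((mass m1)^-1 * Int (fun x => dens m1 r y x * phi x)).
Proof.
move=> sp hp.
have bp : bsupp phi.
  by exists (`|y.1.1| + `|y.1.2| + `|y.2| + d) => x /hp h; apply: (sq_box h); exact: ltW.
have gK := g0int cK KO.
have sl := smooth_laplacian sp; have bl := bsupp_laplacian bp.
have s0 := smooth_dens NP 0 r0; have b0 := bsupp_dens NP 0 r0.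
have cl : ccs (laplacian phi) by exact: ccs_smooth.
have c0 : ccs (dens m1 r 0) by exact: ccs_smooth.
have Ip : intg phi by apply/intg_ccs/ccs_smooth.
pose kap := convol phi (dens m1 r 0).
have skap : smooth kap by exact: smooth_convol.
have kapE z : kap z = Int (fun x => dens m1 r z x * phi x).
  by congr Int; apply/funext => x; rewrite dens_sub densC mulrC.
(* The Laplacian passes from the density to [phi]: first by the symmetry of the former, then by
   Green's second identity. *)
have lkapE z : laplacian kap z = Int (fun x => dens m1 r 0 (x - z) * laplacian phi x).
  rewrite /kap (laplacian_convol Ip s0 b0).
  transitivity (Int (fun x => phi x * laplacian (dens m1 r z) x)).
    exact: (congr1 (@Int R) (funext (fun x => congr1 ( *%R (phi x)) (laplacian_dens_sub r z x)))).
  apply: etrans (Int_laplacian sp (smooth_dens NP z r0) (or_introl bp)) _.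
  by congr Int; apply/funext => x; rewrite dens_sub.
have kapK z : kap z != 0 -> K z.
  apply: contra_neqP => nK; rewrite kapE -[RHS](@Int0 R); congr Int; apply/funext => x.
  have [->|/hp hx] := eqVneq (phi x) 0; first by rewrite mulr0.
  rewrite (dens0 NP) ?mul0r // ltNge; apply/negP => h; apply: nK.
  by apply: (cball_r_sub hx); rewrite /cball /= sqC.
have tk : test_function Om kap by exact: (test_functionP skap cK KO).
have -> : (fun x => regular x * laplacian phi x) =
    (fun x => (mass m1)^-1 * (convol (g0 \_ K) (dens m1 r 0) x * laplacian phi x)).
  by apply/funext => x; rewrite /regular mulrA.
have clK : closed K by exact: closed_cball.
rewrite IntZ; last first.
  have sc := smooth_convol gK s0 b0.
  by apply: (intg_smoothM sc sl); right.
rewrite (Int_convol gK c0 cl).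
have -> : (fun z => (g0 \_ K) z * Int (fun x => dens m1 r 0 (x - z) * laplacian phi x)) =
    (fun z => (g0 \_ K) z * laplacian kap z).
  by apply/funext => z; rewrite lkapE.
rewrite (patchM g0 (laplacian_supp clK kapK)) (g0green tk) kapE.
by rewrite mulrN.
Qed.

Lemma intg_smoothed (phi : E -> R) (B : set E) : compact B -> B `<=` Om ->
  (forall x, phi x != 0 -> B x) -> continuous phi -> intg (fun x => smoothed x * phi x).
Proof.
move=> cB BO hB cp.
have cc := smooth_continuous smooth_cutoff.
have cw := smooth_continuous smooth_regular.
have -> : (fun x => smoothed x * phi x) = (fun x => g0 x * ((1 - cutoff x) * phi x)) \+
    (fun x => cutoff x * regular x * phi x).
  by apply/funext => x; rewrite /smoothed /=; ring.
apply: intgD.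
  apply: (intg_g0 cB BO).
    by move=> x; rewrite mulf_eq0 negb_or => /andP[_ /hB].
  move=> x; apply: cvgM; last exact: cp.
  by apply: cvgB; [exact: cvg_cst|exact: cc].
apply: intg_ccs; split.
  by move=> x; apply: cvgM; [apply: cvgM; [exact: cc|exact: cw]|exact: cp].
apply: bsuppMr.
by have [L _ hL] := compact_sub_box cB; exists L => x /hB/hL.
Qed.

Lemma Int_smoothed_laplacian (phi : E -> R) : test_function Om phi ->
  Int (fun x => smoothed x * laplacian phi x) =
  - ((mass m1)^-1 * Int (fun x => dens m1 r y x * phi x)).
Proof.
move=> tphi; have [sp cS SO] := tphi.
pose phi' x := cutoff x * phi x.
have sp' : smooth phi' by exact: (smoothM smooth_cutoff sp).
have tp' : test_function Om phi' by exact: test_cutoff.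
have hp' x : phi' x != 0 -> cball y d x.
  by rewrite mulf_eq0 negb_or => /andP[/cutoff_supp].
have cB : compact (cball y d) by apply: compact_cball; exact: ltW.
have BO : cball y d `<=` Om by have h := d0; apply: cball_sub; lra.
have phi'E x : phi' x = cutoff x * phi x by [].
clearbody phi'.
have hl' := laplacian_supp (@closed_cball y d) hp'.
have hl := laplacian_supp (@closed_closure _ [set x | phi x != 0])
  (fun x => @subset_closure _ [set x | phi x != 0] x).
have cl := smooth_continuous (smooth_laplacian sp).
have cl' := smooth_continuous (smooth_laplacian sp').
have yy : sq y y = 0 by rewrite /sq !subrr expr0n /= !addr0.
have near1 x : sq y x < 16 / 25 * d ^+ 2 -> laplacian phi' x = laplacian phi x.
  move=> h; apply: (laplacian_open (@open_sq_lt y (16 / 25 * d ^+ 2))) => // z /= hz.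
  by rewrite phi'E cutoff1 ?mul1r // ltW.
(* A pointwise identity without derivatives of [g0]: near the pole phi' and [phi] have the same
   Laplacian, on the annulus [regular] equals [g0], and beyond it the Laplacian of phi' vanishes. *)
have -> : (fun x => smoothed x * laplacian phi x) =
   ((fun x => g0 x * laplacian phi x) \+ (fun x => regular x * laplacian phi' x))
   \- (fun x => g0 x * laplacian phi' x).
  apply/funext => x /=; have [h|h] := ltP (sq y x) (16 / 25 * d ^+ 2).
    by rewrite near1 // /smoothed cutoff1 ?(ltW h) //; ring.
  have rx : r ^+ 2 <= sq y x by apply: le_trans h; rewrite /r; nra.
  rewrite smoothedE //; have [hd|hd] := leP (sq y x) (d ^+ 2).
    by rewrite (regularE rx hd) addrK.
  have -> : laplacian phi' x = 0.
    by apply/eqP; apply: contraTT hd => /hl'; rewrite -leNgt.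
  by ring.
have I1 := intg_g0 cS SO hl cl.
have I2 := intg_g0 cB BO hl' cl'.
have I3 : intg (fun x => regular x * laplacian phi' x).
  apply: (intg_smoothM smooth_regular (smooth_laplacian sp')); right.
  by apply: bsupp_laplacian; exact: test_bsupp tp'.
apply: etrans (IntB (intgD I1 I3) I2) _.
have e12 := etrans (IntD I1 I3) (congr2 +%R (g0green tphi) (Int_regular_laplacian sp' hp')).
apply: etrans (congr2 (fun a b => a - b) e12 (g0green tp')) _.
(* Both point evaluations at the pole cancel, and only the spread charge remains. *)
have -> : phi' y = phi y.
  by rewrite phi'E cutoff1 ?mul1r // yy mulr_ge0 // sqr_ge0.
have -> : (fun x => dens m1 r y x * phi' x) = (fun x => dens m1 r y x * phi x).
  apply/funext => x; have [h|h] := leP (sq y x) (16 / 25 * d ^+ 2).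
    by rewrite phi'E cutoff1 ?mul1r.
  rewrite (dens0 NP) ?mul0r //; apply: le_lt_trans h; rewrite /r; nra.
ring.
Qed.

End Potential.

(** * Dirichlet space and energy *)

Section Dirichlet.
Context {R : realType}.
Notation E := (R * R * R)%type.
Local Notation T := (R3 (measurableTypeR R)).
Local Notation mu := (@leb3 R).
Implicit Types (U : set E) (v phi : E -> R) (dv : E -> E).

Lemma dot_ge0 (a : E) : 0 <= dot a a.
Proof. by rewrite /dot -!expr2 !addr_ge0 ?sqr_ge0. Qed.

Lemma enorm_sq (a : E) : enorm a ^+ 2 = dot a a.
Proof. by rewrite /enorm sqr_sqrtr // dot_ge0. Qed.

Lemma smooth_grad_measurable U phi : smooth phi ->
  @measurable_fun _ _ T T U (grad phi).
Proof.
move=> sp; apply: measurable_funTS.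
by apply: measurable_fun_pair; [apply: measurable_fun_pair|];
  apply: (continuous_measurable3 (smooth_continuous (smooth_partial _ sp))).
Qed.

Lemma measurable_dot U (f : E -> E) : @measurable_fun _ _ T T U f ->
  @measurable_fun _ _ T _ U (fun x => dot (f x) (f x)).
Proof.
move=> mf.
have m2 : @measurable_fun _ _ T (measurableTypeR R) U (fun x => (f x).2).
  exact: (measurableT_comp measurable_snd mf).
have m11 : @measurable_fun _ _ T (measurableTypeR R) U (fun x => (f x).1.1).
  exact: (measurableT_comp measurable_fst (measurableT_comp measurable_fst mf)).
have m12 : @measurable_fun _ _ T (measurableTypeR R) U (fun x => (f x).1.2).
  exact: (measurableT_comp measurable_snd (measurableT_comp measurable_fst mf)).
apply: measurable_funD; first apply: measurable_funD.
- exact: (measurable_funM m11 m11).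
- exact: (measurable_funM m12 m12).
- exact: (measurable_funM m2 m2).
Qed.

Lemma measurable_fun_pair_on d d1 d2 (X : measurableType d) (X1 : measurableType d1)
    (X2 : measurableType d2) (D : set X) (f : X -> X1) (g : X -> X2) : measurable D ->
  measurable_fun D f -> measurable_fun D g -> measurable_fun D (fun x => (f x, g x)).
Proof.
move=> mD mf mg _ Y mY.
have /(_ measurableT Y mY) := measurable_fun_pair ((measurable_restrictT f mD).1 mf)
  ((measurable_restrictT g mD).1 mg).
rewrite setTI => h.
have -> : D `&` (fun x => (f x, g x)) @^-1` Y =
    D `&` (fun x => ((f \_ D) x, (g \_ D) x)) @^-1` Y.
  apply/seteqP; split=> x [Dx] /= Yx; split=> //=; move: Yx;
  by rewrite !patchE (mem_set Dx).
exact: measurableI.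
Qed.

Lemma measurable_vec U (f : E -> E) : measurable U ->
  @measurable_fun _ _ T T U f <-> [/\ @measurable_fun _ _ T (measurableTypeR R) U (fun x => (f x).1.1),
   @measurable_fun _ _ T (measurableTypeR R) U (fun x => (f x).1.2) &
   @measurable_fun _ _ T (measurableTypeR R) U (fun x => (f x).2)].
Proof.
move=> mU; split=> [mf|[m1 m2 m3]].
  split.
  - exact: (measurableT_comp measurable_fst (measurableT_comp measurable_fst mf)).
  - exact: (measurableT_comp measurable_snd (measurableT_comp measurable_fst mf)).
  - exact: (measurableT_comp measurable_snd mf).
have -> : f = fun x => ((f x).1.1, (f x).1.2, (f x).2).
  by apply/funext => x; rewrite -!surjective_pairing.
apply: measurable_fun_pair_on => //; exact: measurable_fun_pair_on.
Qed.

Lemma measurable_lin_vec U (a : R) (f g : E -> E) : @measurable _ T U ->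
  @measurable_fun _ _ T T U f -> @measurable_fun _ _ T T U g ->
  @measurable_fun _ _ T T U (fun x => a *: f x + g x).
Proof.
move=> mU /(measurable_vec _ mU)[f1 f2 f3] /(measurable_vec _ mU)[g1 g2 g3].
apply/(measurable_vec _ mU); split.
- exact: (measurable_funD (measurable_funM (measurable_cst a) f1) g1).
- exact: (measurable_funD (measurable_funM (measurable_cst a) f2) g2).
- exact: (measurable_funD (measurable_funM (measurable_cst a) f3) g3).
Qed.

Lemma cvge0_lt (u : nat -> \bar R) (e : R) : u @ \oo --> 0%E -> 0 < e ->
  \forall n \near \oo, (u n < e%:E)%E.
Proof.
move=> /fine_cvgP[fu /cvgrPdist_lt cu] e0.
have := cu _ e0; apply: filterS2 fu => n fn /=; rewrite sub0r normrN => h.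
by rewrite -(fineK fn) lte_fin (le_lt_trans (ler_norm _)).
Qed.

(** Stands in for Hoelder's inequality: it turns smallness in L^6 into smallness of a pairing with a
    bounded, compactly supported function. *)
Lemma le_sixth (s c : R) : 0 <= s -> 0 < c -> s <= c + s ^+ 6 / c ^+ 5.
Proof.
move=> s0 c0; have c50 : 0 < c ^+ 5 by rewrite exprn_gt0.
have [h|/ltW h] := leP s c; first by rewrite (le_trans h) // lerDl divr_ge0 ?exprn_ge0 // ltW.
rewrite (@le_trans _ _ (s ^+ 6 / c ^+ 5)) //; last by rewrite lerDr ltW.
rewrite ler_pdivlMr // [s ^+ 6]exprS ler_wpM2l //.
by apply: lerXn2r => //; rewrite nnegrE // ltW.
Qed.

Lemma pairing_cvg U v psi (phi : nat -> E -> R) (e : R) : @measurable _ T U ->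
  @measurable_fun _ _ T _ U v ->
  (forall n, test_function U (phi n)) ->
  (fun n => \int[mu]_(x in U) (`|phi n x - v x| ^+ 6)%:E)%E @ \oo --> (0 : \bar R)%E ->
  ccs psi -> (forall x, psi x != 0 -> U x) -> intg (fun x => v x * psi x) -> 0 < e ->
  \forall n \near \oo, `|Int (fun x => phi n x * psi x) - Int (fun x => v x * psi x)| <= e.
Proof.
move=> mU mv tphi h6 cpsi psiU Iv e0.
have [C C0 hC] := ccs_bounded cpsi; have [cp bp] := cpsi.
have Ip := intg_ccs cpsi.
pose J := Int (fun x => `|psi x|); have J0 : 0 <= J by exact: Int_ge0.
(* The first term of [le_sixth] then contributes at most e / 2, and [t] below is the L^6 smallness
   that makes the second at most e / 2. The summand 1 guards against J = 0. *)
pose c := e / (2 * (J + 1)); have c0 : 0 < c by rewrite divr_gt0 // mulr_gt0 // ltr_wpDl.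
have C1 : 0 < C + 1 by rewrite ltr_wpDl.
have c50 : 0 < c ^+ 5 by rewrite exprn_gt0.
pose t := e / 2 * (c ^+ 5 / (C + 1)).
have t0 : 0 < t by rewrite mulr_gt0 ?divr_gt0.
have := cvge0_lt h6 t0; apply: filterS => n hn.
have [sp cS SU] := tphi n.
have Iphi : intg (fun x => phi n x * psi x).
  apply: intg_ccs; split; last exact: bsuppMr.
  by move=> x; apply: cvgM; [exact: smooth_continuous|exact: cp].
rewrite -(IntB Iphi Iv).
have ID := intgB Iphi Iv; have IN := intg_norm ID.
apply: (le_trans (ler_norm_Int ID)).
rewrite -lee_fin (Int_integral IN).
have -> : (\int[mu]_x (`|phi n x * psi x - v x * psi x|)%:E =
   \int[mu]_(x in U) (`|phi n x * psi x - v x * psi x|)%:E)%E.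
  rewrite [RHS]integral_mkcond; apply: eq_integral => x _; rewrite patchE.
  case: ifPn => // /negP xU; have -> : psi x = 0.
    by apply/eqP; apply: contraT => /psiU/mem_set/xU.
  by rewrite !mulr0 subrr normr0.
have mphi : @measurable_fun _ _ T _ U (phi n).
  exact: measurable_funTS (continuous_measurable3 (smooth_continuous sp)).
have mpsi : @measurable_fun _ _ T _ U psi.
  exact: measurable_funTS (continuous_measurable3 cp).
have md : @measurable_fun _ _ T _ U (fun x => `|phi n x - v x| ^+ 6).
  by apply: measurable_funX; apply: measurableT_comp => //; exact: measurable_funB.
have mN : @measurable_fun _ _ T _ U (fun x => c * `|psi x|).
  by apply: measurable_funM => //; exact: measurableT_comp.
pose k := (C + 1) / c ^+ 5; have k0 : 0 < k by rewrite divr_gt0.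
have mk : @measurable_fun _ _ T _ U (fun x => k * `|phi n x - v x| ^+ 6).
  exact: measurable_funM.
apply: (@le_trans _ _ (\int[mu]_(x in U)
   ((c * `|psi x|)%:E + (k * `|phi n x - v x| ^+ 6)%:E))%E).
  apply: ge0_le_integral => //.
  - apply/measurable_EFinP; apply: measurableT_comp => //.
    by apply: measurable_funB; apply: measurable_funM.
  - by apply: emeasurable_funD; exact/measurable_EFinP.
  - move=> x _; rewrite -EFinD lee_fin -mulrBl normrM.
    have h := le_sixth (normr_ge0 (phi n x - v x)) c0.
    have p0 := normr_ge0 (psi x).
    have s60 : 0 <= `|phi n x - v x| ^+ 6 / c ^+ 5 by rewrite divr_ge0 ?exprn_ge0 // ltW.
    apply: (le_trans (ler_wpM2r p0 h)); rewrite mulrDl lerD2l /k.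
    rewrite [leRHS](_ : _ = `|phi n x - v x| ^+ 6 / c ^+ 5 * (C + 1)); last by ring.
    by rewrite ler_wpM2l // (le_trans (hC x)) // lerDl.
rewrite ge0_integralD //; first last.
- exact/measurable_EFinP.
- by move=> x _; rewrite lee_fin mulr_ge0 ?exprn_ge0 // ltW.
- exact/measurable_EFinP.
- by move=> x _; rewrite lee_fin mulr_ge0 // ltW.
have -> : e%:E = ((e / 2)%:E + (e / 2)%:E)%E by rewrite -EFinD; congr EFin; field.
apply: leeD.
  apply: (@le_trans _ _ (\int[mu]_x (c * `|psi x|)%:E)%E).
    apply: ge0_subset_integral => //.
      apply/measurable_EFinP; apply: measurable_funM => //.
      by apply: measurableT_comp => //; exact: continuous_measurable3.
    by move=> x _; rewrite lee_fin mulr_ge0 // ltW.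
  rewrite -(Int_integral (intgZ c (intg_norm Ip))) (IntZ c (intg_norm Ip)) -/J lee_fin /c.
  have J1 : 0 < J + 1 by rewrite ltr_wpDl.
  rewrite [leLHS](_ : _ = e / 2 * (J / (J + 1))); last by field; rewrite gt_eqF.
  by apply: ler_piMr; [rewrite divr_ge0 // ltW|rewrite ler_pdivrMr // mul1r lerDl].
under eq_integral do rewrite EFinM.
rewrite ge0_integralZl_EFin //; last 2 first.
- exact/measurable_EFinP.
- exact: ltW.
apply: (@le_trans _ _ (k%:E * t%:E)%E).
  by apply: lee_wpmul2l; [rewrite lee_fin ltW|exact: ltW].
rewrite -EFinM lee_fin /k /t le_eqVlt; apply/orP; left; apply/eqP.
by field; rewrite !gt_eqF.
Qed.

(** The defect is |a - b/2|^2. With gradients of two approximants, it bounds the energy of one by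
    their mixed energy, which the weak equation controls. *)
Lemma dot_young (a b : E) : 3 / 4 * dot b b <= dot a b + dot (a - b) (a - b).
Proof.
case: a => -[a1 a2] a3; case: b => -[b1 b2] b3.
rewrite /dot -[(a1, a2, a3) - _]/(a1 - b1, a2 - b2, a3 - b3) /=.
have h1 := sqr_ge0 (a1 - b1 / 2); have h2 := sqr_ge0 (a2 - b2 / 2).
have h3 := sqr_ge0 (a3 - b3 / 2).
lra.
Qed.

Lemma dot_sub_le (a b c : E) :
  dot (a - b) (a - b) <= 2 * dot (a - c) (a - c) + 2 * dot (b - c) (b - c).
Proof.
case: a => -[a1 a2] a3; case: b => -[b1 b2] b3; case: c => -[c1 c2] c3.
rewrite /dot -![(_, _, _) - _]/(_ - _, _ - _, _ - _) /=.
have h1 := sqr_ge0 ((a1 - c1) + (b1 - c1)); have h2 := sqr_ge0 ((a2 - c2) + (b2 - c2)).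
have h3 := sqr_ge0 ((a3 - c3) + (b3 - c3)).
lra.
Qed.

Lemma test_partial0 U phi i x : test_function U phi -> ~ U x -> partial i phi x = 0.
Proof.
move=> [_ _ SU] nU; apply/eqP; apply: contra_notT nU => /(partial_supp _) h.
apply/SU; apply: (h (supp phi)); first exact: closed_closure.
exact: subset_closure.
Qed.

Lemma test_grad0 U phi x : test_function U phi -> ~ U x -> grad phi x = 0.
Proof. by move=> tp nU; rewrite /grad !(test_partial0 _ tp nU). Qed.

Lemma ccs_dot_grad (f g : E -> R) : smooth f -> smooth g -> bsupp f ->
  ccs (fun x => dot (grad f x) (grad g x)).
Proof.
move=> sf sg bf.
have -> : (fun x => dot (grad f x) (grad g x)) =
    (fun x => \sum_(i < 3) partial i f x * partial i g x).
  by apply/funext => x; exact: dot_grad.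
split.
  by apply: smooth_continuous; apply: smooth_sum => i;
    exact: (smoothM (smooth_partial i sf) (smooth_partial i sg)).
by apply: bsupp_sum => i; apply: bsuppMl; exact: bsupp_partial.
Qed.

Lemma gradB (f g : E -> R) x : smooth f -> smooth g ->
  grad (fun x => f x - g x) x = grad f x - grad g x.
Proof. by move=> sf sg; rewrite /grad !(partialB _ sf sg). Qed.

Lemma measurable_err U phi dv : @measurable _ T U -> smooth phi ->
  @measurable_fun _ _ T T U dv ->
  @measurable_fun _ _ T (measurableTypeR R) U (fun x => enorm (grad phi x - dv x) ^+ 2).
Proof.
move=> mU sp mdv.
have -> : (fun x => enorm (grad phi x - dv x) ^+ 2) =
    (fun x => dot (-1 *: dv x + grad phi x) (-1 *: dv x + grad phi x)).
  by apply/funext => x; rewrite enorm_sq scaleN1r addrC.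
by apply: measurable_dot; apply: measurable_lin_vec => //; exact: smooth_grad_measurable.
Qed.

(* [v] and [tau] are coupled by [- Delta v = tau]; an approximation [phi] of [v]
   nearly satisfies the energy identity, although [v] itself is never
   differentiated. *)
Lemma energy U v dv (tau : E -> R) : @measurable _ T U -> dirichlet_space U v dv ->
  (forall psi (B : set E), compact B -> B `<=` U -> (forall x, psi x != 0 -> B x) ->
     continuous psi -> intg (fun x => v x * psi x)) ->
  (forall phi, test_function U phi ->
     Int (fun x => v x * laplacian phi x) = - Int (fun x => tau x * phi x)) ->
  (exists B, [/\ compact B, B `<=` U & forall x, tau x != 0 -> B x]) -> continuous tau ->
  forall e, 0 < e -> exists phi, [/\ test_function U phi,
    `|Int (fun x => tau x * phi x) - Int (fun x => v x * tau x)| <= e &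
    3 / 4 * Int (fun x => dot (grad phi x) (grad phi x)) <= Int (fun x => tau x * phi x) + e].
Proof.
move=> mU [mv mdv [phi [tphi hA hB]]] Iv weak [B [cB BU tB]] ct e e0.
have ctau : ccs tau.
  by split => //; have [L _ hL] := compact_sub_box cB; exists L => x /tB/hL.
(* Two gradient errors below e / 8, each weighted by 2, add up to e / 2. *)
have e8 : 0 < e / 8 by rewrite divr_gt0.
have e2 : 0 < e / 2 by rewrite divr_gt0.
have near1 := cvge0_lt hA e8.
have near2 := pairing_cvg mU mv tphi hB ctau (fun x h => BU _ (tB x h)) (Iv _ _ cB BU tB ct) e0.
have [n [/= An tn]] := filter_ex (filterI near1 near2).
have [sn cSn SUn] := tphi n; have bn := test_bsupp (tphi n).
have hSn x : phi n x != 0 -> supp (phi n) x by move=> h; exact: subset_closure.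
have hl : forall x, laplacian (phi n) x != 0 -> supp (phi n) x.
  by apply: laplacian_supp => //; exact: closed_closure.
have cl := smooth_continuous (smooth_laplacian sn).
have cc : ccs (laplacian (phi n)) by split => //; exact: bsupp_laplacian.
(* The index [k] is chosen after [n], because this pairing is against the Laplacian of [phi n]. *)
have near3 := pairing_cvg mU mv tphi hB cc (fun x h => SUn _ (hl x h)) (Iv _ _ cSn SUn hl cl) e2.
have [k [/= Ak tk]] := filter_ex (filterI near1 near3).
have [sk cSk SUk] := tphi k; have bk := test_bsupp (tphi k).
exists (phi n); split.
- exact: tphi.
- have -> : (fun x => tau x * phi n x) = (fun x => phi n x * tau x).
    by apply/funext => x; rewrite mulrC.
  exact: tn.
have Inn := intg_ccs (ccs_dot_grad sn sn bn).
have Ikn := intg_ccs (ccs_dot_grad sk sn bk).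
have skn := smoothB sk sn.
have Idd := intg_ccs (ccs_dot_grad skn skn (bsuppB bk bn)).
have Hdd : Int (fun x => dot (grad (fun x => phi k x - phi n x) x)
    (grad (fun x => phi k x - phi n x) x)) <= e / 2.
  rewrite -lee_fin (Int_integral Idd).
  apply: (@le_trans _ _ (\int[mu]_(x in U) (2%:E * (enorm (grad (phi k) x - dv x) ^+ 2)%:E +
      2%:E * (enorm (grad (phi n) x - dv x) ^+ 2)%:E))%E).
    rewrite (_ : (\int[mu]_x _)%E = (\int[mu]_(x in U) (dot (grad (fun x => phi k x - phi n x) x)
    (grad (fun x => phi k x - phi n x) x))%:E)%E); last first.
      rewrite [RHS]integral_mkcond; apply: eq_integral => x _; rewrite patchE.
      case: ifPn => // /negP xU; have nU : ~ U x by move=> /mem_set.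
      rewrite (gradB _ sk sn) (test_grad0 (tphi k) nU) (test_grad0 (tphi n) nU) subrr.
      by rewrite /dot /= !mulr0 !addr0.
    apply: ge0_le_integral => //.
    - by move=> x _; rewrite lee_fin dot_ge0.
    - apply/measurable_EFinP; apply: measurable_dot; exact: smooth_grad_measurable.
    - apply: emeasurable_funD; apply: emeasurable_funM => //; apply/measurable_EFinP;
        exact: measurable_err.
    - move=> x _; rewrite -!EFinM -EFinD lee_fin !enorm_sq (gradB _ sk sn).
      exact: dot_sub_le.
  have pos c : forall x, U x -> (0 <= 2%:E * (enorm (grad (phi c) x - dv x) ^+ 2)%:E)%E.
    by move=> x _; rewrite -EFinM lee_fin mulr_ge0 // sqr_ge0.
  have mE c : measurable_fun U (fun x : T => (enorm (grad (phi c) x - dv x) ^+ 2)%:E).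
    by have [sc _ _] := tphi c; apply/measurable_EFinP; exact: measurable_err.
  have mE2 c : measurable_fun U (fun x : T => (2%:E * (enorm (grad (phi c) x - dv x) ^+ 2)%:E)%E).
    by apply: emeasurable_funM.
  rewrite (ge0_integralD _ mU (pos k) (mE2 k) (pos n) (mE2 n)).
  have eZ c : (\int[mu]_(x in U) (2%:E * (enorm (grad (phi c) x - dv x) ^+ 2)%:E) =
      2%:E * \int[mu]_(x in U) (enorm (grad (phi c) x - dv x) ^+ 2)%:E)%E.
    apply: ge0_integralZl_EFin => //.
      by move=> x _; rewrite lee_fin sqr_ge0.
    exact: mE.
  rewrite !eZ.
  have -> : (e / 2)%:E = (2%:E * (e / 8)%:E + 2%:E * (e / 8)%:E)%E.
    by rewrite -!EFinM -EFinD; congr EFin; field.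
  have h2 : (0 <= 2%:E :> \bar R)%E by rewrite lee_fin.
  exact: (leeD (lee_wpmul2l h2 (ltW Ak)) (lee_wpmul2l h2 (ltW An))).
have key x : 3 / 4 * dot (grad (phi n) x) (grad (phi n) x) <=
   dot (grad (phi k) x) (grad (phi n) x) +
   dot (grad (fun x => phi k x - phi n x) x) (grad (fun x => phi k x - phi n x) x).
  by rewrite (gradB _ sk sn); exact: dot_young.
have h := le_Int (intgZ (3 / 4) Inn) (intgD Ikn Idd) key.
(* Green's identity puts both derivatives on [phi n]; replacing [phi k] by [v] costs e / 2, and the
   weak equation is then tested with [phi n] itself. *)
have hb : Int (fun x => dot (grad (phi k) x) (grad (phi n) x)) <=
    Int (fun x => tau x * phi n x) + e / 2.
  have e1 := Int_green sk sn (or_introl bk); have e3 := weak _ (tphi n).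
  apply: le_trans (_ : - Int (fun x => phi k x * laplacian (phi n) x) <= _).
    by rewrite le_eqVlt; apply/orP; left; apply/eqP; exact: e1.
  move/ler_normlP : tk => [tk1 _]; move: tk1 e3.
  move: (Int (fun x => v x * laplacian (phi n) x)) (Int (fun x => phi k x * laplacian (phi n) x)).
  by move=> a b h1 h2; lra.
apply: le_trans (_ : Int (fun x => dot (grad (phi k) x) (grad (phi n) x)) + e / 2 <= _).
  apply: le_trans (lerD (lexx _) Hdd).
  apply: (le_trans _ (le_trans h _)); first by rewrite (IntZ _ Inn).
  by rewrite le_eqVlt; apply/orP; left; apply/eqP; exact: (IntD Ikn Idd).
apply: (le_trans (lerD hb (lexx (e / 2)))).
by rewrite -addrA -splitr.
Qed.

End Dirichlet.

(** * Linear structure of the Dirichlet space *)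

Section DirichletLinear.
Context {R : realType}.
Notation E := (R * R * R)%type.
Local Notation T := (R3 (measurableTypeR R)).
Local Notation mu := (@leb3 R).
Implicit Types (U : set E) (v phi : E -> R) (dv : E -> E).

Lemma test_supp U phi x : test_function U phi -> phi x != 0 -> supp phi x.
Proof. by move=> _ h; exact: subset_closure. Qed.

Lemma test_function_lin U (a : R) phi psi : test_function U phi -> test_function U psi ->
  test_function U (fun x => a * phi x + psi x).
Proof.
move=> tp tq; have [sp cp pU] := tp; have [sq cq qU] := tq.
apply: (@test_functionP _ U _ (supp phi `|` supp psi)).
- exact: (smoothD (smoothZ a sp) sq).
- exact: compactU.
- by move=> x [/pU|/qU].
- move=> x h; have [p0|/(test_supp tp) hp] := eqVneq (phi x) 0; last by left.
  have [q0|/(test_supp tq) hq] := eqVneq (psi x) 0; last by right.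
  by move: h; rewrite p0 q0 mulr0 addr0 eqxx.
Qed.

Lemma cvge0_squeeze (u w w' : nat -> \bar R) (c : R) : 0 <= c -> (forall n, 0 <= u n)%E ->
  (forall n, u n <= c%:E * w n + c%:E * w' n)%E ->
  w @ \oo --> 0%E -> w' @ \oo --> 0%E -> u @ \oo --> 0%E.
Proof.
move=> c0 u0 uw cw cw'.
apply: (@squeeze_cvge _ _ _ _ (cst 0%E) _ (fun n => c%:E * w n + c%:E * w' n)%E).
- by apply: nearW => n; rewrite u0 uw.
- exact: cvg_cst.
- have cz (z : nat -> \bar R) : z @ \oo --> 0%E -> (fun n => c%:E * z n)%E @ \oo --> 0%E.
    by move=> cz; rewrite -(mule0 c%:E); exact: cvgeZl.
  by rewrite -(adde0 0%E); apply: cvgeD => //; exact: cz.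
Qed.

Lemma integral_le_lin U (f g h : T -> R) (c : R) : @measurable _ T U -> 0 <= c ->
  measurable_fun U f -> measurable_fun U g -> measurable_fun U h ->
  (forall x, 0 <= f x) -> (forall x, 0 <= g x) -> (forall x, 0 <= h x) ->
  (forall x, h x <= c * f x + c * g x) ->
  (\int[mu]_(x in U) (h x)%:E <=
   c%:E * \int[mu]_(x in U) (f x)%:E + c%:E * \int[mu]_(x in U) (g x)%:E)%E.
Proof.
move=> mU c0 /measurable_EFinP mf /measurable_EFinP mg /measurable_EFinP mh f0 g0 h0 hh.
have eZ (k : T -> R) : measurable_fun U (fun x => (k x)%:E) -> (forall x, 0 <= k x) ->
    (c%:E * \int[mu]_(x in U) (k x)%:E = \int[mu]_(x in U) (c%:E * (k x)%:E))%E.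
  move=> mk k0; apply/esym/ge0_integralZl_EFin => //.
  by move=> x _; rewrite lee_fin.
have cM (k : T -> R) : measurable_fun U (fun x => (k x)%:E) ->
    measurable_fun U (fun x => (c%:E * (k x)%:E)%E) by move=> mk; exact: emeasurable_funM.
have cp (k : T -> R) : (forall x, 0 <= k x) -> forall x, U x -> (0 <= c%:E * (k x)%:E)%E.
  by move=> k0 x _; rewrite -EFinM lee_fin mulr_ge0.
rewrite (eZ f mf f0) (eZ g mg g0).
rewrite -(ge0_integralD mu mU (cp f f0) (cM f mf) (cp g g0) (cM g mg)).
apply: ge0_le_integral => //.
- by move=> x _; rewrite lee_fin.
- by apply: emeasurable_funD; exact: cM.
- by move=> x _; rewrite -!EFinM -EFinD lee_fin.
Qed.

Lemma grad_lin (a : R) phi psi x : smooth phi -> smooth psi ->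
  grad (fun x => a * phi x + psi x) x = a *: grad phi x + grad psi x.
Proof.
move=> sp sq; rewrite /grad !(partialD _ (smoothZ a sp) sq) !(partialZ _ a sp).
by [].
Qed.

Lemma enorm_lin_le (a : R) (p q : E) :
  enorm (a *: p + q) ^+ 2 <= (2 * a ^+ 2 + 2) * enorm p ^+ 2 + (2 * a ^+ 2 + 2) * enorm q ^+ 2.
Proof.
rewrite !enorm_sq; case: p => -[p1 p2] p3; case: q => -[q1 q2] q3.
rewrite /dot -[_ *: _ + _]/(a * p1 + q1, a * p2 + q2, a * p3 + q3) /=.
have h (s t : R) : (a * s + t) * (a * s + t) <= (2 * a ^+ 2 + 2) * (s * s) + (2 * a ^+ 2 + 2) * (t * t).
  rewrite -subr_ge0.
  have -> : (2 * a ^+ 2 + 2) * (s * s) + (2 * a ^+ 2 + 2) * (t * t) - (a * s + t) * (a * s + t) =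
    (a * s - t) ^+ 2 + 2 * s ^+ 2 + 2 * (a * t) ^+ 2 by ring.
  by rewrite !addr_ge0 ?sqr_ge0 // mulr_ge0 ?sqr_ge0.
have := h p1 q1; have := h p2 q2; have := h p3 q3; lra.
Qed.

(** |a s + t| is at most twice the larger of |a s| and |t|, and 2^6 = 64. *)
Lemma sixth_lin_le (a s t : R) :
  `|a * s + t| ^+ 6 <= (64 * a ^+ 6 + 64) * `|s| ^+ 6 + (64 * a ^+ 6 + 64) * `|t| ^+ 6.
Proof.
have A0 : 0 <= a ^+ 6 by rewrite -[6%N]/(3 * 2)%N exprM sqr_ge0.
have s0 := exprn_ge0 6 (normr_ge0 s); have t0 := exprn_ge0 6 (normr_ge0 t).
have -> : a ^+ 6 = `|a| ^+ 6 by rewrite -normrX ger0_norm.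
have B0 := exprn_ge0 6 (normr_ge0 a).
have [h|/ltW h] := leP (`|a * s|) `|t|.
  have h1 : `|a * s + t| <= 2 * `|t| by have := ler_normD (a * s) t; lra.
  apply: (@le_trans _ _ ((2 * `|t|) ^+ 6)); first by apply: lerXn2r; rewrite ?nnegrE ?mulr_ge0.
  have -> : (2 * `|t|) ^+ 6 = 64 * `|t| ^+ 6 by ring.
  by nra.
have h1 : `|a * s + t| <= 2 * (`|a| * `|s|) by have := ler_normD (a * s) t; rewrite normrM in h *; lra.
apply: (@le_trans _ _ ((2 * (`|a| * `|s|)) ^+ 6)); first by apply: lerXn2r; rewrite ?nnegrE ?mulr_ge0.
have -> : (2 * (`|a| * `|s|)) ^+ 6 = 64 * `|a| ^+ 6 * `|s| ^+ 6 by ring.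
by nra.
Qed.

Lemma dirichlet_ext U v v' dv : (forall x, U x -> v x = v' x) ->
  dirichlet_space U v dv -> dirichlet_space U v' dv.
Proof.
move=> vv' [mv mdv [phi [tphi hA hB]]]; split => //.
  by apply: eq_measurable_fun mv => x; rewrite inE; exact: vv'.
exists phi; split => //.
suff -> : (fun n => \int[mu]_(x in U) (`|phi n x - v' x| ^+ 6)%:E)%E =
  (fun n => \int[mu]_(x in U) (`|phi n x - v x| ^+ 6)%:E)%E by [].
by apply/funext => n; apply: eq_integral => x; rewrite inE => Ux; rewrite vv'.
Qed.

Lemma dirichlet_lin U (a : R) v v' dv dv' : @measurable _ T U ->
  dirichlet_space U v dv -> dirichlet_space U v' dv' ->
  dirichlet_space U (fun x => a * v x + v' x) (fun x => a *: dv x + dv' x).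
Proof.
move=> mU [mv mdv [phi [tphi hA hB]]] [mv' mdv' [psi [tpsi hA' hB']]].
have mphi n : @measurable_fun _ _ T (measurableTypeR R) U (phi n).
  have [s _ _] := tphi n.
  exact: measurable_funTS (continuous_measurable3 (smooth_continuous s)).
have mpsi n : @measurable_fun _ _ T (measurableTypeR R) U (psi n).
  have [s _ _] := tpsi n.
  exact: measurable_funTS (continuous_measurable3 (smooth_continuous s)).
have m6 (f g : E -> R) : @measurable_fun _ _ T (measurableTypeR R) U f ->
    @measurable_fun _ _ T (measurableTypeR R) U g ->
    @measurable_fun _ _ T (measurableTypeR R) U (fun x => `|f x - g x| ^+ 6).
  move=> mf mg; apply: measurable_funX.
  by apply: measurableT_comp => //; exact: measurable_funB.
have mlin : @measurable_fun _ _ T (measurableTypeR R) U (fun x => a * v x + v' x).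
  exact: (measurable_funD (measurable_funM (measurable_cst a) mv) mv').
have mdlin := measurable_lin_vec a mU mdv mdv'.
split => //.
exists (fun n x => a * phi n x + psi n x); split.
- by move=> n; exact: test_function_lin.
- have c0 : 0 <= 2 * a ^+ 2 + 2 by rewrite addr_ge0 // mulr_ge0 // sqr_ge0.
  apply: (cvge0_squeeze c0 _ _ hA hA').
    by move=> n; apply: integral_ge0 => x _; rewrite lee_fin sqr_ge0.
  move=> n; have [s _ _] := tphi n; have [s' _ _] := tpsi n.
  have [s'' _ _] := test_function_lin a (tphi n) (tpsi n).
  apply: integral_le_lin => //; try (by move=> x; rewrite sqr_ge0); try exact: measurable_err.
  move=> x; rewrite (grad_lin a x s s').
  have -> : a *: grad (phi n) x + grad (psi n) x - (a *: dv x + dv' x) =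
      a *: (grad (phi n) x - dv x) + (grad (psi n) x - dv' x).
    by rewrite scalerBr opprD addrACA.
  exact: enorm_lin_le.
- have c0 : 0 <= 64 * a ^+ 6 + 64.
    by rewrite addr_ge0 // mulr_ge0 // -[6%N]/(3 * 2)%N exprM sqr_ge0.
  apply: (cvge0_squeeze c0 _ _ hB hB').
    by move=> n; apply: integral_ge0 => x _; rewrite lee_fin exprn_ge0.
  move=> n; apply: integral_le_lin => //; try (by move=> x; rewrite exprn_ge0);
    try exact: m6.
  - apply: m6 => //.
    exact: (measurable_funD (measurable_funM (measurable_cst a) (mphi n)) (mpsi n)).
  - move=> x.
    have -> : a * phi n x + psi n x - (a * v x + v' x) =
        a * (phi n x - v x) + (psi n x - v' x) by ring.
    exact: sixth_lin_le.
Qed.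

Lemma dirichlet_test U phi : @measurable _ T U -> test_function U phi ->
  dirichlet_space U phi (grad phi).
Proof.
move=> mU tp; have [sp _ _] := tp; split.
- exact: measurable_funTS (continuous_measurable3 (smooth_continuous sp)).
- exact: smooth_grad_measurable.
- exists (fun=> phi); split => //.
    rewrite (_ : (fun=> _) = cst 0%E); first exact: cvg_cst.
    apply/funext => n; rewrite /= integral0_eq // => x _.
    by rewrite subrr enorm_sq /dot /= !mulr0 !addr0.
  rewrite (_ : (fun=> _) = cst 0%E); first exact: cvg_cst.
  apply/funext => n; rewrite /= integral0_eq // => x _.
  by rewrite subrr normr0 expr0n.
Qed.

Lemma test_function0 U : test_function U (fun=> 0 : R).
Proof.
apply: (@test_functionP _ U _ set0); [exact: smooth_cst|exact: compact0|by []|].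
by move=> x; rewrite eqxx.
Qed.

Lemma dirichlet_sum (I : eqType) (r : seq I) U (q : I -> R) (v : I -> E -> R) : @measurable _ T U ->
  (forall i, exists dv, dirichlet_space U (v i) dv) ->
  exists dv, dirichlet_space U (fun x => \sum_(i <- r) q i * v i x) dv.
Proof.
move=> mU hv; elim: r => [|i r [dw ih]].
  exists (grad (fun=> 0)); apply: dirichlet_ext (dirichlet_test mU (test_function0 U)).
  by move=> x _; rewrite big_nil.
have [dv hdv] := hv i; exists (fun x => q i *: dv x + dw x).
apply: dirichlet_ext (dirichlet_lin (q i) mU hdv ih).
by move=> x _; rewrite big_cons.
Qed.

End DirichletLinear.

(** * Positivity of the Green matrix *)

Section Geometry.
Context {R : realType}.
Notation E := (R * R * R)%type.
Local Notation T := (R3 (measurableTypeR R)).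
Local Notation mu := (@leb3 R).

Lemma nbhs_sq (x : E) (P : set E) : nbhs x P ->
  exists2 r : R, 0 < r & forall z, sq x z <= r ^+ 2 -> P z.
Proof.
move=> /nbhs_normP[e /= e0 eP]; have e2 : 0 < e / 2 by rewrite divr_gt0.
exists (e / 2) => // z hz; apply: eP; rewrite /ball_ /=.
have s1 := sqr_ge0 (z.1.1 - x.1.1); have s2 := sqr_ge0 (z.1.2 - x.1.2).
have s3 := sqr_ge0 (z.2 - x.2).
have H (a b : R) : (a - b) ^+ 2 <= (e / 2) ^+ 2 -> `|b - a| < e.
  move=> hs; apply: (@le_lt_trans _ _ (e / 2)); last by lra.
  by rewrite distrC -(@ler_pXn2r _ 2) ?nnegrE ?(ltW e2) // real_normK ?num_real.
rewrite /sq in hz.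
rewrite /Num.norm /= !gt_max; apply/andP; split; first apply/andP; first split.
all: apply: H; lra.
Qed.

Lemma enorm_sub_sq (x y : E) : enorm (x - y) ^+ 2 = sq y x.
Proof. by rewrite enorm_sq /dot /sq -!expr2. Qed.

Lemma ball_in_open (om FF : set E) (y : E) (d : R) : 0 < d -> open om -> om y -> FF y ->
  ((2 * d)%:E <= set_dist FF (boundary om))%E ->
  forall x, sq y x < (2 * d) ^+ 2 -> om x.
Proof.
move=> d0 oom omy Fy hd x hx; apply: contrapT => nx.
pose g (t : R) : E := t *: (x - y) + y.
have cg : continuous g.
  by move=> t; apply: cvgD; [apply: cvgZr_tmp; exact: cvg_id|exact: cvg_cst].
have g0 : g 0 = y by rewrite /g scale0r add0r.
have g1 : g 1 = x by rewrite /g scale1r subrK.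
pose S := [set t : R | 0 <= t <= 1 /\ ~ om (g t)].
have S1 : S 1 by split; [rewrite ler01 lexx|rewrite g1].
have lS : has_lbound S by exists 0 => t [/andP[]].
have hS : has_inf S by split => //; exists 1.
pose s := inf S.
have s1 : s <= 1 by exact: ge_inf.
have s0 : 0 <= s by apply: lb_le_inf; [exists 1|move=> t [/andP[]]].
have ngs : ~ om (g s).
  move=> omgs; have /cg : nbhs (g s) om by exact: open_nbhs_nbhs.
  move=> /nbhs_normP[e /= e0 he].
  have [t St ts] := inf_adherent e0 hS.
  have st : s <= t by exact: ge_inf.
  case: St => _; apply; apply: he; rewrite /ball_ /= distrC ger0_norm ?subr_ge0 //.
  by rewrite ltrBlDl.
have s_gt0 : 0 < s.
  by rewrite lt_neqAle s0 andbT; apply: contra_notN ngs => /eqP <-; rewrite g0.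
have bs : boundary om (g s).
  split; last by move=> /interior_subset.
  move=> B /cg /nbhs_normP[e /= e0 he].
  pose t := Num.max 0 (s - e / 2).
  have ts : t < s by rewrite gt_max s_gt0 /= ltrBlDr ltrDl divr_gt0.
  have t0 : 0 <= t by rewrite le_max lexx.
  exists (g t); split.
    apply: contrapT => nt; have : s <= t.
      by apply: ge_inf => //; split => //; rewrite t0 (le_trans (ltW ts)).
    by rewrite leNgt ts.
  apply: he; rewrite /ball_ /= ger0_norm ?subr_ge0 ?(ltW ts) //.
  have : s - e / 2 <= t by rewrite le_max lexx orbT.
  by lra.
have : ((2 * d)%:E <= (enorm (y - g s))%:E)%E.
  apply: (le_trans hd); apply: ereal_inf_lbound.
  by exists (y, g s).
rewrite lee_fin leNgt => /negP; apply.
have e0 : 0 <= enorm (y - g s) by exact: sqrtr_ge0.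
rewrite -(@ltr_pXn2r _ 2) ?nnegrE ?mulr_ge0 ?(ltW d0) //.
rewrite enorm_sub_sq; apply: le_lt_trans hx.
have -> : sq (g s) y = s ^+ 2 * sq y x.
  rewrite /sq /g -[s *: (x - y) + y]/(s * (x.1.1 - y.1.1) + y.1.1,
    s * (x.1.2 - y.1.2) + y.1.2, s * (x.2 - y.2) + y.2) /=.
  by ring.
by rewrite ler_piMl ?sq_ge0 // expr_le1.
Qed.

(** [G] is set to zero outside [Om], so that integrals over the whole space express hypotheses that
    concern [Om] alone. *)
Lemma green_intg (Om : set E) G y (K : set E) : green_function Om G -> Om y -> compact K ->
  K `<=` Om -> intg (((G^~ y) \_ Om) \_ K).
Proof.
move=> hG Oy cK KO; have [_ hK _ _] := hG y Oy.
have -> : ((G^~ y) \_ Om) \_ K = (G^~ y) \_ K.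
  apply/funext => x; rewrite !patchE; case: ifPn => // xK.
  by rewrite ifT //; apply/mem_set/KO/set_mem.
have mK : @measurable _ T K.
  by apply: closed_measurable3; apply: compact_closed => //; exact: norm_hausdorff.
by rewrite /intg -restrict_EFin; apply/(integrable_mkcond _ mK); exact: hK.
Qed.

Lemma green_laplacian (Om : set E) G y phi : green_function Om G -> Om y ->
  test_function Om phi ->
  Int (fun x => ((G^~ y) \_ Om) x * laplacian phi x) = - phi y.
Proof.
move=> hG Oy tp; have [_ _ /(_ phi tp) h _] := hG y Oy.
apply/eqP; rewrite -addr_eq0 -h; apply/eqP; congr (_ + _).
rewrite unlock [RHS]Rintegral_mkcond; congr (\int[mu]_x _); apply/funext => x.
by rewrite !patchE; case: ifPn => // _; rewrite mul0r.
Qed.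

Lemma green_continuous (Om : set E) G y x (e : R) : open Om -> green_function Om G -> Om y ->
  Om x -> x != y -> 0 < e -> exists2 r : R, 0 < r & forall z, sq x z <= r ^+ 2 ->
    `|((G^~ y) \_ Om) z - ((G^~ y) \_ Om) x| <= e.
Proof.
move=> oO hG Oy Ox xy e0; have [hc _ _ _] := hG y Oy.
apply: nbhs_sq.
have xin : x \in Om `\ y by rewrite inE; split => //; exact/eqP.
have /cvgrPdist_le/(_ e e0) := hc x xin; apply: filterS2 (open_nbhs_nbhs (conj oO Ox)).
by move=> z Oz; rewrite !patchE !mem_set // distrC.
Qed.

End Geometry.

(** * Self-energies and the Gram matrix *)

Section Gram.
Context {R : realType}.
Notation E := (R * R * R)%type.
Local Notation T := (R3 (measurableTypeR R)).
Implicit Types (U : set E) (v tau : E -> R).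

Definition locally_integrable_against U v := forall (psi : E -> R) (B : set E),
  compact B -> B `<=` U -> (forall x, psi x != 0 -> B x) -> continuous psi ->
  intg (fun x => v x * psi x).

Definition source U tau := continuous tau /\
  exists B, [/\ compact B, B `<=` U & forall x, tau x != 0 -> B x].

Definition weak_laplacian U v tau := forall phi, test_function U phi ->
  Int (fun x => v x * laplacian phi x) = - Int (fun x => tau x * phi x).

Lemma intg_source U v tau : locally_integrable_against U v -> source U tau ->
  intg (fun x => v x * tau x).
Proof. by move=> hv [ct [B [cB BU hB]]]; exact: (hv tau B). Qed.

(** The Dirichlet integral of an approximant is nonnegative, which bounds the self-energy below by
    minus an arbitrary error. *)
Lemma self_energy_ge0 U v dv tau : @measurable _ T U -> dirichlet_space U v dv ->
  locally_integrable_against U v -> weak_laplacian U v tau -> source U tau ->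
  0 <= Int (fun x => v x * tau x).
Proof.
move=> mU hD hv hw [ct hB]; apply/ler_addgt0Pr => e e0.
have e2 : 0 < e / 2 by rewrite divr_gt0.
have [phi [_ /ler_normlP[h1 h2] h3]] := energy mU hD hv hw hB ct e2.
have P0 : 0 <= Int (fun x => dot (grad phi x) (grad phi x)).
  by apply: Int_ge0 => x; exact: dot_ge0.
lra.
Qed.

(** By [energy], 3/8 of the Dirichlet integral is at most half of the pairing of [tau] with the
    approximant, up to an error. Absorbing this half doubles 2/3 c to 4/3 c. *)
Lemma self_energy_le U v dv tau (c : R) : @measurable _ T U -> dirichlet_space U v dv ->
  locally_integrable_against U v -> weak_laplacian U v tau -> source U tau ->
  (forall phi, test_function U phi -> Int (fun x => tau x * phi x) <=
     3 / 8 * Int (fun x => dot (grad phi x) (grad phi x)) + 2 / 3 * c) ->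
  Int (fun x => v x * tau x) <= 4 / 3 * c.
Proof.
move=> mU hD hv hw [ct hB] hc; apply/ler_addgt0Pr => e e0.
have e2 : 0 < e / 2 by rewrite divr_gt0.
have [phi [tp /ler_normlP[h1 h2] h3]] := energy mU hD hv hw hB ct e2.
have := hc phi tp; lra.
Qed.

Lemma continuous_fsum (I : Type) (r : seq I) (f : I -> E -> R) :
  (forall i, continuous (f i)) -> continuous (fun x => \sum_(i <- r) f i x).
Proof.
move=> cf; elim: r => [|i r ih].
  have -> : (fun x => \sum_(i <- [::]) f i x) = fun=> 0.
    by apply/funext => x; rewrite big_nil.
  by move=> x; exact: cvg_cst.
have -> : (fun x => \sum_(k <- i :: r) f k x) = (fun x => f i x + \sum_(k <- r) f k x).
  by apply/funext => x; rewrite big_cons.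
by move=> x; apply: cvgD; [exact: cf|exact: ih].
Qed.

(** The quadratic form is the self-energy of the superposition of the potentials [v i] with weights
    [q i], whose source is the same superposition of the [tau i]. *)
Lemma gram_ge0 (I : finType) U (v tau : I -> E -> R) (q : I -> R) : @measurable _ T U ->
  (forall i, exists dv, dirichlet_space U (v i) dv) ->
  (forall i, locally_integrable_against U (v i)) ->
  (forall i, weak_laplacian U (v i) (tau i)) -> (forall i, source U (tau i)) ->
  0 <= \sum_i \sum_k q i * q k * Int (fun x => v i x * tau k x).
Proof.
move=> mU hD hv hw hs.
have [dv hdv] := dirichlet_sum (index_enum I) q mU hD.
have hV : locally_integrable_against U (fun x => \sum_i q i * v i x).
  move=> psi B cB BU hB cp.
  have -> : (fun x => (\sum_i q i * v i x) * psi x) =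
      (fun x => \sum_i q i * (v i x * psi x)).
    by apply/funext => x; rewrite mulr_suml; apply: eq_bigr => i _; rewrite mulrA.
  by apply: intg_sum => i; apply: intgZ; exact: (hv i psi B).
have hsrc : source U (fun x => \sum_k q k * tau k x).
  split.
    apply: continuous_fsum => k x.
    by apply: cvgM; [exact: cvg_cst|exact: (hs k).1].
  have /choice[B hB] : forall k, exists B, [/\ compact B, B `<=` U & forall x, tau k x != 0 -> B x].
    by move=> k; exact: (hs k).2.
  exists (\bigcup_(k in [set` index_enum I]) B k); split.
  - by rewrite bigcup_seq; apply: bigsetU_compact => k _; have [] := hB k.
  - by move=> x [k _ Bx]; have [_ + _] := hB k; apply.
  - move=> x /eqP hx; apply: contrapT => nx; apply: hx; apply: big1 => k _.
    have [_ _ h] := hB k; have [->|/h Bx] := eqVneq (tau k x) 0; first by rewrite mulr0.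
    by case: nx; exists k => //; exact: mem_index_enum.
have hweak : weak_laplacian U (fun x => \sum_i q i * v i x) (fun x => \sum_k q k * tau k x).
  move=> phi tp; have [sp cS SU] := tp.
  have hl : forall x, laplacian phi x != 0 -> supp phi x.
    by apply: laplacian_supp; [exact: closed_closure|move=> x; exact: test_supp tp].
  have cl := smooth_continuous (smooth_laplacian sp).
  have I1 i : intg (fun x => q i * (v i x * laplacian phi x)).
    by apply: intgZ; exact: (hv i _ _ cS SU hl cl).
  have I2 k : intg (fun x => tau k x * phi x).
    have [ct [B [cB _ hB]]] := hs k.
    apply: intg_ccs; split.
      by move=> x; apply: cvgM; [exact: ct|exact: (smooth_continuous sp)].
    by apply: bsuppMr; exact: test_bsupp tp.
  have -> : (fun x => (\sum_i q i * v i x) * laplacian phi x) =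
      (fun x => \sum_i q i * (v i x * laplacian phi x)).
    by apply/funext => x; rewrite mulr_suml; apply: eq_bigr => i _; rewrite mulrA.
  have -> : (fun x => (\sum_i q i * tau i x) * phi x) =
      (fun x => \sum_i q i * (tau i x * phi x)).
    by apply/funext => x; rewrite mulr_suml; apply: eq_bigr => i _; rewrite mulrA.
  rewrite (Int_sum _ I1) (Int_sum _ (fun k => intgZ (q k) (I2 k))) -sumrN.
  apply: eq_bigr => i _.
  rewrite (IntZ _ (hv i _ _ cS SU hl cl)) (IntZ _ (I2 i)) -mulrN; congr (_ * _).
  exact: hw.
have := self_energy_ge0 mU hdv hV hweak hsrc.
suff -> : Int (fun x => (\sum_i q i * v i x) * (\sum_k q k * tau k x)) =
  \sum_i \sum_k q i * q k * Int (fun x => v i x * tau k x) by [].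
have I3 i k := intgZ (q i * q k) (intg_source (hv i) (hs k)).
have -> : (fun x => (\sum_i q i * v i x) * (\sum_k q k * tau k x)) =
   (fun x => \sum_i \sum_k (q i * q k) * (v i x * tau k x)).
  apply/funext => x; rewrite mulr_suml; apply: eq_bigr => i _; rewrite mulr_sumr.
  by apply: eq_bigr => k _; rewrite mulrACA.
rewrite Int_sum => [|i]; last by apply: intg_sum => k; exact: I3.
apply: eq_bigr => i _; rewrite (Int_sum _ (I3 i)).
by apply: eq_bigr => k _; rewrite (IntZ _ (intg_source (hv i) (hs k))).
Qed.

End Gram.

(** * Lower bound for the Green form *)

Section GreenMatrix.
Context {R : realType}.
Notation E := (R * R * R)%type.
Local Notation T := (R3 (measurableTypeR R)).
Variables (N : nat) (Om : set E) (O : 'I_N -> E) (G : E -> E -> R) (d : R).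
Hypotheses (d0 : 0 < d) (oOm : open Om) (hG : green_function Om G).
Hypothesis ballOm : forall j x, sq (O j) x < (2 * d) ^+ 2 -> Om x.
Hypothesis sepO : forall i k, i != k -> (2 * d) ^+ 2 <= sq (O i) (O k).

Lemma green_matrix_coercive (q : 'I_N -> R) :
  - (6 / (5 * d)) * \sum_i q i ^+ 2 <=
  \sum_i \sum_k q i * q k * ((1 - (i == k)%:R) * G (O k) (O i)).
Proof.
have hd := d0; have [F [F1 [m [m1 NP]]]] := @exists_newton_profile R.
have mOm : @measurable _ T Om by exact: open_measurable3.
have OO i : Om (O i).
  by apply: (ballOm (j := i)); rewrite /sq !subrr expr0n /= !addr0 exprn_gt0 // mulr_gt0.
pose g i := (G^~ (O i)) \_ Om.
have gint i := fun K => @green_intg R Om G (O i) K hG (OO i).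
have ggreen i := fun phi => @green_laplacian R Om G (O i) phi hG (OO i).
have gcont i : forall x, Om x -> x != O i -> forall e : R, 0 < e ->
    exists2 r : R, 0 < r & forall z, sq x z <= r ^+ 2 -> `|g i z - g i x| <= e.
  by move=> x Ox xO e; exact: green_continuous.
pose r : R := 3 / 4 * d.
have r0 : 0 < r by rewrite mulr_gt0 // divr_gt0.
pose h i := smoothed m m1 (O i) (g i) d.
have M52 := mass_lower NP.
have M0 : 0 < mass m1 by apply: lt_le_trans M52; lra.
pose tau k x := (mass m1)^-1 * dens m1 r (O k) x.
have hint i : locally_integrable_against Om (h i).
  by move=> psi B; exact: (intg_smoothed NP d0 (ballOm (j := i)) (gint i)).
have hweak i : weak_laplacian Om (h i) (tau i).
  move=> phi tp.
  apply: etrans (Int_smoothed_laplacian NP d0 (ballOm (j := i)) (gint i) (ggreen i) (gcont i) tp) _.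
  rewrite -IntZ; last first.
    have [sp _ _] := tp.
    by apply: (intg_smoothM (smooth_dens NP (O i) r0) sp); right; exact: test_bsupp tp.
  by congr (- Int _); apply/funext => x; rewrite /tau mulrA.
have cB k : compact (cball (O k) r) by apply: compact_cball; exact: ltW.
have BO k : cball (O k) r `<=` Om by apply: (cball_sub (ballOm (j := k))); rewrite /r; lra.
have tsupp k x : tau k x != 0 -> cball (O k) r x.
  by rewrite mulf_eq0 negb_or => /andP[_]; exact: (dens_supp NP r0).
have hsrc k : source Om (tau k).
  split; last by exists (cball (O k) r); split; [exact: cB|exact: BO|exact: tsupp].
  exact: smooth_continuous (smoothZ _ (smooth_dens NP (O k) r0)).
(* Away from the pole, [h i] belongs to the space by the boundary condition on [G], taken with the
   cutoff as [chi]; the remaining part is a test function. *)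
have hD i : exists dv, dirichlet_space Om (h i) dv.
  have [_ _ _ hchi] := hG (OO i).
  have tc : test_function Om (cutoff m (O i) d).
    have := test_cutoff NP d0 (ballOm (j := i)) (smooth_cst (1 : R)).
    by congr test_function; apply/funext => x; rewrite mulr1.
  have nc : \forall x \near O i, cutoff m (O i) d x = 1.
    have op := @open_sq_lt R (O i) (16 / 25 * d ^+ 2).
    have h0 : sq (O i) (O i) < 16 / 25 * d ^+ 2.
      by rewrite /sq !subrr expr0n /= !addr0 mulr_gt0 ?divr_gt0 // exprn_gt0.
    apply: filterS (open_nbhs_nbhs (conj op h0)) => x /= hx.
    by apply: (cutoff1 NP d0); exact: ltW.
  have [dg hdg] := hchi _ tc nc.
  have tw := test_cutoff NP d0 (ballOm (j := i)) (smooth_regular NP d0 (ballOm (j := i)) (gint i)).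
  have := dirichlet_lin 1 mOm hdg (dirichlet_test mOm tw).
  set dv := (X in dirichlet_space _ _ X) => hdv; exists dv.
  apply: dirichlet_ext hdv => x Ox.
  by rewrite /h /smoothed /g patchE mem_set // mul1r.
have offdiag i k : i != k -> Int (fun x => h i x * tau k x) = G (O k) (O i).
  move=> ik.
  (* A point within r of both poles would put them within 2r = 3d/2 of each other. *)
  have far x : cball (O k) r x -> (3 / 4 * d) ^+ 2 <= sq (O i) x.
    move=> hx; rewrite leNgt; apply/negP => /ltW hlt.
    have hx' : sq x (O k) <= r ^+ 2 by rewrite sqC.
    have := sq_triangle (ltW r0) (ltW r0) hlt hx'.
    have := sepO ik; rewrite /r; have d20 : 0 < d ^+ 2 by rewrite exprn_gt0.
    nra.
  have -> : (fun x => h i x * tau k x) = (fun x => (mass m1)^-1 * (g i x * dens m1 r (O k) x)).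
    apply/funext => x; have [t0|tn] := eqVneq (tau k x) 0.
      have -> : dens m1 r (O k) x = 0.
        by move/eqP: t0; rewrite /tau mulf_eq0 invr_eq0 (gt_eqF M0) => /eqP.
      by rewrite t0 !mulr0.
    rewrite /h (smoothedE NP d0 (ballOm (j := i)) (gint i) (ggreen i) (gcont i) (far _ (tsupp _ _ tn))).
    by rewrite /tau mulrCA.
  rewrite IntZ; last first.
    apply: (intg_g0 (gint i) (cB k) (BO k)).
      by move=> x; exact: (dens_supp NP r0).
    exact: smooth_continuous (smooth_dens NP (O k) r0).
  have Bk : cball (O k) r (O k) by rewrite /cball /= /sq !subrr expr0n /= !addr0 sqr_ge0.
  rewrite (mean_value NP (gint i) (ggreen i) (gcont i) r0 (far _ Bk) (BO k)).
  by rewrite mulKf ?gt_eqF // /g patchE mem_set.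
have diag i : Int (fun x => h i x * tau i x) <= 6 / (5 * d).
  have [dv hdv] := hD i.
  pose c : R := 5 / 4 / r / mass m1.
  have hc phi : test_function Om phi -> Int (fun x => tau i x * phi x) <=
      3 / 8 * Int (fun x => dot (grad phi x) (grad phi x)) + 2 / 3 * c.
    move=> tp; have [sp _ _] := tp; have bp := test_bsupp tp.
    (* The weight l = 3/4 mass produces, after division by the mass, the coefficient 3/8 that
       [self_energy_le] can absorb. *)
    have l0 : 0 < 3 / 4 * mass m1 by rewrite mulr_gt0 // divr_gt0.
    have ID := intg_smoothM (smooth_dens NP (O i) r0) sp (or_intror bp).
    have -> : (fun x => tau i x * phi x) = (fun x => (mass m1)^-1 * (dens m1 r (O i) x * phi x)).
      by apply/funext => x; rewrite /tau -mulrA.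
    rewrite (IntZ _ ID) mulrC ler_pdivrMr //.
    apply: (le_trans (Int_dens_test NP (O i) r0 l0 sp bp)).
    rewrite le_eqVlt; apply/orP; left; apply/eqP; rewrite /c.
    by move: (Int _) => P; field; rewrite !gt_eqF.
  apply: (le_trans (self_energy_le mOm hdv (hint i) (hweak i) (hsrc i) hc)).
  have -> : 4 / 3 * c = 20 / 9 / mass m1 / d.
    by rewrite /c /r; field; rewrite !gt_eqF.
  have -> : 6 / (5 * d) = 6 / 5 / d by field; rewrite gt_eqF.
  rewrite ler_wpM2r ?invr_ge0 ?(ltW d0) // ler_pdivrMr //; lra.
have H := gram_ge0 q mOm hD hint hweak hsrc.
rewrite mulNr mulr_sumr -subr_ge0 opprK -big_split /=.
apply: (le_trans H); apply: ler_sum => i _.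
rewrite (bigD1 i) //= [in leRHS](bigD1 i) //= eqxx subrr mul0r mulr0 add0r [leLHS]addrC.
apply: lerD.
  rewrite le_eqVlt; apply/orP; left; apply/eqP; apply: eq_bigr => k ki.
  have ik : i != k by rewrite eq_sym.
  by rewrite (offdiag _ _ ik) (negbTE ik) subr0 mul1r.
by rewrite -expr2 mulrC; apply: ler_wpM2r; [exact: sqr_ge0|exact: diag].
Qed.

End GreenMatrix.

(** * The linear system *)

Section Coercive.
Context {R : realType}.

Lemma weighted_coercive_unitmx (N : nat) (A : 'M[R]_N) (c : 'I_N -> R) (k : R) :
  0 < k -> (forall j, 0 < c j) ->
  (forall x : 'cV[R]_N, k * \sum_j c j * x j 0 ^+ 2 <= \sum_j c j * x j 0 * (A *m x) j 0) ->
  A \in unitmx.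
Proof.
move=> k0 c0 hA; rewrite unitmxE unitfE -det_tr; apply/det0P => -[v vn0 vA].
pose x := v^T.
have Ax : A *m x = 0 by rewrite -[A]trmxK -trmx_mul vA trmx0.
have h0 : \sum_j c j * x j 0 ^+ 2 <= 0.
  rewrite -(ler_pM2l k0) mulr0 (le_trans (hA x)) // Ax big1 // => j _.
  by rewrite [X in _ * X]mxE mulr0.
case/negP: vn0; apply/eqP/rowP => j; rewrite mxE.
have p i : 0 <= c i * x i 0 ^+ 2 by rewrite mulr_ge0 ?sqr_ge0 // ltW.
have : c j * x j 0 ^+ 2 <= 0.
  by apply: le_trans h0; rewrite (bigD1 j) //= lerDl sumr_ge0.
rewrite pmulr_rle0 // => h; have /eqP : x j 0 ^+ 2 = 0.
  by apply/eqP; rewrite eq_le h sqr_ge0.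
by rewrite sqrf_eq0 mxE => /eqP.
Qed.

Lemma weighted_coercive_bound (N : nat) (A : 'M[R]_N) (c : 'I_N -> R) (k : R) (x b : 'cV[R]_N) :
  0 < k -> (forall j, 0 < c j) ->
  k * \sum_j c j * x j 0 ^+ 2 <= \sum_j c j * x j 0 * (A *m x) j 0 ->
  A *m x = - b ->
  \sum_j c j * x j 0 ^+ 2 <= k ^- 2 * \sum_j c j * b j 0 ^+ 2.
Proof.
move=> k0 c0 hA Ax; rewrite Ax in hA.
have h : \sum_j c j * x j 0 * (- b) j 0 <=
    k / 2 * (\sum_j c j * x j 0 ^+ 2) + (2 * k)^-1 * (\sum_j c j * b j 0 ^+ 2).
  rewrite !mulr_sumr -big_split /=; apply: ler_sum => j _; rewrite mxE -subr_ge0.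
  have -> : k / 2 * (c j * x j 0 ^+ 2) + (2 * k)^-1 * (c j * b j 0 ^+ 2) - c j * x j 0 * - b j 0 =
      c j * (2 * k)^-1 * (k * x j 0 + b j 0) ^+ 2.
    by field; rewrite gt_eqF.
  by rewrite mulr_ge0 ?sqr_ge0 // mulr_ge0 ?ltW // invr_gt0 mulr_gt0.
have {}h := le_trans hA h.
rewrite mulrC ler_pdivlMr ?exprn_gt0 //.
set X := \sum_j _ in h *; set B := \sum_j _ in h *.
have h2 : k / 2 * X <= (2 * k)^-1 * B by lra.
have h3 := ler_wpM2l (ltW (mulr_gt0 (ltr0n R 2) k0)) h2.
have e1 : 2 * k * (k / 2 * X) = X * k ^+ 2 by field.
have e2 : 2 * k * ((2 * k)^-1 * B) = B by rewrite mulVKf // mulf_neq0 // gt_eqF.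
by rewrite -e1 -e2.
Qed.

End Coercive.

Theorem lemma1 (R : realType) :
  exists2 c0 : R, 0 < c0 &
  forall (N : nat) (Omega omega : set (R3 R))
         (F : 'I_N -> set (R3 R)) (O : 'I_N -> R3 R)
         (K : R) (f v : R3 R -> R) (G : R3 R -> R3 R -> R),
  let eps := \big[Num.max/0]_(j < N) fine (ediam (F j)) in
  let d := 2^-1 * inf [set enorm (O p.1 - O p.2) | p in [set p | p.1 != p.2]] in
  let cap := fun j => harmonic_capacity (F j) in
  let maxcap := \big[Num.max/0]_(j < N) cap j in
  (2 <= N)%N ->
  domain Omega ->
  (forall j, [/\ compact (F j), F j `<=` Omega & 0 < cap j]) ->
  trivIset setT F ->
  (forall j, F j (O j)) ->
  eps < c0 * d ->
  [/\ open omega, omega `<=` Omega & \bigcup_j F j `<=` omega] ->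
  ediam omega = 1%E ->
  ((2 * d)%:E <= set_dist (boundary omega) (boundary Omega))%E ->
  ((2 * d)%:E <= set_dist (\bigcup_j F j) (boundary omega))%E ->
  test_function Omega f ->
  (ediam (supp f) <= K%:E)%E ->
  variational_solution Omega f v ->
  green_function Omega G ->
  let S : 'M[R]_N := \matrix_(i, k) ((1 - (i == k)%:R) * G (O k) (O i)) in
  let D : 'M[R]_N := (4 * pi) *: diag_mx (\row_j cap j) in
  let V : 'cV[R]_N := \col_j v (O j) in
  let C : 'cV[R]_N := - (invmx (1%:M + S *m D) *m V) in
  maxcap < 5 * d / (24 * pi) ->
  1%:M + S *m D \in unitmx /\
  \sum_(j < N) cap j * C j 0 ^+ 2 <=
    (1 - 24 * pi / (5 * d) * maxcap) ^- 2 *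
    \sum_(j < N) cap j * v (O j) ^+ 2.
Proof.
exists 1 => // N Om om F O K f v G eps d cap maxcap N2 [_ oOm _] hF tF FO heps [oom omOm Fom]
  _ _ hdist _ _ _ hG S D V C hmax.
have eps0 : 0 <= eps by exact: bigmax_ge_id.
have d0 : 0 < d by rewrite mul1r in heps; exact: le_lt_trans heps.
have sepO i k : i != k -> (2 * d) ^+ 2 <= sq (O i) (O k).
  move=> ik; have -> : 2 * d = inf [set enorm (O p.1 - O p.2) | p in [set p | p.1 != p.2]].
    by rewrite /d mulVKf.
  rewrite -enorm_sub_sq; apply: lerXn2r; rewrite ?nnegrE ?sqrtr_ge0 //.
    apply: lb_le_inf; first by exists (enorm (O i - O k)), (i, k).
    by move=> _ [p _ <-]; exact: sqrtr_ge0.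
  apply: ge_inf; first by exists 0 => _ [p _ <-]; exact: sqrtr_ge0.
  by exists (k, i) => //=; rewrite eq_sym.
have ballOm j x : sq (O j) x < (2 * d) ^+ 2 -> Om x.
  have FOj : (\bigcup_j F j) (O j) by exists j.
  by move=> hx; apply: omOm; exact: (ball_in_open d0 oom (Fom _ FOj) FOj hdist hx).
have cap0 j : 0 < cap j by have [] := hF j.
have capmax j : cap j <= maxcap by exact: le_bigmax.
have pi0 : 0 < pi :> R by exact: pi_gt0.
set k := 1 - 24 * pi / (5 * d) * maxcap.
have k0 : 0 < k.
  rewrite subr_gt0; have e : 1 = 24 * pi / (5 * d) * (5 * d / (24 * pi)) :> R.
    by move: (pi : R) pi0 => p p0; field; rewrite !gt_eqF.
  by rewrite [ltRHS]e ltr_pM2l // divr_gt0 // mulr_gt0.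
pose A := 1%:M + S *m D.
have SDE (x : 'cV[R]_N) i : (A *m x) i 0 =
    x i 0 + 4 * pi * \sum_k ((1 - (i == k)%:R) * G (O k) (O i)) * (cap k * x k 0).
  rewrite mulmxDl mul1mx mxE -mulmxA /D -scalemxAl -scalemxAr mxE [X in _ * X]mxE.
  by congr (_ + _ * _); apply: eq_bigr => l _; rewrite mul_diag_mx !mxE.
have coerc (x : 'cV[R]_N) : k * \sum_j cap j * x j 0 ^+ 2 <=
    \sum_j cap j * x j 0 * (A *m x) j 0.
  have -> : \sum_j cap j * x j 0 * (A *m x) j 0 = \sum_j cap j * x j 0 ^+ 2 +
      4 * pi * \sum_i \sum_l (cap i * x i 0) * (cap l * x l 0) *
        ((1 - (i == l)%:R) * G (O l) (O i)).
    rewrite mulr_sumr -big_split /=; apply: eq_bigr => i _; rewrite SDE mulrDr; congr (_ + _).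
      by rewrite expr2 mulrA.
    rewrite mulrCA mulr_sumr; congr (_ * _); apply: eq_bigr => l _.
    by rewrite -[RHS]mulrA; congr (_ * _); rewrite mulrC.
  have := green_matrix_coercive d0 oOm hG ballOm sepO (fun i => cap i * x i 0).
  set Q := \sum_i \sum_l _ => hQ.
  have h2 : \sum_i (cap i * x i 0) ^+ 2 <= maxcap * \sum_i cap i * x i 0 ^+ 2.
    rewrite mulr_sumr; apply: ler_sum => i _; rewrite exprMn expr2 -mulrA.
    by rewrite ler_wpM2r ?capmax // mulr_ge0 ?sqr_ge0 // ltW ?cap0.
  set X := \sum_i cap i * x i 0 ^+ 2 in h2 *.
  have c1 : 0 <= 6 / (5 * d) by rewrite divr_ge0 // mulr_ge0 // ltW.
  have h3 := ler_wpM2l c1 h2.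
  have h4 : - (6 / (5 * d)) * (maxcap * X) <= Q.
    by apply: le_trans hQ; rewrite !mulNr lerN2.
  have p4 : 0 <= 4 * pi :> R by rewrite mulr_ge0 // ltW.
  have h5 := ler_wpM2l p4 h4.
  have -> : k * X = X + 4 * pi * (- (6 / (5 * d)) * (maxcap * X)).
    by rewrite /k; move: (pi : R) (X) (maxcap) => p Y M; field; rewrite gt_eqF.
  by rewrite lerD2l.
have unitA : A \in unitmx by exact: weighted_coercive_unitmx k0 cap0 coerc.
split => //.
have AC : A *m C = - V by rewrite /C mulmxN mulKVmx.
have := weighted_coercive_bound k0 cap0 (coerc C) AC.
by rewrite [X in _ * X](eq_bigr (fun j => cap j * v (O j) ^+ 2)) // => j _; rewrite mxE.
Qed.
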